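(* Let $1<p<\infty$, $d\ge1$, and let $M$ be a nonempty compact subset of $\mathbb{R}^d$. Then there exists a trivial isomorphic extension $\theta_M$ of $K(l^p)$ by $C(M)$ such that $[\theta_M]=[\theta_M]+[\theta_M]$ and such that for every isomorphic extension $\phi$ of $K(l^p)$ by $C(M)$ there exists an isomorphic extension $\phi^{(-1)}$ of $K(l^p)$ by $C(M)$ with $[\theta_M]=[\phi]+[\phi^{(-1)}]$. Moreover, $\theta_M$ is unique up to equivalence (any two isomorphic extensions with these properties are equivalent).
   Context: $C(M)$ is the Banach algebra of continuous complex functions on $M$ with sup norm. $\pi:B(l^p)\to B(l^p)/K(l^p)$ is the quotient map. A homomorphism $\phi:\mathcal{A}_1\to\mathcal{A}_2$ of Banach algebras is an isomorphism (into) if there is $C\ge1$ with $C^{-1}\|a\|\le\|\phi(a)\|\le C\|a\|$ for all $a$. For a separable unital Banach algebra $\mathcal{A}$, an isomorphic extension of $K(l^p)$ by $\mathcal{A}$ is a unital isomorphism (into) $\phi:\mathcal{A}\to B(l^p)/K(l^p)$; it is trivial if $\phi=\pi\circ\rho$ for some unital isomorphism (into) $\rho:\mathcal{A}\to B(l^p)$. Two isomorphic extensions $\phi_1,\phi_2$ are equivalent if there is an invertible $S\in B(l^p)$ with $\phi_2(a)=\pi(S)\phi_1(a)\pi(S)^{-1}$ for all $a$; $[\phi]$ denotes the equivalence class. The sum is $[\phi_1]+[\phi_2]=[\phi]$ where $\phi(a)=\pi(S_0(T_1\oplus T_2)S_0^{-1})$, with $T_i\in B(l^p)$ any operators satisfying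 $\pi(T_i)=\phi_i(a)$ and $S_0:l^p\oplus l^p\to l^p$ any invertible operator; this makes the set of classes a commutative semigroup. *)

(* Defs.v *)
From Stdlib Require Import Reals Lra List.
Open Scope R_scope.

Definition CC := (R * R)%type.
Definition C0 : CC := (0, 0).
Definition C1 : CC := (1, 0).
Definition Cadd (a b : CC) : CC := (fst a + fst b, snd a + snd b).
Definition Copp (a : CC) : CC := (- fst a, - snd a).
Definition Cmul (a b : CC) : CC :=
  (fst a * fst b - snd a * snd b, fst a * snd b + snd a * fst b).
Definition Cnorm (a : CC) : R := sqrt (fst a * fst a + snd a * snd a).

(* power x^p for x >= 0 (with 0^p = 0, p > 0) *)
Definition rpow (x p : R) : R := if Rlt_dec 0 x then Rpower x p else 0.

Definition vec := nat -> CC.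
Definition vadd (x y : vec) : vec := fun n => Cadd (x n) (y n).
Definition vsub (x y : vec) : vec := fun n => Cadd (x n) (Copp (y n)).
Definition vscale (c : CC) (x : vec) : vec := fun n => Cmul c (x n).
Definition veq (x y : vec) : Prop := forall n, x n = y n.

Definition lp_norm_le (p : R) (x : vec) (r : R) : Prop :=
  0 <= r /\ forall N, sum_f_R0 (fun n => rpow (Cnorm (x n)) p) N <= rpow r p.
Definition lp (p : R) (x : vec) : Prop := exists r, lp_norm_le p x r.

Definition op := vec -> vec.
Definition op_id : op := fun x => x.
Definition op_comp (T S : op) : op := fun x => T (S x).
Definition op_sub (T S : op) : op := fun x => vsub (T x) (S x).
Definition op_add (T S : op) : op := fun x => vadd (T x) (S x).
Definition op_scale (c : CC) (T : op) : op := fun x => vscale c (T x).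
Definition op_eq (p : R) (T S : op) : Prop := forall x, lp p x -> veq (T x) (S x).

Definition op_bound (p : R) (T : op) (r : R) : Prop :=
  forall x s, lp_norm_le p x s -> lp_norm_le p (T x) (r * s).

Definition bdd (p : R) (T : op) : Prop :=
  (forall x y, lp p x -> lp p y -> veq (T (vadd x y)) (vadd (T x) (T y))) /\
  (forall c x, lp p x -> veq (T (vscale c x)) (vscale c (T x))) /\
  exists r, op_bound p T r.

Definition compact_op (p : R) (T : op) : Prop :=
  bdd p T /\
  forall eps, 0 < eps -> exists ys : list vec,
    forall x, lp_norm_le p x 1 ->
      exists y, In y ys /\ lp_norm_le p (vsub (T x) y) eps.

Definition calk_eq (p : R) (T S : op) : Prop := compact_op p (op_sub T S).

Definition calk_norm_le (p : R) (T : op) (r : R) : Prop :=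
  forall eps, 0 < eps -> exists K, compact_op p K /\ op_bound p (op_add T K) (r + eps).

Definition invertible_op (p : R) (S S' : op) : Prop :=
  bdd p S /\ bdd p S' /\ op_eq p (op_comp S S') op_id /\ op_eq p (op_comp S' S) op_id.

(* points of R^d are sequences; only the first d coordinates are used and the
   points of M are required to vanish beyond d (canonical embedding). *)
Definition pt := nat -> R.
Definition dist (d : nat) (x y : pt) : R :=
  sqrt (sum_f_R0 (fun i => (x i - y i) * (x i - y i)) (d - 1)).
Definition in_Rd (d : nat) (M : pt -> Prop) : Prop :=
  forall x, M x -> forall i, (d <= i)%nat -> x i = 0.
Definition open_set (d : nat) (U : pt -> Prop) : Prop :=
  forall x, U x -> exists r, 0 < r /\ forall y, dist d x y < r -> U y.
Definition compact_set (d : nat) (M : pt -> Prop) : Prop :=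
  forall (I : Type) (U : I -> pt -> Prop),
    (forall i, open_set d (U i)) ->
    (forall x, M x -> exists i, U i x) ->
    exists l : list I, forall x, M x -> exists i, In i l /\ U i x.

Definition fn := pt -> CC.
Definition cont_on (d : nat) (M : pt -> Prop) (f : fn) : Prop :=
  forall x, M x -> forall eps, 0 < eps -> exists del, 0 < del /\
    forall y, M y -> dist d x y < del -> Cnorm (Cadd (f y) (Copp (f x))) < eps.
Definition sup_le (M : pt -> Prop) (f : fn) (s : R) : Prop :=
  forall x, M x -> Cnorm (f x) <= s.
Definition fadd (f g : fn) : fn := fun x => Cadd (f x) (g x).
Definition fmul (f g : fn) : fn := fun x => Cmul (f x) (g x).
Definition fscale (c : CC) (f : fn) : fn := fun x => Cmul c (f x).
Definition fone : fn := fun _ => C1.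
Definition feq (M : pt -> Prop) (f g : fn) : Prop := forall x, M x -> f x = g x.

(* An isomorphic extension phi : C(M) -> B(l^p)/K(l^p) is represented by a
   choice of lifts Phi f in B(l^p) with pi(Phi f) = phi(f). *)
Definition is_ext (p : R) (d : nat) (M : pt -> Prop) (Phi : fn -> op) : Prop :=
  (forall f, cont_on d M f -> bdd p (Phi f)) /\
  (forall f g, cont_on d M f -> cont_on d M g -> feq M f g -> calk_eq p (Phi f) (Phi g)) /\
  (forall f g, cont_on d M f -> cont_on d M g ->
     calk_eq p (Phi (fadd f g)) (op_add (Phi f) (Phi g))) /\
  (forall c f, cont_on d M f -> calk_eq p (Phi (fscale c f)) (op_scale c (Phi f))) /\
  (forall f g, cont_on d M f -> cont_on d M g ->
     calk_eq p (Phi (fmul f g)) (op_comp (Phi f) (Phi g))) /\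
  calk_eq p (Phi fone) op_id /\
  exists C, 1 <= C /\ forall f, cont_on d M f ->
    (forall s, calk_norm_le p (Phi f) s -> sup_le M f (C * s)) /\
    (forall s, sup_le M f s -> calk_norm_le p (Phi f) (C * s)).

Definition is_iso_into_B (p : R) (d : nat) (M : pt -> Prop) (rho : fn -> op) : Prop :=
  (forall f, cont_on d M f -> bdd p (rho f)) /\
  (forall f g, cont_on d M f -> cont_on d M g -> feq M f g -> op_eq p (rho f) (rho g)) /\
  (forall f g, cont_on d M f -> cont_on d M g ->
     op_eq p (rho (fadd f g)) (op_add (rho f) (rho g))) /\
  (forall c f, cont_on d M f -> op_eq p (rho (fscale c f)) (op_scale c (rho f))) /\
  (forall f g, cont_on d M f -> cont_on d M g ->
     op_eq p (rho (fmul f g)) (op_comp (rho f) (rho g))) /\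
  op_eq p (rho fone) op_id /\
  exists C, 1 <= C /\ forall f, cont_on d M f ->
    (forall s, op_bound p (rho f) s -> sup_le M f (C * s)) /\
    (forall s, sup_le M f s -> op_bound p (rho f) (C * s)).

Definition trivial_ext (p : R) (d : nat) (M : pt -> Prop) (Phi : fn -> op) : Prop :=
  exists rho, is_iso_into_B p d M rho /\
    forall f, cont_on d M f -> calk_eq p (Phi f) (rho f).

Definition equiv_ext (p : R) (d : nat) (M : pt -> Prop) (Phi1 Phi2 : fn -> op) : Prop :=
  exists S S', invertible_op p S S' /\
    forall f, cont_on d M f -> calk_eq p (Phi2 f) (op_comp S (op_comp (Phi1 f) S')).

(* the sum, using the invertible S0 : l^p (+) l^p -> l^p, (u,v) |-> interleave *)
Definition evens (x : vec) : vec := fun n => x (2 * n)%nat.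
Definition odds (x : vec) : vec := fun n => x (2 * n + 1)%nat.
Definition interleave (u v : vec) : vec :=
  fun n => if Nat.even n then u (Nat.div2 n) else v (Nat.div2 n).
Definition sum_ext (Phi1 Phi2 : fn -> op) : fn -> op :=
  fun f x => interleave (Phi1 f (evens x)) (Phi2 f (odds x)).

(* Main.v *)
(** Let [T] be a lift of an extension of K(l^p) by C(M). At scale [n] choose a grid partition of
    unity [sum_i h_i^2 = 1] on [M], subordinate to points [x_i], whose multiplicity is bounded in
    terms of [d] only, and a finite-rank cutoff [g_n] that almost commutes with finitely many of
    the operators [T f] ([sum_n g_n = 1]). Averaging over signs, the maps [x |-> (sum_i eps_i
    T(h_i) g_n x)_eps] and [(y_eps) |-> g'_n E_eps (sum_i eps_i T(h_i)) y_eps] between l^p and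
    L^p({-1,1}^k; l^p) are bounded uniformly in [n], because [sum_i eps_i h_i] is bounded
    uniformly. On the span of the Rademacher functions, which is complemented uniformly in [k] by
    Khinchine's inequality, let [f] act by [eps_i |-> f(x_i) eps_i], and on the complement by the
    scalar [f(x_0)]; the l^p-sum over [n] of these actions is a representation [rho] of C(M) on
    l^p that does not depend on [T]. The maps above add up to [V] and [W] with [W V = 1] that
    intertwine [T] and [rho] modulo the compacts. With [N = 1 - V W], the involution with matrix
    [(0, W; V, N)] conjugates the direct sum of [f(x_0)] and [rho(f)] into that of [T(f)] and
    [f(x_0) V W + N rho(f) N], so every extension is a direct summand of the sum [theta] of
    [f(x_0)] and [rho(f)]. As [rho] has infinite multiplicity, [theta] absorbs itself; the
    uniqueness is formal. *)

From Stdlib Require Import Reals Lra Lia List ZArith Cantor.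
From Stdlib Require Import ClassicalEpsilon FunctionalExtensionality Classical.
From Stdlib Require Import Morphisms.
From Coquelicot Require Import Complex Hierarchy(eventually, filter_and, filter_imp)
  Rcomplements(Rabs_le_between).
(* After [Reals], which has its own [C1]. *)
Require Import Defs.
Import ListNotations.
Open Scope R_scope.

Section FiniteLists.
Context {A : Type}.

Lemma list_common_witness {B : Type} (valid : B -> Prop) (le : B -> B -> Prop) (Q : A -> B -> Prop)
  (b0 : B) (l : list A) :
  valid b0 ->
  (forall b b', valid b -> valid b' -> exists c, valid c /\ le b c /\ le b' c) ->
  (forall a b c, le b c -> Q a b -> Q a c) ->
  (forall a, In a l -> exists b, valid b /\ Q a b) ->
  exists b, valid b /\ forall a, In a l -> Q a b.
Proof.
  intros b0_valid directed Q_mono. induction l as [|a l IH]; intros witness.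
  - exists b0. split; auto. intros a [].
  - destruct (witness a) as (b & b_valid & Qb); [left; auto|].
    destruct IH as (b' & b'_valid & Qb'); [intros; apply witness; right; auto|].
    destruct (directed b b') as (c & c_valid & b_le & b'_le); auto.
    exists c. split; auto. intros a' [<-|a'_in]; [apply Q_mono with b|apply Q_mono with b']; auto.
Qed.

Lemma list_common_bound (l : list A) (Q : A -> R -> Prop) :
  (forall a r s, r <= s -> Q a r -> Q a s) ->
  (forall a, In a l -> exists r, 0 <= r /\ Q a r) ->
  exists r, 0 <= r /\ forall a, In a l -> Q a r.
Proof.
  intros Q_mono. apply list_common_witness with (le := Rle) (b0 := 0); [lra| |apply Q_mono].
  intros r s r_nonneg s_nonneg. exists (r + s). lra.
Qed.

Lemma list_common_radius (l : list A) (Q : A -> R -> Prop) :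
  (forall a r s, s <= r -> Q a r -> Q a s) ->
  (forall a, In a l -> exists r, 0 < r /\ Q a r) ->
  exists r, 0 < r /\ forall a, In a l -> Q a r.
Proof.
  intros Q_mono. apply list_common_witness with (le := Rge) (b0 := 1); [lra| |].
  - intros r s r_pos s_pos. exists (Rmin r s).
    split; [apply Rmin_glb_lt; auto|split; apply Rle_ge; [apply Rmin_l|apply Rmin_r]].
  - intros a r s s_le. apply Q_mono, Rge_le, s_le.
Qed.

Lemma list_pigeonhole (l : list A) (Q : A -> nat -> Prop) :
  (forall a m m', (m <= m')%nat -> Q a m' -> Q a m) ->
  (forall m, exists a, In a l /\ Q a m) -> exists a, In a l /\ forall m, Q a m.
Proof.
  intros Q_anti often. apply NNPP. intros none.
  destruct (list_common_witness (fun _ => True) le (fun a m => ~ Q a m) 0%nat l)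
    as (m & _ & never); auto.
  - intros m m' _ _. exists (Nat.max m m'). repeat split; lia.
  - intros a m m' m_le not_Q Qm'. apply not_Q, Q_anti with m'; auto.
  - intros a a_in. apply NNPP. intros always. apply none. exists a. split; auto.
    intros m. apply NNPP. intros not_Q. apply always. exists m. auto.
  - destruct (often m) as (a & a_in & Qm). exact (never a a_in Qm).
Qed.

Lemma eventually_list (l : list A) (Q : A -> nat -> Prop) :
  (forall a, In a l -> eventually (Q a)) -> eventually (fun m => forall a, In a l -> Q a m).
Proof.
  intros ev. destruct (list_common_witness (fun _ => True) le
    (fun a N => forall m, (N <= m)%nat -> Q a m) 0%nat l)
    as (N & _ & from_N); auto.
  - intros m m' _ _. exists (Nat.max m m'). repeat split; lia.
  - intros a N N' N_le from_N m m_ge. apply from_N. lia.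
  - intros a a_in. destruct (ev a a_in) as [N from_N]. eauto.
  - exists N. intros m m_ge a a_in. apply from_N; auto.
Qed.

End FiniteLists.

Lemma uniform_bound_of_tail (Q : nat -> R -> Prop) (N : nat) (r : R) : 0 <= r ->
  (forall n s t, s <= t -> Q n s -> Q n t) -> (forall n, (N <= n)%nat -> Q n r) ->
  (forall n, exists s, 0 <= s /\ Q n s) -> exists s, 0 <= s /\ forall n, Q n s.
Proof.
  intros r_nonneg Q_mono from_N bounds.
  destruct (list_common_bound (seq 0 N) Q Q_mono) as (s & s_nonneg & below_N); [auto|].
  exists (r + s). split; [lra|]. intros n. destruct (le_lt_dec N n) as [n_ge|n_lt].
  - apply Q_mono with r; [lra|auto].
  - apply Q_mono with s; [lra|]. apply below_N, in_seq. lia.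
Qed.

Lemma eventually_below (N : nat) (Q : nat -> nat -> Prop) :
  (forall i, (i < N)%nat -> eventually (Q i)) ->
  eventually (fun m => forall i, (i < N)%nat -> Q i m).
Proof.
  intros ev. apply filter_imp with (fun m => forall i, In i (seq 0 N) -> Q i m).
  - intros m Qm i i_lt. apply Qm, in_seq. lia.
  - apply eventually_list. intros i i_in. apply in_seq in i_in. apply ev. lia.
Qed.

Lemma monotone_of_steps {A : Type} (le : A -> A -> Prop) `{Reflexive A le} `{Transitive A le}
  (f : nat -> A) :
  (forall n, le (f n) (f (S n))) -> forall m n, (m <= n)%nat -> le (f m) (f n).
Proof. intros step m n m_le. induction m_le; [reflexivity|]. etransitivity; eauto. Qed.

Class comm_monoid {A : Type} (add : A -> A -> A) (zero : A) : Prop := {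
  monoid_assoc : forall a b c, add a (add b c) = add (add a b) c;
  monoid_comm : forall a b, add a b = add b a;
  monoid_unit : forall a, add zero a = a }.

Fixpoint msum {A : Type} (add : A -> A -> A) (zero : A) (n : nat) (F : nat -> A) : A :=
  match n with O => zero | S m => add (msum add zero m F) (F m) end.

Lemma msum_ext {A : Type} (add : A -> A -> A) (zero : A) (n : nat) (F G : nat -> A) :
  (forall i, (i < n)%nat -> F i = G i) -> msum add zero n F = msum add zero n G.
Proof.
  induction n as [|n IH]; intros FG; simpl; auto.
  rewrite IH, FG by auto. reflexivity.
Qed.

Lemma msum_proper {A : Type} (add : A -> A -> A) (zero : A) (eqv : A -> A -> Prop)
  {eqv_refl : Reflexive eqv} {add_eqv : Proper (eqv ==> eqv ==> eqv) add}
  (n : nat) (F G : nat -> A) :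
  (forall i, (i < n)%nat -> eqv (F i) (G i)) -> eqv (msum add zero n F) (msum add zero n G).
Proof. induction n as [|n IH]; intros FG; simpl; [reflexivity|]. apply add_eqv; auto. Qed.

Lemma msum_morph {A B : Type} (add : A -> A -> A) (zero : A) (add' : B -> B -> B) (zero' : B)
  (phi : A -> B) (n : nat) (F : nat -> A) :
  phi zero = zero' -> (forall a b, phi (add a b) = add' (phi a) (phi b)) ->
  phi (msum add zero n F) = msum add' zero' n (fun i => phi (F i)).
Proof.
  intros phi_zero phi_add; induction n as [|n IH]; simpl; auto.
  rewrite phi_add, IH. reflexivity.
Qed.

Section MonoidSums.
Context {A : Type} {add : A -> A -> A} {zero : A} {monoid : comm_monoid add zero}.
Local Notation sum := (msum add zero).

Let add_zero_l (a : A) : add zero a = a.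
Proof. apply monoid_unit. Qed.

Let add_zero_r (a : A) : add a zero = a.
Proof. rewrite monoid_comm. apply monoid_unit. Qed.

Lemma msum_zero (n : nat) (F : nat -> A) :
  (forall i, (i < n)%nat -> F i = zero) -> sum n F = zero.
Proof.
  induction n as [|n IH]; intros F_zero; simpl; auto.
  rewrite IH, F_zero by auto. apply add_zero_l.
Qed.

Lemma msum_add (n : nat) (F G : nat -> A) :
  sum n (fun i => add (F i) (G i)) = add (sum n F) (sum n G).
Proof.
  induction n as [|n IH]; simpl; [symmetry; apply add_zero_l|].
  rewrite IH, !monoid_assoc. f_equal. rewrite <- !monoid_assoc. f_equal. apply monoid_comm.
Qed.

Lemma msum_swap (n m : nat) (F : nat -> nat -> A) :
  sum n (fun i => sum m (F i)) = sum m (fun j => sum n (fun i => F i j)).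
Proof.
  induction n as [|n IH]; simpl.
  - symmetry. apply msum_zero; auto.
  - rewrite IH, <- msum_add. reflexivity.
Qed.

Lemma msum_split (n m : nat) (F : nat -> A) :
  sum (n + m) F = add (sum n F) (sum m (fun i => F (n + i)%nat)).
Proof.
  induction m as [|m IH]; simpl.
  - rewrite Nat.add_0_r, add_zero_r. reflexivity.
  - rewrite Nat.add_succ_r, monoid_assoc, <- IH. reflexivity.
Qed.

Lemma msum_S_first (n : nat) (F : nat -> A) :
  sum (S n) F = add (F 0%nat) (sum n (fun i => F (S i))).
Proof. rewrite (msum_split 1 n). simpl. rewrite add_zero_l. reflexivity. Qed.

Lemma msum_single (n k : nat) (F : nat -> A) :
  (k < n)%nat -> (forall i, (i < n)%nat -> i <> k -> F i = zero) -> sum n F = F k.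
Proof.
  intros k_lt F_zero. replace n with (k + S (n - S k))%nat by lia.
  rewrite msum_split, msum_S_first, !msum_zero, add_zero_l, add_zero_r, Nat.add_0_r
    by (intros; apply F_zero; lia).
  reflexivity.
Qed.

Lemma msum_two_terms (n k : nat) (F : nat -> A) :
  (S k < n)%nat -> (forall i, i <> k -> i <> S k -> F i = zero) ->
  sum n F = add (F k) (F (S k)).
Proof.
  intros k_lt F_zero. replace n with (k + S (S (n - S (S k))))%nat by lia.
  rewrite msum_split, !msum_S_first, !msum_zero, add_zero_l, add_zero_r, Nat.add_0_r, Nat.add_1_r
    by (intros; apply F_zero; lia).
  reflexivity.
Qed.

Lemma msum_mul (k m : nat) (F : nat -> nat -> A) : (0 < m)%nat ->
  sum (k * m) (fun t => F (t / m)%nat (t mod m)%nat) = sum k (fun i => sum m (F i)).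
Proof.
  intros m_pos. induction k as [|k IH]; [reflexivity|].
  replace (S k * m)%nat with (k * m + m)%nat by lia. rewrite msum_split, IH. simpl. f_equal.
  apply msum_ext. intros i i_lt. f_equal.
  - rewrite Nat.div_add_l, Nat.div_small by lia. lia.
  - rewrite Nat.add_comm, Nat.Div0.mod_add. apply Nat.mod_small. lia.
Qed.

Lemma msum_double (m : nat) (F : nat -> A) :
  sum (2 * m) F = sum m (fun e => add (F (2 * e)%nat) (F (2 * e + 1)%nat)).
Proof.
  induction m as [|m IH]; [reflexivity|].
  replace (2 * S m)%nat with (S (S (2 * m))) by lia.
  cbn [msum]. rewrite IH, Nat.add_1_r, monoid_assoc. reflexivity.
Qed.

End MonoidSums.

Notation rsum := (msum Rplus 0).

#[global] Instance Rplus_comm_monoid : comm_monoid Rplus 0.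
Proof. split; intros; ring. Qed.

Lemma rsum_scal (n : nat) (c : R) (F : nat -> R) : rsum n (fun i => c * F i) = c * rsum n F.
Proof. symmetry. apply (msum_morph Rplus 0 Rplus 0 (Rmult c)); intros; ring. Qed.

Lemma rsum_const (n : nat) (c : R) : rsum n (fun _ => c) = INR n * c.
Proof. induction n as [|n IH]; [simpl; lra|]. rewrite S_INR. simpl msum. rewrite IH. lra. Qed.

Lemma rsum_le (n : nat) (F G : nat -> R) :
  (forall i, (i < n)%nat -> F i <= G i) -> rsum n F <= rsum n G.
Proof. induction n as [|n IH]; intros FG; simpl; [lra|]. apply Rplus_le_compat; auto. Qed.

Lemma rsum_nonneg (n : nat) (F : nat -> R) :
  (forall i, (i < n)%nat -> 0 <= F i) -> 0 <= rsum n F.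
Proof.
  induction n as [|n IH]; intros F_nonneg; simpl; [lra|]. apply Rplus_le_le_0_compat; auto.
Qed.

Lemma rsum_mono (n m : nat) (F : nat -> R) :
  (n <= m)%nat -> (forall i, 0 <= F i) -> rsum n F <= rsum m F.
Proof.
  intros n_le F_nonneg. replace m with (n + (m - n))%nat by lia.
  rewrite msum_split.
  pose proof (rsum_nonneg (m - n) (fun i => F (n + i)%nat) (fun i _ => F_nonneg _)). lra.
Qed.

Lemma rsum_ge_term (n k : nat) (F : nat -> R) :
  (k < n)%nat -> (forall i, 0 <= F i) -> F k <= rsum n F.
Proof.
  intros k_lt F_nonneg. apply Rle_trans with (rsum (S k) F); [|apply rsum_mono; auto].
  simpl. pose proof (rsum_nonneg k F (fun i _ => F_nonneg i)). lra.
Qed.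

Lemma sum_f_R0_rsum (F : nat -> R) (N : nat) : sum_f_R0 F N = rsum (S N) F.
Proof. induction N as [|N IH]; simpl in *; [lra|]. rewrite IH. reflexivity. Qed.

Definition partial_injective (s : nat -> option nat) : Prop :=
  forall i i' j, s i = Some j -> s i' = Some j -> i = i'.

Lemma rsum_partial_injective_le (s : nat -> option nat) (a : nat -> R) (S : R) :
  partial_injective s -> (forall j, 0 <= a j) -> (forall K, rsum K a <= S) ->
  forall n, rsum n (fun i => match s i with Some j => a j | None => 0 end) <= S.
Proof.
  intros s_inj a_nonneg a_le n.
  assert (range : exists K, forall i j, (i < n)%nat -> s i = Some j -> (j < K)%nat).
  { induction n as [|n [K below_K]]; [exists 0%nat; intros; lia|].
    exists (K + match s n with Some j => Datatypes.S j | None => 0 end)%nat. intros i j i_lt si.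
    destruct (Nat.eq_dec i n) as [->|ne]; [rewrite si; lia|].
    specialize (below_K i j ltac:(lia) si). lia. }
  destruct range as [K below_K].
  set (hit i j := match s i with Some j' => if (j' =? j)%nat then a j else 0 | None => 0 end).
  assert (rows : forall i, (i < n)%nat ->
    match s i with Some j => a j | None => 0 end = rsum K (hit i)).
  { intros i i_lt. unfold hit. specialize (below_K i). destruct (s i) as [j|].
    - rewrite (msum_single K j), Nat.eqb_refl; auto.
      intros j' _ ne. destruct (Nat.eqb_spec j j'); [congruence|reflexivity].
    - rewrite msum_zero; auto. }
  rewrite (msum_ext _ _ n _ _ rows), msum_swap.
  eapply Rle_trans; [|apply (a_le K)]. apply rsum_le. intros j _.
  destruct (classic (exists i, (i < n)%nat /\ s i = Some j)) as [(i & i_lt & si)|none].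
  - rewrite (msum_single n i); unfold hit; auto.
    + rewrite si, Nat.eqb_refl. lra.
    + intros i' _ ne. destruct (s i') as [j'|] eqn:si'; auto.
      destruct (Nat.eqb_spec j' j) as [->|]; auto. destruct ne. eapply s_inj; eauto.
  - rewrite msum_zero; auto. intros i i_lt. unfold hit. destruct (s i) as [j'|] eqn:si; auto.
    destruct (Nat.eqb_spec j' j) as [->|]; auto. destruct none. eauto.
Qed.

Lemma fst_of_nat_le (t : nat) : (fst (of_nat t) <= t)%nat.
Proof.
  pose proof (cancel_to_of t) as cancel. destruct (of_nat t) as [n s].
  pose proof (to_nat_non_decreasing n s). simpl. lia.
Qed.

Lemma snd_of_nat_le (t : nat) : (snd (of_nat t) <= t)%nat.
Proof.
  pose proof (cancel_to_of t) as cancel. destruct (of_nat t) as [n s].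
  pose proof (to_nat_non_decreasing n s). simpl. lia.
Qed.

Lemma rsum_pairs_le (a : nat -> nat -> R) (S : R) : (forall n s, 0 <= a n s) ->
  (forall N, rsum N (fun t => a (fst (of_nat t)) (snd (of_nat t))) <= S) ->
  forall N M, rsum N (fun n => rsum M (a n)) <= S.
Proof.
  intros a_nonneg a_le N M. destruct (Nat.eq_dec M 0) as [->|M_pos].
  - rewrite msum_zero by auto. apply (a_le 0%nat).
  - rewrite <- msum_mul by lia.
    eapply Rle_trans; [right|
      apply (rsum_partial_injective_le (fun t => Some (to_nat (t / M, t mod M)%nat)));
        [|intros t; apply a_nonneg|exact a_le]].
    + apply msum_ext. intros t _. rewrite cancel_of_to. reflexivity.
    + intros t t' u code code'. rewrite <- code' in code.
      apply (f_equal (option_map of_nat)) in code. cbn [option_map] in code.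
      rewrite !cancel_of_to in code. injection code as div_eq mod_eq.
      rewrite (Nat.div_mod_eq t M), (Nat.div_mod_eq t' M). congruence.
Qed.

Lemma rsum_of_nat_le (a : nat -> nat -> R) (S : R) : (forall n s, 0 <= a n s) ->
  (forall N M, rsum N (fun n => rsum M (a n)) <= S) ->
  forall N, rsum N (fun t => a (fst (of_nat t)) (snd (of_nat t))) <= S.
Proof.
  intros a_nonneg a_le [|N]; [apply (a_le 0%nat 0%nat)|]. set (m := Datatypes.S N).
  set (s t := if (snd (of_nat t) <? m)%nat
    then Some (fst (of_nat t) * m + snd (of_nat t))%nat else None).
  assert (div_code : forall n r, (r < m)%nat -> ((n * m + r) / m = n)%nat)
    by (intros; rewrite Nat.div_add_l, Nat.div_small by lia; lia).
  assert (mod_code : forall n r, (r < m)%nat -> ((n * m + r) mod m = r)%nat)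
    by (intros; rewrite Nat.add_comm, Nat.Div0.mod_add; apply Nat.mod_small; lia).
  eapply Rle_trans;
    [right|apply (rsum_partial_injective_le s (fun u => a (u / m)%nat (u mod m)%nat)); auto].
  - apply msum_ext. intros t t_lt. unfold s. pose proof (snd_of_nat_le t).
    destruct (Nat.ltb_spec (snd (of_nat t)) m); [|unfold m in *; lia].
    rewrite div_code, mod_code by auto. reflexivity.
  - intros t t' u. unfold s. destruct (Nat.ltb_spec (snd (of_nat t)) m) as [r_lt|]; [|discriminate].
    destruct (Nat.ltb_spec (snd (of_nat t')) m) as [r_lt'|]; [|discriminate].
    intros code code'. assert (codes : (fst (of_nat t') * m + snd (of_nat t')
      = fst (of_nat t) * m + snd (of_nat t))%nat) by congruence.
    assert (fst_eq : fst (of_nat t) = fst (of_nat t')) by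
      (rewrite <- (div_code (fst (of_nat t)) _ r_lt), <- codes, div_code by auto; reflexivity).
    assert (snd_eq : snd (of_nat t) = snd (of_nat t')) by
      (rewrite <- (mod_code (fst (of_nat t)) _ r_lt), <- codes, mod_code by auto; reflexivity).
    rewrite <- (cancel_to_of t), <- (cancel_to_of t'), (surjective_pairing (of_nat t)),
      (surjective_pairing (of_nat t')), fst_eq, snd_eq. reflexivity.
  - intros K. apply Rle_trans with (rsum (K * m) (fun u => a (u / m)%nat (u mod m)%nat)).
    + apply rsum_mono; [unfold m; nia|auto].
    + rewrite msum_mul by (unfold m; lia). apply a_le.
Qed.

Lemma geometric_tail (N k : nat) : rsum k (fun i => (/ 2) ^ (N + i)) <= 2 * (/ 2) ^ N.
Proof.
  assert (rsum k (fun i => (/ 2) ^ (N + i)) = 2 * (/ 2) ^ N - 2 * (/ 2) ^ (N + k)) as ->.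
  { induction k as [|k IH]; simpl.
    - rewrite Nat.add_0_r. ring.
    - rewrite IH, Nat.add_succ_r. simpl. field. }
  pose proof (pow_lt (/ 2) (N + k) ltac:(lra)). lra.
Qed.

Create HintDb sign.
#[export] Hint Resolve Rabs_pos sqrt_pos exp_pos pow_lt Rmult_le_pos Rmult_lt_0_compat
  Rplus_le_le_0_compat Rinv_0_lt_compat Rdiv_lt_0_compat Rle_mult_inv_pos : sign.
#[export] Hint Extern 1 (0 <= _ / _) => apply Rle_mult_inv_pos : sign.
#[export] Hint Extern 1 (0 <= / _) => apply Rlt_le, Rinv_0_lt_compat : sign.
#[export] Hint Extern 1 (0 <= exp _) => apply Rlt_le, exp_pos : sign.
#[export] Hint Extern 3 (_ <= _) => lra : sign.
#[export] Hint Extern 3 (_ < _) => lra : sign.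
#[export] Hint Extern 2 (_ <> 0) => apply not_eq_sym, Rlt_not_eq : sign.
Ltac positivity := solve [auto 10 with sign].

(** * Real powers *)

Lemma Rpower_weighted_AMGM (a b t : R) :
  0 < a -> 0 < b -> 0 <= t <= 1 ->
  Rpower a t * Rpower b (1 - t) <= t * a + (1 - t) * b.
Proof.
  intros a_pos b_pos t_range. set (m := t * ln a + (1 - t) * ln b).
  replace (Rpower a t * Rpower b (1 - t)) with (exp m)
    by (unfold Rpower, m; rewrite exp_plus; reflexivity).
  assert (tangent : forall c, 0 < c -> exp m * (1 + (ln c - m)) <= c).
  { intros c c_pos. replace c with (exp m * exp (ln c - m)) at 2.
    - apply Rmult_le_compat_l; [positivity|apply exp_ineq1_le].
    - rewrite <- exp_plus. replace (m + (ln c - m)) with (ln c) by ring. apply exp_ln; auto. }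
  apply Rle_trans with (t * (exp m * (1 + (ln a - m))) + (1 - t) * (exp m * (1 + (ln b - m)))).
  - right. unfold m. ring.
  - apply Rplus_le_compat; apply Rmult_le_compat_l; auto; lra.
Qed.

Lemma rpow_nonneg (x p : R) : 0 <= rpow x p.
Proof. unfold rpow. destruct (Rlt_dec 0 x); [apply Rlt_le, exp_pos|lra]. Qed.

Lemma rpow_pos (x p : R) : 0 < x -> 0 < rpow x p.
Proof. intros. unfold rpow. destruct (Rlt_dec 0 x); [apply exp_pos|lra]. Qed.

#[export] Hint Resolve rpow_nonneg rpow_pos : sign.

Lemma rpow_Rpower (x p : R) : 0 < x -> rpow x p = Rpower x p.
Proof. intros. unfold rpow. destruct (Rlt_dec 0 x); [reflexivity|lra]. Qed.

Lemma rpow_0 (p : R) : rpow 0 p = 0.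
Proof. unfold rpow. destruct (Rlt_dec 0 0); lra. Qed.

Lemma rpow_1 (p : R) : rpow 1 p = 1.
Proof. rewrite rpow_Rpower by lra. unfold Rpower. rewrite ln_1, Rmult_0_r. apply exp_0. Qed.

Lemma rpow_exponent_1 (x : R) : 0 <= x -> rpow x 1 = x.
Proof. intros [x_pos|<-]; [|apply rpow_0]. rewrite rpow_Rpower by auto. apply Rpower_1; auto. Qed.

Lemma rpow_le (x y p : R) : 0 <= p -> 0 <= x <= y -> rpow x p <= rpow y p.
Proof.
  intros p_nonneg [[x_pos|<-] x_le]; [|rewrite rpow_0; positivity].
  rewrite !rpow_Rpower by lra. apply Rle_Rpower_l; lra.
Qed.

Lemma rpow_mult_distr (x y p : R) : 0 <= x -> 0 <= y -> rpow (x * y) p = rpow x p * rpow y p.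
Proof.
  intros [x_pos|<-] [y_pos|<-]; rewrite ?Rmult_0_l, ?Rmult_0_r, ?rpow_0; try ring.
  rewrite !rpow_Rpower by positivity. symmetry. apply Rpower_mult_distr; auto.
Qed.

Lemma rpow_rpow (x p q : R) : 0 <= x -> rpow (rpow x p) q = rpow x (p * q).
Proof.
  intros [x_pos|<-]; [|rewrite !rpow_0; reflexivity].
  rewrite rpow_Rpower, !(rpow_Rpower x) by positivity. apply Rpower_mult.
Qed.

Lemma rpow_plus (x p q : R) : 0 <= x -> rpow x (p + q) = rpow x p * rpow x q.
Proof.
  intros [x_pos|<-]; [|rewrite !rpow_0; ring].
  rewrite !rpow_Rpower by auto. apply Rpower_plus.
Qed.

Lemma rpow_Rinv (x p : R) : 0 < x -> rpow (/ x) p = / rpow x p.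
Proof.
  intros x_pos. pose proof (rpow_pos x p x_pos). apply Rmult_eq_reg_l with (rpow x p); [|lra].
  rewrite <- rpow_mult_distr, !Rinv_r, rpow_1 by positivity. reflexivity.
Qed.

Lemma rpow_rpow_Rinv (x p : R) : 0 < p -> 0 <= x -> rpow (rpow x p) (/ p) = x.
Proof. intros. rewrite rpow_rpow, Rinv_r by lra. apply rpow_exponent_1; auto. Qed.

Lemma rpow_Rinv_rpow (x p : R) : 0 < p -> 0 <= x -> rpow (rpow x (/ p)) p = x.
Proof. intros. rewrite rpow_rpow, Rinv_l by lra. apply rpow_exponent_1; auto. Qed.

Lemma rpow_le_reg (x y p : R) : 0 < p -> 0 <= x -> 0 <= y -> rpow x p <= rpow y p -> x <= y.
Proof.
  intros. rewrite <- (rpow_rpow_Rinv x p), <- (rpow_rpow_Rinv y p) by auto.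
  apply rpow_le; [|split]; positivity.
Qed.

Lemma rpow_le_self (x p : R) : 1 <= p -> 0 <= x <= 1 -> rpow x p <= x.
Proof.
  intros p_ge1 [x_nonneg x_le1]. replace p with (1 + (p - 1)) by ring.
  rewrite rpow_plus, rpow_exponent_1 by auto.
  assert (rpow x (p - 1) <= 1) by (rewrite <- (rpow_1 (p - 1)) at 2; apply rpow_le; lra).
  pose proof (rpow_nonneg x (p - 1)). nra.
Qed.

Lemma rpow_Bernoulli (u p : R) : 1 <= p -> 0 <= u -> 1 + p * (u - 1) <= rpow u p.
Proof.
  intros p_ge1 u_nonneg. set (w := 1 + p * (u - 1)).
  destruct (Rle_dec w 0) as [w_neg|w_pos]; [pose proof (rpow_nonneg u p); lra|].
  apply Rnot_le_lt in w_pos.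
  assert (u_mean : u = / p * w + (1 - / p) * 1) by (unfold w; field; lra).
  assert (p_inv : 0 <= / p <= 1).
  { split; [positivity|]. rewrite <- Rinv_1. apply Rinv_le_contravar; lra. }
  pose proof (Rpower_weighted_AMGM w 1 (/ p) w_pos Rlt_0_1 p_inv) as AMGM.
  rewrite <- u_mean, <- !rpow_Rpower, rpow_1, Rmult_1_r in AMGM by lra.
  rewrite <- (rpow_Rinv_rpow w p) by lra. apply rpow_le; [lra|]. split; positivity.
Qed.

Lemma rpow_convex (x y t p : R) : 1 <= p -> 0 <= x -> 0 <= y -> 0 <= t <= 1 ->
  rpow (t * x + (1 - t) * y) p <= t * rpow x p + (1 - t) * rpow y p.
Proof.
  intros p_ge1 x_nonneg y_nonneg t_range. set (m := t * x + (1 - t) * y).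
  assert (m_nonneg : 0 <= m) by (unfold m; positivity).
  destruct m_nonneg as [m_pos|m_zero].
  - assert (tangent : forall c, 0 <= c -> rpow m p * (1 + p * (c / m - 1)) <= rpow c p).
    { intros c c_nonneg. replace c with (m * (c / m)) at 2 by (field; lra).
      rewrite rpow_mult_distr by positivity.
      apply Rmult_le_compat_l; [|apply rpow_Bernoulli]; positivity. }
    apply Rle_trans with (t * (rpow m p * (1 + p * (x / m - 1)))
                          + (1 - t) * (rpow m p * (1 + p * (y / m - 1)))).
    + right. transitivity (rpow m p * (1 + p * ((t * x + (1 - t) * y) / m - 1))).
      * fold m. field. lra.
      * field. lra.
    + apply Rplus_le_compat; apply Rmult_le_compat_l; auto; lra.
  - rewrite <- m_zero, rpow_0. positivity.
Qed.

Lemma rpow_add_le (x y p : R) : 1 <= p -> 0 <= x -> 0 <= y ->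
  rpow (x + y) p <= rpow 2 p * (rpow x p + rpow y p).
Proof.
  intros p_ge1 x_nonneg y_nonneg. replace (x + y) with (2 * (/ 2 * x + (1 - / 2) * y)) by field.
  rewrite rpow_mult_distr by lra. apply Rmult_le_compat_l; [positivity|].
  pose proof (rpow_convex x y (/ 2) p p_ge1 x_nonneg y_nonneg ltac:(lra)).
  pose proof (rpow_nonneg x p). pose proof (rpow_nonneg y p). lra.
Qed.

Lemma Young_inequality (x y p q : R) : 1 < p -> 0 < q -> / p + / q = 1 -> 0 <= x -> 0 <= y ->
  x * y <= rpow x p / p + rpow y q / q.
Proof.
  intros p_gt1 q_pos conjugate [x_pos|<-] [y_pos|<-];
    try (rewrite ?Rmult_0_l, ?Rmult_0_r, ?rpow_0; positivity).
  assert (0 < / p) by positivity. assert (0 < / q) by positivity.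
  pose proof (Rpower_weighted_AMGM (rpow x p) (rpow y q) (/ p)
    (rpow_pos _ _ x_pos) (rpow_pos _ _ y_pos) ltac:(lra)) as AMGM.
  rewrite <- !rpow_Rpower in AMGM by positivity.
  replace (1 - / p) with (/ q) in AMGM by lra.
  rewrite !rpow_rpow_Rinv in AMGM by lra. unfold Rdiv. lra.
Qed.

Lemma rpow_mean (n : nat) (a : nat -> R) (p : R) : 1 <= p -> (0 < n)%nat ->
  (forall i, 0 <= a i) ->
  rpow (rsum n a / INR n) p <= rsum n (fun i => rpow (a i) p) / INR n.
Proof.
  intros p_ge1 n_pos a_nonneg. induction n as [|[|n] IH]; [lia| |].
  - simpl. rewrite !Rplus_0_l, !Rdiv_1_r. lra.
  - specialize (IH ltac:(lia)). set (m := S n) in *.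
    assert (m_pos : 0 < INR m) by (apply lt_0_INR; lia).
    set (t := INR m / INR (S m)).
    assert (t_eq : 1 - t = / INR (S m)) by (unfold t; rewrite S_INR; field; lra).
    assert (t_range : 0 <= t <= 1).
    { split; [unfold t; rewrite S_INR; positivity|].
      assert (0 <= / INR (S m)) by (rewrite S_INR; positivity). lra. }
    assert (mean_S : forall b, rsum (S m) b / INR (S m) = t * (rsum m b / INR m) + (1 - t) * b m).
    { intros b. rewrite t_eq. unfold t. simpl msum. rewrite S_INR. field. lra. }
    rewrite !mean_S. eapply Rle_trans.
    + apply rpow_convex; auto. apply Rle_mult_inv_pos; [apply rsum_nonneg|]; auto.
    + apply Rplus_le_compat_r, Rmult_le_compat_l; lra.
Qed.

Lemma rpow_le_exp (s r : R) : 0 < r -> 0 <= s -> rpow s r <= rpow r r * exp s.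
Proof.
  intros r_pos [s_pos|<-]; [|rewrite rpow_0; positivity].
  replace s with (r * (s / r)) at 1 by (field; lra).
  rewrite rpow_mult_distr by positivity. apply Rmult_le_compat_l; [positivity|].
  replace (exp s) with (rpow (exp (s / r)) r).
  - apply rpow_le; [lra|]. split; [positivity|]. pose proof (exp_ineq1_le (s / r)). lra.
  - rewrite rpow_Rpower by positivity. unfold Rpower. rewrite ln_exp. f_equal. field. lra.
Qed.

(** * Complex scalars *)

Lemma CC_ring_theory : ring_theory C0 C1 Cadd Cmul (fun a b => Cadd a (Copp b)) Copp (@eq CC).
Proof.
  constructor; intros; repeat match goal with x : CC |- _ => destruct x end;
  unfold C0, C1, Cadd, Cmul, Copp; simpl; f_equal; ring.
Qed.
Add Ring CC_ring : CC_ring_theory.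

Notation Csub a b := (Cadd a (Copp b)).

Definition RC (r : R) : CC := (r, 0).

Lemma RC_0 : RC 0 = C0. Proof. reflexivity. Qed.
Lemma RC_1 : RC 1 = C1. Proof. reflexivity. Qed.
Lemma RC_add (a b : R) : RC (a + b) = Cadd (RC a) (RC b).
Proof. unfold RC, Cadd; simpl; f_equal; ring. Qed.
Lemma RC_mul (a b : R) : RC (a * b) = Cmul (RC a) (RC b).
Proof. unfold RC, Cmul; simpl; f_equal; ring. Qed.
Lemma RC_opp (a : R) : RC (- a) = Copp (RC a).
Proof. unfold RC, Copp; simpl; f_equal; ring. Qed.

Lemma Cnorm_Cmod (a : CC) : Cnorm a = Cmod a.
Proof. unfold Cnorm, Cmod. f_equal. ring. Qed.

Lemma Cnorm_nonneg (a : CC) : 0 <= Cnorm a.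
Proof. apply sqrt_pos. Qed.

#[export] Hint Resolve Cnorm_nonneg : sign.

Lemma Cnorm_mul (a b : CC) : Cnorm (Cmul a b) = Cnorm a * Cnorm b.
Proof. rewrite !Cnorm_Cmod. apply Cmod_mult. Qed.

Lemma Cnorm_add (a b : CC) : Cnorm (Cadd a b) <= Cnorm a + Cnorm b.
Proof. rewrite !Cnorm_Cmod. apply Cmod_triangle. Qed.

Lemma Cnorm_opp (a : CC) : Cnorm (Copp a) = Cnorm a.
Proof. rewrite !Cnorm_Cmod. apply Cmod_opp. Qed.

Lemma Cnorm_RC (r : R) : Cnorm (RC r) = Rabs r.
Proof. rewrite Cnorm_Cmod. apply Cmod_R. Qed.

Lemma Cnorm_RC_nonneg (r : R) : 0 <= r -> Cnorm (RC r) = r.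
Proof. intros. rewrite Cnorm_RC. apply Rabs_pos_eq; auto. Qed.

Lemma Cnorm_C0 : Cnorm C0 = 0.
Proof. rewrite Cnorm_Cmod. apply Cmod_0. Qed.

Lemma Cnorm_C1 : Cnorm C1 = 1.
Proof. rewrite Cnorm_Cmod. apply Cmod_1. Qed.

Lemma Cnorm_eq_0 (a : CC) : Cnorm a = 0 -> a = C0.
Proof. rewrite Cnorm_Cmod. apply Cmod_eq_0. Qed.

Lemma Cnorm_sq (a : CC) : Cnorm a * Cnorm a = fst a * fst a + snd a * snd a.
Proof. apply sqrt_sqrt. nra. Qed.

Lemma Rabs_fst_le_Cnorm (a : CC) : Rabs (fst a) <= Cnorm a.
Proof. rewrite Cnorm_Cmod. eapply Rle_trans; [apply Rmax_l|apply Rmax_Cmod]. Qed.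

Lemma Rabs_snd_le_Cnorm (a : CC) : Rabs (snd a) <= Cnorm a.
Proof. rewrite Cnorm_Cmod. eapply Rle_trans; [apply Rmax_r|apply Rmax_Cmod]. Qed.

Lemma Cnorm_le_Rabs_fst_snd (a : CC) : Cnorm a <= Rabs (fst a) + Rabs (snd a).
Proof.
  replace a with (Cadd (RC (fst a)) (Cmul (0, 1) (RC (snd a)))) at 1
    by (destruct a; unfold Cadd, Cmul, RC; simpl; f_equal; ring).
  eapply Rle_trans; [apply Cnorm_add|]. rewrite Cnorm_mul, !Cnorm_RC, (Cnorm_Cmod (0, 1)).
  change (0, 1) with Ci. rewrite Cmod_Ci. lra.
Qed.

Notation csum := (msum Cadd C0).

#[global] Instance Cadd_comm_monoid : comm_monoid Cadd C0.
Proof. split; intros; ring. Qed.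

Lemma Cnorm_csum (n : nat) (F : nat -> CC) : Cnorm (csum n F) <= rsum n (fun i => Cnorm (F i)).
Proof.
  induction n as [|n IH]; simpl; [rewrite Cnorm_C0; lra|].
  eapply Rle_trans; [apply Cnorm_add|]. lra.
Qed.

Lemma csum_scal (n : nat) (c : CC) (F : nat -> CC) :
  csum n (fun i => Cmul c (F i)) = Cmul c (csum n F).
Proof. symmetry. apply (msum_morph Cadd C0 Cadd C0 (Cmul c)); intros; ring. Qed.

Lemma csum_RC (n : nat) (F : nat -> R) : csum n (fun i => RC (F i)) = RC (rsum n F).
Proof. symmetry. apply (msum_morph Rplus 0 Cadd C0 RC); [reflexivity|apply RC_add]. Qed.

Lemma fst_csum (n : nat) (F : nat -> CC) : fst (csum n F) = rsum n (fun i => fst (F i)).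
Proof. apply (msum_morph Cadd C0 Rplus 0 fst); reflexivity. Qed.

Lemma snd_csum (n : nat) (F : nat -> CC) : snd (csum n F) = rsum n (fun i => snd (F i)).
Proof. apply (msum_morph Cadd C0 Rplus 0 snd); reflexivity. Qed.

(** * The space l^p *)

Class exponent := Exponent { pexp : R; pexp_gt1 : 1 < pexp }.

Section Space.
Context {E : exponent}.
Notation p := pexp.

Lemma pexp_ge1 : 1 <= p. Proof. pose proof pexp_gt1. lra. Qed.
Lemma pexp_pos : 0 < p. Proof. pose proof pexp_gt1. lra. Qed.
Lemma pexp_nonneg : 0 <= p. Proof. pose proof pexp_gt1. lra. Qed.

Hint Resolve pexp_ge1 pexp_pos pexp_nonneg : sign.

Lemma lp_norm_le_iff (x : vec) (r : R) :
  lp_norm_le p x r <-> 0 <= r /\ forall N, rsum N (fun n => rpow (Cnorm (x n)) p) <= rpow r p.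
Proof.
  unfold lp_norm_le. split; intros [r_nonneg sums_le]; split; auto; intros N.
  - destruct N as [|N]; [apply rpow_nonneg|]. rewrite <- sum_f_R0_rsum. apply sums_le.
  - rewrite sum_f_R0_rsum. apply sums_le.
Qed.

Lemma lp_norm_le_coord (x : vec) (r : R) (n : nat) : lp_norm_le p x r -> Cnorm (x n) <= r.
Proof.
  rewrite lp_norm_le_iff. intros [r_nonneg sums_le].
  apply rpow_le_reg with p; [positivity..|]. eapply Rle_trans; [|apply (sums_le (S n))].
  apply (rsum_ge_term (S n) n (fun n => rpow (Cnorm (x n)) p)); positivity.
Qed.

Lemma lp_norm_le_pointwise (x y : vec) (r : R) :
  (forall n, Cnorm (x n) <= Cnorm (y n)) -> lp_norm_le p y r -> lp_norm_le p x r.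
Proof.
  rewrite !lp_norm_le_iff. intros x_le [r_nonneg sums_le]. split; auto. intros N.
  eapply Rle_trans; [|apply sums_le]. apply rsum_le. intros i _.
  apply rpow_le; [|split]; positivity.
Qed.

Lemma lp_norm_le_weaken (x : vec) (r s : R) : r <= s -> lp_norm_le p x r -> lp_norm_le p x s.
Proof.
  rewrite !lp_norm_le_iff. intros r_le [r_nonneg sums_le]. split; [lra|]. intros N.
  eapply Rle_trans; [apply sums_le|]. apply rpow_le; positivity.
Qed.

Lemma lp_norm_le_normalized (x : vec) (r : R) (N : nat) : 0 < r -> lp_norm_le p x r ->
  rsum N (fun n => rpow (Cnorm (x n) / r) p) <= 1.
Proof.
  rewrite lp_norm_le_iff. intros r_pos [_ sums_le].
  rewrite (msum_ext _ _ N _ (fun n => rpow (/ r) p * rpow (Cnorm (x n)) p)).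
  - rewrite rsum_scal. replace 1 with (rpow (/ r) p * rpow r p).
    + apply Rmult_le_compat_l; positivity.
    + rewrite <- rpow_mult_distr, Rinv_l, rpow_1 by positivity. reflexivity.
  - intros n _. unfold Rdiv. rewrite Rmult_comm. apply rpow_mult_distr; positivity.
Qed.

(* Convexity of [t^p] at [x / r] and [y / s], with weights [r / (r + s)] and [s / (r + s)]. *)
Lemma lp_norm_le_add_of_pos (x y : vec) (r s : R) : 0 < r -> 0 < s ->
  lp_norm_le p x r -> lp_norm_le p y s -> lp_norm_le p (vadd x y) (r + s).
Proof.
  intros r_pos s_pos x_le y_le. apply lp_norm_le_iff. split; [lra|]. intros N.
  set (t := r / (r + s)).
  assert (t_eq : 1 - t = s / (r + s)) by (unfold t; field; lra).
  assert (t_range : 0 <= t <= 1).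
  { assert (0 <= t) by (unfold t; positivity). assert (0 <= 1 - t) by (rewrite t_eq; positivity).
    lra. }
  apply Rle_trans with (rpow (r + s) p *
    (t * rsum N (fun n => rpow (Cnorm (x n) / r) p)
     + (1 - t) * rsum N (fun n => rpow (Cnorm (y n) / s) p))).
  - rewrite <- !rsum_scal, <- (msum_add (add := Rplus)), <- rsum_scal. apply rsum_le. intros n _.
    apply Rle_trans with (rpow ((r + s) * (t * (Cnorm (x n) / r) + (1 - t) * (Cnorm (y n) / s))) p).
    + apply rpow_le; [positivity|]. split; [positivity|]. eapply Rle_trans; [apply Cnorm_add|].
      right. rewrite t_eq. unfold t. field. lra.
    + rewrite rpow_mult_distr by positivity.
      apply Rmult_le_compat_l; [|apply rpow_convex]; positivity.
  - rewrite <- (Rmult_1_r (rpow (r + s) p)) at 2. apply Rmult_le_compat_l; [positivity|].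
    pose proof (lp_norm_le_normalized x r N r_pos x_le).
    pose proof (lp_norm_le_normalized y s N s_pos y_le). nra.
Qed.

Lemma lp_norm_le_add_zero (x y : vec) (s : R) :
  lp_norm_le p x 0 -> lp_norm_le p y s -> lp_norm_le p (vadd x y) s.
Proof.
  intros x_le y_le. apply lp_norm_le_pointwise with y; auto. intros n.
  pose proof (lp_norm_le_coord x 0 n x_le). pose proof (Cnorm_add (x n) (y n)). unfold vadd. lra.
Qed.

Lemma vadd_comm (x y : vec) : vadd x y = vadd y x.
Proof. apply functional_extensionality. intros n. unfold vadd. ring. Qed.

Lemma lp_norm_le_add (x y : vec) (r s : R) :
  lp_norm_le p x r -> lp_norm_le p y s -> lp_norm_le p (vadd x y) (r + s).
Proof.
  intros x_le y_le. destruct (proj1 x_le) as [r_pos|<-]; [destruct (proj1 y_le) as [s_pos|<-]|].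
  - apply lp_norm_le_add_of_pos; auto.
  - rewrite vadd_comm, Rplus_0_r. apply lp_norm_le_add_zero; auto.
  - rewrite Rplus_0_l. apply lp_norm_le_add_zero; auto.
Qed.

Lemma lp_norm_le_scale (c : CC) (x : vec) (r : R) :
  lp_norm_le p x r -> lp_norm_le p (vscale c x) (Cnorm c * r).
Proof.
  rewrite !lp_norm_le_iff. intros [r_nonneg sums_le]. split; [positivity|]. intros N.
  unfold vscale. rewrite (msum_ext _ _ N _ (fun n => rpow (Cnorm c) p * rpow (Cnorm (x n)) p))
    by (intros; rewrite Cnorm_mul; apply rpow_mult_distr; positivity).
  rewrite rsum_scal, rpow_mult_distr by positivity. apply Rmult_le_compat_l; positivity.
Qed.

Definition ellp : Type := { x : vec | lp p x }.
Definition coord (x : ellp) : nat -> CC := proj1_sig x.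
Coercion coord : ellp >-> Funclass.

Lemma ellp_ext (x y : ellp) : (forall n, x n = y n) -> x = y.
Proof.
  destruct x as [x x_lp], y as [y y_lp]; simpl. intros eq_xy.
  assert (x = y) by (apply functional_extensionality; auto). subst.
  f_equal. apply proof_irrelevance.
Qed.

Lemma norm_exists (x : ellp) :
  exists s, lp_norm_le p x s /\ forall r, lp_norm_le p x r -> s <= r.
Proof.
  destruct x as [x [r0 x_le]]; simpl. set (a := fun n => rpow (Cnorm (x n)) p).
  destruct (completeness (fun t => exists N, t = rsum N a)) as [S [upper least]].
  - exists (rpow r0 p). intros t [N ->]. apply lp_norm_le_iff in x_le. apply x_le.
  - exists 0, 0%nat. reflexivity.
  - assert (S_nonneg : 0 <= S) by (apply upper; exists 0%nat; reflexivity).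
    exists (rpow S (/ p)). split.
    + apply lp_norm_le_iff. split; [positivity|]. intros N.
      rewrite rpow_Rinv_rpow by positivity. apply upper. exists N; reflexivity.
    + intros r r_bound. apply lp_norm_le_iff in r_bound. destruct r_bound as [r_nonneg sums_le].
      apply rpow_le_reg with p; [positivity..|]. rewrite rpow_Rinv_rpow by positivity.
      apply least. intros t [N ->]. apply sums_le.
Qed.

Definition norm (x : ellp) : R :=
  proj1_sig (constructive_indefinite_description _ (norm_exists x)).

Lemma norm_le_iff (x : ellp) (r : R) : norm x <= r <-> lp_norm_le p x r.
Proof.
  unfold norm. destruct constructive_indefinite_description as [s [s_bound least]]; simpl.
  split; auto. intros s_le. apply lp_norm_le_weaken with s; auto.
Qed.

Lemma lp_norm_le_norm (x : ellp) : lp_norm_le p x (norm x).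
Proof. apply norm_le_iff. lra. Qed.

Lemma norm_nonneg (x : ellp) : 0 <= norm x.
Proof. apply (lp_norm_le_norm x). Qed.

Hint Resolve norm_nonneg : sign.

Lemma coord_le_norm (x : ellp) (n : nat) : Cnorm (x n) <= norm x.
Proof. apply lp_norm_le_coord, lp_norm_le_norm. Qed.

Lemma sum_coord_pow_le (x : ellp) (N : nat) :
  rsum N (fun n => rpow (Cnorm (x n)) p) <= rpow (norm x) p.
Proof. apply lp_norm_le_iff, lp_norm_le_norm. Qed.

Lemma norm_le_of_sums (x : ellp) (r : R) :
  0 <= r -> (forall N, rsum N (fun n => rpow (Cnorm (x n)) p) <= rpow r p) -> norm x <= r.
Proof. intros. apply norm_le_iff, lp_norm_le_iff. auto. Qed.

Lemma norm_pow_le_of_sums (x : ellp) (S : R) :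
  (forall N, rsum N (fun n => rpow (Cnorm (x n)) p) <= S) -> rpow (norm x) p <= S.
Proof.
  intros sums_le. assert (S_nonneg : 0 <= S) by (apply (sums_le 0%nat)).
  rewrite <- (rpow_Rinv_rpow S p) by positivity. apply rpow_le; [positivity|].
  split; [positivity|]. apply norm_le_of_sums; [positivity|]. intros N.
  rewrite rpow_Rinv_rpow by positivity. apply sums_le.
Qed.

Lemma norm_le_pointwise (x y : ellp) : (forall n, Cnorm (x n) <= Cnorm (y n)) -> norm x <= norm y.
Proof.
  intros x_le. apply norm_le_iff. eapply lp_norm_le_pointwise; [apply x_le|apply lp_norm_le_norm].
Qed.

Lemma lp_add (x y : ellp) : lp p (vadd x y).
Proof. exists (norm x + norm y). apply lp_norm_le_add; apply lp_norm_le_norm. Qed.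
Lemma lp_scale (c : CC) (x : ellp) : lp p (vscale c x).
Proof. exists (Cnorm c * norm x). apply lp_norm_le_scale; apply lp_norm_le_norm. Qed.
Lemma lp_norm_le_zero : lp_norm_le p (fun _ => C0) 0.
Proof.
  apply lp_norm_le_iff. split; [lra|]. intros N. rewrite Cnorm_C0, rpow_0, msum_zero; auto; lra.
Qed.

Definition ladd (x y : ellp) : ellp := exist _ _ (lp_add x y).
Definition lscale (c : CC) (x : ellp) : ellp := exist _ _ (lp_scale c x).
Definition lzero : ellp := exist _ _ (ex_intro _ 0 lp_norm_le_zero).
Definition lsub (x y : ellp) : ellp := ladd x (lscale (Copp C1) y).

Lemma coord_add (x y : ellp) (n : nat) : ladd x y n = Cadd (x n) (y n).
Proof. reflexivity. Qed.
Lemma coord_scale (c : CC) (x : ellp) (n : nat) : lscale c x n = Cmul c (x n).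
Proof. reflexivity. Qed.
Lemma coord_zero (n : nat) : lzero n = C0.
Proof. reflexivity. Qed.

End Space.

#[export] Hint Resolve pexp_ge1 pexp_pos pexp_nonneg norm_nonneg : sign.

Ltac push_coord := unfold lsub;
  repeat first [rewrite coord_add | rewrite coord_scale | rewrite coord_zero].
Ltac ellp_ring := intros; apply ellp_ext; let n := fresh "n" in intros n; push_coord; ring.

Section Norm.
Context {E : exponent}.
Notation p := pexp.

Lemma norm_add (x y : ellp) : norm (ladd x y) <= norm x + norm y.
Proof. apply norm_le_iff, lp_norm_le_add; apply lp_norm_le_norm. Qed.

Lemma norm_zero : norm lzero = 0.
Proof. apply Rle_antisym; [|positivity]. apply norm_le_iff, lp_norm_le_zero. Qed.

Lemma norm_eq_0 (x : ellp) : norm x = 0 -> x = lzero.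
Proof.
  intros norm_x. apply ellp_ext. intros n. apply Cnorm_eq_0.
  pose proof (coord_le_norm x n). pose proof (Cnorm_nonneg (x n)). lra.
Qed.

Lemma lscale_1 (x : ellp) : lscale C1 x = x.
Proof. ellp_ring. Qed.

Lemma lscale_lscale (c d : CC) (x : ellp) : lscale c (lscale d x) = lscale (Cmul c d) x.
Proof. ellp_ring. Qed.

Lemma norm_scale (c : CC) (x : ellp) : norm (lscale c x) = Cnorm c * norm x.
Proof.
  apply Rle_antisym; [apply norm_le_iff, lp_norm_le_scale, lp_norm_le_norm|].
  apply rpow_le_reg with p; [positivity..|]. rewrite rpow_mult_distr by positivity.
  destruct (Cnorm_nonneg c) as [c_pos|<-]; [|rewrite rpow_0, Rmult_0_l; positivity].
  assert (pow_pos : 0 < rpow (Cnorm c) p) by positivity.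
  apply Rmult_le_reg_l with (/ rpow (Cnorm c) p); [positivity|].
  rewrite <- Rmult_assoc, Rinv_l, Rmult_1_l by lra. apply norm_pow_le_of_sums. intros N.
  apply Rmult_le_reg_l with (rpow (Cnorm c) p); auto.
  rewrite <- Rmult_assoc, Rinv_r, Rmult_1_l, <- rsum_scal by lra.
  eapply Rle_trans; [right|apply (sum_coord_pow_le _ N)]. apply msum_ext. intros n _.
  rewrite coord_scale, Cnorm_mul, rpow_mult_distr by positivity. reflexivity.
Qed.

Lemma norm_le_add_norm_sub (x y : ellp) : norm x <= norm y + norm (lsub x y).
Proof. replace x with (ladd y (lsub x y)) at 1 by ellp_ring. apply norm_add. Qed.

End Norm.

(** * Bounded operators *)

Section BoundedOperators.
Context {E : exponent}.
Notation p := pexp.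

Record Bop : Type := mkBop {
  bapp :> ellp -> ellp;
  bapp_add : forall x y, bapp (ladd x y) = ladd (bapp x) (bapp y);
  bapp_scale : forall c x, bapp (lscale c x) = lscale c (bapp x);
  bapp_bounded : exists r, 0 <= r /\ forall x, norm (bapp x) <= r * norm x }.

Lemma Bop_ext (A B : Bop) : (forall x, A x = B x) -> A = B.
Proof.
  destruct A as [a a_add a_scale a_bounded], B as [b b_add b_scale b_bounded]; simpl. intros eq_ab.
  assert (a = b) by (apply functional_extensionality; auto). subst.
  f_equal; apply proof_irrelevance.
Qed.

Definition opnorm_le (A : Bop) (r : R) : Prop := 0 <= r /\ forall x, norm (A x) <= r * norm x.

Lemma opnorm_le_exists (A : Bop) : exists r, opnorm_le A r.
Proof. exact (bapp_bounded A). Qed.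

Lemma opnorm_le_nonneg (A : Bop) (r : R) : opnorm_le A r -> 0 <= r.
Proof. intros A_le. apply A_le. Qed.

Definition badd (A B : Bop) : Bop.
Proof.
  refine (mkBop (fun x => ladd (A x) (B x)) _ _ _).
  - abstract (intros; rewrite !bapp_add; ellp_ring).
  - abstract (intros; rewrite !bapp_scale; ellp_ring).
  - abstract (destruct (bapp_bounded A) as (r & ? & A_le), (bapp_bounded B) as (s & ? & B_le);
      exists (r + s); split; [lra|]; intros x; eapply Rle_trans; [apply norm_add|];
      specialize (A_le x); specialize (B_le x); lra).
Defined.

Definition bscale (c : CC) (A : Bop) : Bop.
Proof.
  refine (mkBop (fun x => lscale c (A x)) _ _ _).
  - abstract (intros; rewrite !bapp_add; ellp_ring).
  - abstract (intros; rewrite !bapp_scale; ellp_ring).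
  - abstract (destruct (bapp_bounded A) as (r & ? & A_le); exists (Cnorm c * r);
      split; [positivity|]; intros x; rewrite norm_scale, Rmult_assoc;
      apply Rmult_le_compat_l; positivity).
Defined.

Definition bcomp (A B : Bop) : Bop.
Proof.
  refine (mkBop (fun x => A (B x)) _ _ _).
  - abstract (intros; rewrite !bapp_add; reflexivity).
  - abstract (intros; rewrite !bapp_scale; reflexivity).
  - abstract (destruct (bapp_bounded A) as (r & ? & A_le), (bapp_bounded B) as (s & ? & B_le);
      exists (r * s); split; [positivity|]; intros x; eapply Rle_trans; [apply A_le|];
      rewrite Rmult_assoc; apply Rmult_le_compat_l; auto).
Defined.

Definition bid : Bop.
Proof.
  refine (mkBop (fun x => x) _ _ _); auto.
  abstract (exists 1; split; [lra|]; intros; lra).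
Defined.

Definition bzero : Bop.
Proof.
  refine (mkBop (fun x => lzero) _ _ _); [abstract ellp_ring|abstract ellp_ring|].
  abstract (exists 0; split; [lra|]; intros; rewrite norm_zero; lra).
Defined.

Definition bsub (A B : Bop) : Bop := badd A (bscale (Copp C1) B).

Lemma bapp_zero (A : Bop) : A lzero = lzero.
Proof. replace lzero with (lscale C0 lzero) by ellp_ring. rewrite bapp_scale. ellp_ring. Qed.

Lemma bapp_sub (A : Bop) (x y : ellp) : A (lsub x y) = lsub (A x) (A y).
Proof. unfold lsub. rewrite bapp_add, bapp_scale. reflexivity. Qed.

Definition bounded_linear (F : ellp -> vec) (r : R) : Prop :=
  (forall x y n, F (ladd x y) n = Cadd (F x n) (F y n)) /\
  (forall c x n, F (lscale c x) n = Cmul c (F x n)) /\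
  0 <= r /\ forall x, lp_norm_le p (F x) (r * norm x).

Lemma bounded_linear_lp (F : ellp -> vec) : (exists r, bounded_linear F r) -> forall x, lp p (F x).
Proof. intros (r & _ & _ & _ & F_le) x. eexists; apply F_le. Qed.

(* The zero operator, when [F] is not a bounded linear map. *)
Definition Bop_of (F : ellp -> vec) : Bop.
Proof.
  refine (match excluded_middle_informative (exists r, bounded_linear F r) with
    | left F_bl => mkBop (fun x => exist _ (F x) (bounded_linear_lp F F_bl x)) _ _ _
    | right _ => bzero end).
  - abstract (pose proof F_bl as (r & F_add & _); intros; apply ellp_ext; intros n;
      rewrite coord_add; apply F_add).
  - abstract (pose proof F_bl as (r & _ & F_scale & _); intros; apply ellp_ext; intros n;
      rewrite coord_scale; apply F_scale).
  - abstract (pose proof F_bl as (r & F_add & F_scale & r_nonneg & F_le); exists r; split; auto;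
      intros x; apply norm_le_iff; apply F_le).
Defined.

Lemma Bop_of_app (F : ellp -> vec) (r : R) : bounded_linear F r -> forall x n, Bop_of F x n = F x n.
Proof.
  intros F_bl x n. unfold Bop_of. destruct excluded_middle_informative as [|not_bl]; auto.
  destruct not_bl. exists r. auto.
Qed.

Lemma opnorm_le_Bop_of (F : ellp -> vec) (r : R) : bounded_linear F r -> opnorm_le (Bop_of F) r.
Proof.
  intros F_bl. split; [apply F_bl|]. intros x. apply norm_le_iff.
  apply lp_norm_le_pointwise with (F x); [|apply F_bl].
  intros n. rewrite (Bop_of_app F r) by auto. lra.
Qed.

End BoundedOperators.

Declare Scope bop_scope.
Delimit Scope bop_scope with B.
Infix "[+]" := badd (at level 50, left associativity) : bop_scope.
Infix "[-]" := bsub (at level 50, left associativity) : bop_scope.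
Infix "[*]" := bcomp (at level 40, left associativity) : bop_scope.
Infix "[.]" := bscale (at level 35, right associativity) : bop_scope.
Open Scope bop_scope.
Notation vsum := (msum ladd lzero).
Notation bsum := (msum badd bzero).

Ltac unfold_bop := unfold bsub, lsub; cbn [bapp badd bscale bcomp bid bzero].
Ltac push_bapp := repeat first [rewrite bapp_add | rewrite bapp_scale | rewrite bapp_zero].
Ltac bop_ring := intros; apply Bop_ext; intro; unfold_bop; push_bapp; ellp_ring.
Ltac bop_coords := intros; apply Bop_ext; let x := fresh "x" in intros x;
  apply ellp_ext; let t := fresh "t" in intros t; unfold_bop; push_coord.

Section OperatorAlgebra.
Context {E : exponent}.

Lemma opnorm_le_mono (A : Bop) (r s : R) : r <= s -> opnorm_le A r -> opnorm_le A s.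
Proof.
  intros r_le [r_nonneg A_le]. split; [lra|]. intros x. eapply Rle_trans; [apply A_le|].
  apply Rmult_le_compat_r; positivity.
Qed.

Lemma opnorm_le_add (A B : Bop) (r s : R) :
  opnorm_le A r -> opnorm_le B s -> opnorm_le (A [+] B) (r + s).
Proof.
  intros [r_nonneg A_le] [s_nonneg B_le]. split; [lra|]. intros x. simpl.
  eapply Rle_trans; [apply norm_add|]. specialize (A_le x). specialize (B_le x). lra.
Qed.

Lemma opnorm_le_scale (c : CC) (A : Bop) (r : R) :
  opnorm_le A r -> opnorm_le (c [.] A) (Cnorm c * r).
Proof.
  intros [r_nonneg A_le]. split; [positivity|]. intros x. simpl.
  rewrite norm_scale, Rmult_assoc. apply Rmult_le_compat_l; positivity.
Qed.

Lemma opnorm_le_scale_RC (t : R) (A : Bop) (r : R) :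
  0 <= t -> opnorm_le A r -> opnorm_le (RC t [.] A) (t * r).
Proof. intros. rewrite <- (Cnorm_RC_nonneg t) at 2 by auto. apply opnorm_le_scale; auto. Qed.

Lemma opnorm_le_opp (A : Bop) (r : R) : opnorm_le A r -> opnorm_le (Copp C1 [.] A) r.
Proof.
  intros A_le. replace r with (Cnorm (Copp C1) * r) by (rewrite Cnorm_opp, Cnorm_C1; ring).
  apply opnorm_le_scale; auto.
Qed.

Lemma opnorm_le_sub (A B : Bop) (r s : R) :
  opnorm_le A r -> opnorm_le B s -> opnorm_le (A [-] B) (r + s).
Proof. intros. apply opnorm_le_add; [|apply opnorm_le_opp]; auto. Qed.

Lemma opnorm_le_comp (A B : Bop) (r s : R) :
  opnorm_le A r -> opnorm_le B s -> opnorm_le (A [*] B) (r * s).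
Proof.
  intros [r_nonneg A_le] [s_nonneg B_le]. split; [positivity|]. intros x. simpl.
  eapply Rle_trans; [apply A_le|]. rewrite Rmult_assoc. apply Rmult_le_compat_l; auto.
Qed.

Lemma opnorm_le_contraction_l (A B : Bop) (r : R) :
  opnorm_le A 1 -> opnorm_le B r -> opnorm_le (A [*] B) r.
Proof. intros. rewrite <- (Rmult_1_l r). apply opnorm_le_comp; auto. Qed.

Lemma opnorm_le_contraction_r (A B : Bop) (r : R) :
  opnorm_le A r -> opnorm_le B 1 -> opnorm_le (A [*] B) r.
Proof. intros. rewrite <- (Rmult_1_r r). apply opnorm_le_comp; auto. Qed.

Lemma opnorm_le_id : opnorm_le bid 1.
Proof. split; [lra|]. intros; simpl; lra. Qed.

Lemma opnorm_le_zero : opnorm_le bzero 0.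
Proof. split; [lra|]. intros; simpl. rewrite norm_zero. lra. Qed.

Lemma opnorm_le_bsum (n : nat) (F : nat -> Bop) (r : nat -> R) :
  (forall i, (i < n)%nat -> opnorm_le (F i) (r i)) -> opnorm_le (bsum n F) (rsum n r).
Proof.
  induction n as [|n IH]; intros F_le; simpl; [apply opnorm_le_zero|].
  apply opnorm_le_add; auto.
Qed.

#[global] Instance badd_comm_monoid : comm_monoid badd bzero.
Proof. split; bop_ring. Qed.

Lemma bsum_app (n : nat) (F : nat -> Bop) (x : ellp) : bsum n F x = vsum n (fun i => F i x).
Proof. apply (msum_morph badd bzero ladd lzero (fun A : Bop => A x)); reflexivity. Qed.

Lemma coord_vsum (n : nat) (F : nat -> ellp) (t : nat) : vsum n F t = csum n (fun i => F i t).
Proof. apply (msum_morph ladd lzero Cadd C0 (fun x : ellp => x t)); reflexivity. Qed.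

Lemma coord_bsum (n : nat) (F : nat -> Bop) (x : ellp) (t : nat) :
  bsum n F x t = csum n (fun i => F i x t).
Proof. rewrite bsum_app. apply coord_vsum. Qed.

Lemma norm_vsum (n : nat) (F : nat -> ellp) : norm (vsum n F) <= rsum n (fun i => norm (F i)).
Proof.
  induction n as [|n IH]; simpl; [rewrite norm_zero; lra|].
  eapply Rle_trans; [apply norm_add|]. lra.
Qed.

Lemma bcomp_assoc (A B C : Bop) : A [*] B [*] C = A [*] (B [*] C). Proof. bop_ring. Qed.
Lemma bcomp_id_l (A : Bop) : bid [*] A = A. Proof. bop_ring. Qed.
Lemma bcomp_id_r (A : Bop) : A [*] bid = A. Proof. bop_ring. Qed.
Lemma bcomp_zero_l (A : Bop) : bzero [*] A = bzero. Proof. bop_ring. Qed.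
Lemma bcomp_zero_r (A : Bop) : A [*] bzero = bzero. Proof. bop_ring. Qed.
Lemma badd_zero_r (A : Bop) : A [+] bzero = A. Proof. bop_ring. Qed.
Lemma badd_comm (A B : Bop) : A [+] B = B [+] A. Proof. bop_ring. Qed.
Lemma bcomp_add_l (A B C : Bop) : (A [+] B) [*] C = A [*] C [+] B [*] C. Proof. bop_ring. Qed.
Lemma bcomp_add_r (A B C : Bop) : A [*] (B [+] C) = A [*] B [+] A [*] C. Proof. bop_ring. Qed.
Lemma bcomp_scale_l (c : CC) (A B : Bop) : (c [.] A) [*] B = c [.] (A [*] B). Proof. bop_ring. Qed.
Lemma bcomp_scale_r (c : CC) (A B : Bop) : A [*] (c [.] B) = c [.] (A [*] B). Proof. bop_ring. Qed.
Lemma bscale_bscale (c d : CC) (A : Bop) : c [.] d [.] A = Cmul c d [.] A. Proof. bop_ring. Qed.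
Lemma bscale_1 (A : Bop) : C1 [.] A = A. Proof. bop_ring. Qed.
Lemma bscale_0 (A : Bop) : C0 [.] A = bzero. Proof. bop_ring. Qed.

Lemma bcomp_bsum_r (n : nat) (A : Bop) (F : nat -> Bop) :
  A [*] bsum n F = bsum n (fun i => A [*] F i).
Proof. apply (msum_morph badd bzero badd bzero (bcomp A)); bop_ring. Qed.

Lemma bcomp_bsum_l (n : nat) (A : Bop) (F : nat -> Bop) :
  bsum n F [*] A = bsum n (fun i => F i [*] A).
Proof. apply (msum_morph badd bzero badd bzero (fun B => B [*] A)); bop_ring. Qed.

Lemma bscale_bsum (n : nat) (c : CC) (F : nat -> Bop) :
  c [.] bsum n F = bsum n (fun i => c [.] F i).
Proof. apply (msum_morph badd bzero badd bzero (bscale c)); bop_ring. Qed.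

Lemma bsum_sub (n : nat) (F G : nat -> Bop) :
  bsum n (fun i => F i [-] G i) = bsum n F [-] bsum n G.
Proof. unfold bsub. rewrite bscale_bsum. apply msum_add. Qed.

Lemma bscale_csum (n : nat) (c : nat -> CC) (A : Bop) :
  csum n c [.] A = bsum n (fun i => c i [.] A).
Proof. apply (msum_morph Cadd C0 badd bzero (fun z => z [.] A)); bop_ring. Qed.

End OperatorAlgebra.

(** * Compact operators *)

Section CompactOperators.
Context {E : exponent}.

Definition is_compact (A : Bop) : Prop :=
  forall eps, 0 < eps -> exists ys : list ellp,
    forall x, norm x <= 1 -> exists y, In y ys /\ norm (lsub (A x) y) <= eps.

Lemma norm_normalize_le_1 (x : ellp) (r : R) :
  0 < r -> norm x <= r -> norm (lscale (RC (/ r)) x) <= 1.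
Proof.
  intros r_pos x_le. rewrite norm_scale, Cnorm_RC_nonneg by positivity.
  apply Rmult_le_reg_l with r; auto. rewrite <- Rmult_assoc, Rinv_r; lra.
Qed.

Lemma lscale_RC_Rinv (x : ellp) (r : R) : r <> 0 -> lscale (RC r) (lscale (RC (/ r)) x) = x.
Proof. intros. rewrite lscale_lscale, <- RC_mul, Rinv_r by auto. apply lscale_1. Qed.

Lemma opnorm_le_of_unit_ball (A : Bop) (r : R) :
  0 <= r -> (forall x, norm x <= 1 -> norm (A x) <= r) -> opnorm_le A r.
Proof.
  intros r_nonneg A_le. split; auto. intros x. destruct (norm_nonneg x) as [x_pos|x_zero].
  - rewrite <- (lscale_RC_Rinv x (norm x)) at 1 by lra.
    rewrite bapp_scale, norm_scale, Cnorm_RC_nonneg, Rmult_comm by lra.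
    apply Rmult_le_compat_r; [positivity|]. apply A_le, norm_normalize_le_1; lra.
  - symmetry in x_zero. apply norm_eq_0 in x_zero as ->. rewrite bapp_zero, norm_zero. lra.
Qed.

Lemma compact_zero : is_compact bzero.
Proof.
  intros eps eps_pos. exists [lzero]. intros x _. exists lzero. split; [left; auto|].
  replace (lsub (bzero x) lzero) with lzero by (unfold_bop; ellp_ring). rewrite norm_zero. lra.
Qed.

Lemma compact_add (A B : Bop) : is_compact A -> is_compact B -> is_compact (A [+] B).
Proof.
  intros A_cpt B_cpt eps eps_pos.
  destruct (A_cpt (eps / 2)) as [ys net_A]; [lra|].
  destruct (B_cpt (eps / 2)) as [zs net_B]; [lra|].
  exists (map (fun c => ladd (fst c) (snd c)) (list_prod ys zs)).
  intros x x_le. destruct (net_A x x_le) as (y & y_in & y_near).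
  destruct (net_B x x_le) as (z & z_in & z_near). exists (ladd y z). split.
  - apply in_map_iff. exists (y, z). split; auto. apply in_prod; auto.
  - replace (lsub ((A [+] B) x) (ladd y z)) with (ladd (lsub (A x) y) (lsub (B x) z))
      by (unfold_bop; ellp_ring).
    eapply Rle_trans; [apply norm_add|lra].
Qed.

Lemma compact_comp_l (A K : Bop) : is_compact K -> is_compact (A [*] K).
Proof.
  intros K_cpt eps eps_pos. destruct (opnorm_le_exists A) as (r & r_nonneg & A_le).
  destruct (K_cpt (eps / (r + 1))) as [ys net]; [positivity|].
  exists (map A ys). intros x x_le. destruct (net x x_le) as (y & y_in & y_near).
  exists (A y). split; [apply in_map; auto|]. simpl. rewrite <- bapp_sub.
  eapply Rle_trans; [apply A_le|].
  apply Rle_trans with ((r + 1) * (eps / (r + 1))); [|right; field; lra].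
  apply Rmult_le_compat; positivity.
Qed.

Lemma compact_net_on_ball (K : Bop) (r eps : R) : is_compact K -> 0 < r -> 0 < eps ->
  exists ys : list ellp,
    forall x, norm x <= r -> exists y, In y ys /\ norm (lsub (K x) y) <= eps.
Proof.
  intros K_cpt r_pos eps_pos. destruct (K_cpt (eps / r)) as [ys net]; [positivity|].
  exists (map (lscale (RC r)) ys). intros x x_le.
  destruct (net (lscale (RC (/ r)) x)) as (y & y_in & y_near).
  { apply norm_normalize_le_1; auto. }
  exists (lscale (RC r) y). split; [apply in_map; auto|].
  rewrite <- (lscale_RC_Rinv x r), bapp_scale by lra.
  replace (lsub (lscale (RC r) (K (lscale (RC (/ r)) x))) (lscale (RC r) y))
    with (lscale (RC r) (lsub (K (lscale (RC (/ r)) x)) y)) by ellp_ring.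
  rewrite norm_scale, Cnorm_RC_nonneg by lra.
  apply Rle_trans with (r * (eps / r)); [|right; field; lra]. apply Rmult_le_compat_l; lra.
Qed.

Lemma compact_comp_r (A K : Bop) : is_compact K -> is_compact (K [*] A).
Proof.
  intros K_cpt eps eps_pos. destruct (opnorm_le_exists A) as (r & r_nonneg & A_le).
  destruct (compact_net_on_ball K (r + 1) eps) as [ys net]; [auto|lra|auto|].
  exists ys. intros x x_le. apply net. specialize (A_le x). pose proof (norm_nonneg x). nra.
Qed.

Lemma compact_scale (c : CC) (K : Bop) : is_compact K -> is_compact (c [.] K).
Proof.
  intros. replace (c [.] K) with ((c [.] bid) [*] K) by bop_ring. apply compact_comp_l; auto.
Qed.

Lemma compact_sub (A B : Bop) : is_compact A -> is_compact B -> is_compact (A [-] B).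
Proof. intros. apply compact_add; [|apply compact_scale]; auto. Qed.

Lemma compact_bsum (n : nat) (F : nat -> Bop) :
  (forall i, (i < n)%nat -> is_compact (F i)) -> is_compact (bsum n F).
Proof.
  induction n as [|n IH]; intros F_cpt; simpl; [apply compact_zero|]. apply compact_add; auto.
Qed.

Lemma compact_limit (A : Bop) :
  (forall eps, 0 < eps -> exists K, is_compact K /\ opnorm_le (A [-] K) eps) -> is_compact A.
Proof.
  intros approx eps eps_pos. destruct (approx (eps / 2)) as (K & K_cpt & _ & AK_le); [lra|].
  destruct (K_cpt (eps / 2)) as [ys net]; [lra|]. exists ys. intros x x_le.
  destruct (net x x_le) as (y & y_in & y_near). exists y. split; auto.
  replace (lsub (A x) y) with (ladd ((A [-] K) x) (lsub (K x) y)) by (unfold_bop; ellp_ring).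
  eapply Rle_trans; [apply norm_add|]. specialize (AK_le x). nra.
Qed.

(** * Equality and norm modulo the compact operators *)

Definition calkin_eq (A B : Bop) : Prop := is_compact (A [-] B).
Infix "=K" := calkin_eq (at level 70).

#[global] Instance calkin_eq_equiv : Equivalence calkin_eq.
Proof.
  unfold calkin_eq. split.
  - intros A. replace (A [-] A) with bzero by bop_ring. apply compact_zero.
  - intros A B AB. replace (B [-] A) with (Copp C1 [.] (A [-] B)) by bop_ring.
    apply compact_scale; auto.
  - intros A B C AB BC. replace (A [-] C) with ((A [-] B) [+] (B [-] C)) by bop_ring.
    apply compact_add; auto.
Qed.

Lemma calkin_eq_of_eq (A B : Bop) : A = B -> A =K B.
Proof. intros ->. reflexivity. Qed.

#[global] Instance badd_calkin_eq : Proper (calkin_eq ==> calkin_eq ==> calkin_eq) badd.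
Proof.
  intros A A' AA' B B' BB'. unfold calkin_eq in *.
  replace (A [+] B [-] (A' [+] B')) with ((A [-] A') [+] (B [-] B')) by bop_ring.
  apply compact_add; auto.
Qed.

#[global] Instance bscale_calkin_eq (c : CC) : Proper (calkin_eq ==> calkin_eq) (bscale c).
Proof.
  intros A A' AA'. unfold calkin_eq in *.
  replace (c [.] A [-] c [.] A') with (c [.] (A [-] A')) by bop_ring. apply compact_scale; auto.
Qed.

#[global] Instance bsub_calkin_eq : Proper (calkin_eq ==> calkin_eq ==> calkin_eq) bsub.
Proof. intros A A' AA' B B' BB'. unfold bsub. rewrite AA', BB'. reflexivity. Qed.

#[global] Instance bcomp_calkin_eq : Proper (calkin_eq ==> calkin_eq ==> calkin_eq) bcomp.
Proof.
  intros A A' AA' B B' BB'. unfold calkin_eq in *.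
  replace (A [*] B [-] A' [*] B') with ((A [-] A') [*] B [+] A' [*] (B [-] B')) by bop_ring.
  apply compact_add; [apply compact_comp_r|apply compact_comp_l]; auto.
Qed.

Lemma calkin_eq_bsum (n : nat) (F G : nat -> Bop) :
  (forall i, (i < n)%nat -> F i =K G i) -> bsum n F =K bsum n G.
Proof. apply (msum_proper _ _ calkin_eq). Qed.

Lemma calkin_eq_zero (A : Bop) : A =K bzero <-> is_compact A.
Proof. unfold calkin_eq. replace (A [-] bzero) with A by bop_ring. reflexivity. Qed.

Definition calkin_norm_le (A : Bop) (r : R) : Prop :=
  forall eps, 0 < eps -> exists K, is_compact K /\ opnorm_le (A [+] K) (r + eps).

Lemma calkin_norm_le_of_opnorm_le (A : Bop) (r : R) : opnorm_le A r -> calkin_norm_le A r.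
Proof.
  intros A_le eps eps_pos. exists bzero. split; [apply compact_zero|]. rewrite badd_zero_r.
  apply opnorm_le_mono with r; auto. lra.
Qed.

Lemma calkin_norm_le_weaken (A : Bop) (r s : R) : r <= s -> calkin_norm_le A r ->
  calkin_norm_le A s.
Proof.
  intros r_le A_le eps eps_pos. destruct (A_le eps eps_pos) as (K & K_cpt & AK_le).
  exists K. split; auto. apply opnorm_le_mono with (r + eps); auto. lra.
Qed.

Lemma calkin_norm_le_calkin_eq (A B : Bop) (r : R) : A =K B -> calkin_norm_le A r ->
  calkin_norm_le B r.
Proof.
  intros AB A_le eps eps_pos. destruct (A_le eps eps_pos) as (K & K_cpt & AK_le).
  exists ((A [-] B) [+] K). split; [apply compact_add; auto|].
  replace (B [+] (A [-] B [+] K)) with (A [+] K) by bop_ring. auto.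
Qed.

Lemma calkin_norm_le_add (A B : Bop) (r s : R) :
  calkin_norm_le A r -> calkin_norm_le B s -> calkin_norm_le (A [+] B) (r + s).
Proof.
  intros A_le B_le eps eps_pos.
  destruct (A_le (eps / 2)) as (K & K_cpt & AK_le); [lra|].
  destruct (B_le (eps / 2)) as (L & L_cpt & BL_le); [lra|].
  exists (K [+] L). split; [apply compact_add; auto|].
  replace (A [+] B [+] (K [+] L)) with ((A [+] K) [+] (B [+] L)) by bop_ring.
  replace (r + s + eps) with (r + eps / 2 + (s + eps / 2)) by field. apply opnorm_le_add; auto.
Qed.

Lemma compact_of_calkin_norm_le (A : Bop) :
  (forall eps, 0 < eps -> calkin_norm_le A eps) -> is_compact A.
Proof.
  intros A_small. apply compact_limit. intros eps eps_pos.
  destruct (A_small (eps / 2) ltac:(lra) (eps / 2)) as (K & K_cpt & AK_le); [lra|].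
  exists (Copp C1 [.] K). split; [apply compact_scale; auto|].
  replace (A [-] Copp C1 [.] K) with (A [+] K) by bop_ring.
  replace eps with (eps / 2 + eps / 2) by field. auto.
Qed.

Lemma calkin_norm_le_comp (A X Y : Bop) (r a b : R) :
  opnorm_le X a -> opnorm_le Y b -> calkin_norm_le A r ->
    calkin_norm_le (X [*] A [*] Y) (a * r * b).
Proof.
  intros X_le Y_le A_le eps eps_pos.
  pose proof (opnorm_le_nonneg X a X_le). pose proof (opnorm_le_nonneg Y b Y_le).
  assert (ab_nonneg : 0 <= a * b) by positivity.
  destruct (A_le (eps / (a * b + 1))) as (K & K_cpt & AK_le); [positivity|].
  exists (X [*] K [*] Y). split; [apply compact_comp_r, compact_comp_l; auto|].
  replace (X [*] A [*] Y [+] X [*] K [*] Y) with (X [*] (A [+] K) [*] Y) by bop_ring.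
  apply opnorm_le_mono with (a * (r + eps / (a * b + 1)) * b).
  - assert (a * b * (eps / (a * b + 1)) <= eps); [|nra].
    apply Rle_trans with ((a * b + 1) * (eps / (a * b + 1))); [|right; field; lra].
    apply Rmult_le_compat_r; positivity.
  - repeat apply opnorm_le_comp; auto.
Qed.

End CompactOperators.

Infix "=K" := calkin_eq (at level 70) : bop_scope.

(** * Diagonal operators and partial permutations of the coordinates *)

Definition clip (r : R) : R := Rmax 0 (Rmin 1 r).

Lemma clip_range (r : R) : 0 <= clip r <= 1.
Proof. unfold clip, Rmax, Rmin. repeat destruct Rle_dec; lra. Qed.

Lemma clip_id (r : R) : 0 <= r <= 1 -> clip r = r.
Proof. unfold clip, Rmax, Rmin. repeat destruct Rle_dec; lra. Qed.

Definition below (m t : nat) : R := if (t <? m)%nat then 1 else 0.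

Lemma below_range (m t : nat) : 0 <= below m t <= 1.
Proof. unfold below. destruct (t <? m)%nat; lra. Qed.

Section CoordinateOperators.
Context {E : exponent}.
Notation p := pexp.

(* The weight is truncated to [0, 1], so that every weight gives a contraction. *)
Definition diag (w : nat -> R) : Bop := Bop_of (fun x t => Cmul (RC (clip (w t))) (x t)).

Lemma diag_bounded_linear (w : nat -> R) :
  bounded_linear (fun x t => Cmul (RC (clip (w t))) (x t)) 1.
Proof.
  split; [|split; [|split]]; [intros; push_coord; ring..|lra|].
  intros x. rewrite Rmult_1_l. apply lp_norm_le_pointwise with x; [|apply lp_norm_le_norm].
  intros n. pose proof (clip_range (w n)). rewrite Cnorm_mul, Cnorm_RC_nonneg by lra.
  pose proof (Cnorm_nonneg (x n)). nra.
Qed.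

Lemma diag_app (w : nat -> R) (x : ellp) (t : nat) : diag w x t = Cmul (RC (clip (w t))) (x t).
Proof. exact (Bop_of_app _ 1 (diag_bounded_linear w) x t). Qed.

Lemma opnorm_le_diag (w : nat -> R) : opnorm_le (diag w) 1.
Proof. apply opnorm_le_Bop_of, diag_bounded_linear. Qed.

Lemma norm_diag_le (w : nat -> R) (x : ellp) : norm (diag w x) <= norm x.
Proof. pose proof (proj2 (opnorm_le_diag w) x). lra. Qed.

Lemma diag_comp (w w' w'' : nat -> R) :
  (forall t, clip (w t) * clip (w' t) = clip (w'' t)) -> diag w [*] diag w' = diag w''.
Proof. intros product. bop_coords. rewrite !diag_app, <- product, RC_mul. ring. Qed.

Lemma diag_comm (w w' : nat -> R) : diag w [*] diag w' = diag w' [*] diag w.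
Proof. bop_coords. rewrite !diag_app. ring. Qed.

Lemma diag_zero : diag (fun _ => 0) = bzero.
Proof. bop_coords. rewrite diag_app, clip_id, RC_0 by lra. ring. Qed.

Definition head (m : nat) : Bop := diag (below m).
Definition tail (m : nat) : Bop := diag (fun t => 1 - below m t).

Lemma head_app (m : nat) (x : ellp) (t : nat) : head m x t = if (t <? m)%nat then x t else C0.
Proof.
  unfold head. rewrite diag_app, clip_id by apply below_range.
  unfold below. destruct (t <? m)%nat; [rewrite RC_1|rewrite RC_0]; ring.
Qed.

Lemma tail_app (m : nat) (x : ellp) (t : nat) : tail m x t = if (t <? m)%nat then C0 else x t.
Proof.
  pose proof (below_range m t). unfold tail. rewrite diag_app, clip_id by lra.
  unfold below. destruct (t <? m)%nat;
    [rewrite Rminus_diag, RC_0|rewrite Rminus_0_r, RC_1]; ring.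
Qed.

Lemma head_add_tail (m : nat) : head m [+] tail m = bid.
Proof. bop_coords. rewrite head_app, tail_app. destruct (t <? m)%nat; ring. Qed.

Lemma tail_eq (m : nat) : tail m = bid [-] head m.
Proof. rewrite <- (head_add_tail m). bop_ring. Qed.

Lemma head_comp (m m' : nat) : (m <= m')%nat -> head m' [*] head m = head m.
Proof.
  intros m_le. bop_coords. rewrite !head_app.
  destruct (Nat.ltb_spec t m), (Nat.ltb_spec t m'); auto; lia.
Qed.

Lemma tail_comp (m m' : nat) : (m <= m')%nat -> tail m [*] tail m' = tail m'.
Proof.
  intros m_le. bop_coords. rewrite !tail_app.
  destruct (Nat.ltb_spec t m), (Nat.ltb_spec t m'); auto; lia.
Qed.

Lemma head_tail_comm (m m' : nat) : head m [*] tail m' = tail m' [*] head m.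
Proof. apply diag_comm. Qed.

Lemma bounded_series_tail (a : nat -> R) (S eps : R) : (forall N, rsum N a <= S) -> 0 < eps ->
  exists m, forall N, rsum N a <= rsum m a + eps.
Proof.
  intros a_le eps_pos.
  destruct (completeness (fun t => exists N, t = rsum N a)) as [L [upper least]].
  - exists S. intros t [N ->]. apply a_le.
  - exists 0, 0%nat. reflexivity.
  - apply NNPP. intros none. assert (L <= L - eps); [|lra].
    apply least. intros t [m ->]. apply Rnot_lt_le. intros m_big. apply none. exists m. intros N.
    specialize (upper (rsum N a) (ex_intro _ N eq_refl)). lra.
Qed.

Lemma norm_tail_small (x : ellp) (eps : R) : 0 < eps ->
  eventually (fun m => norm (tail m x) <= eps).
Proof.
  intros eps_pos. set (a := fun t => rpow (Cnorm (x t)) p).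
  destruct (bounded_series_tail a (rpow (norm x) p) (rpow eps p)) as [m0 a_tail];
    [apply sum_coord_pow_le|positivity|].
  exists m0. intros m m_ge. apply norm_le_of_sums; [lra|]. intros N.
  apply Rle_trans with (rsum (m + N) (fun t => rpow (Cnorm (tail m x t)) p));
    [apply rsum_mono; [lia|positivity]|].
  rewrite msum_split, msum_zero.
  - rewrite (msum_ext _ _ N _ (fun i => a (m + i)%nat)).
    + pose proof (a_tail (m + N)%nat) as a_le. rewrite msum_split in a_le.
      assert (rsum m0 a <= rsum m a) by (apply rsum_mono; [lia|intros; apply rpow_nonneg]). lra.
    + intros i _. rewrite tail_app. destruct (Nat.ltb_spec (m + i) m); [lia|reflexivity].
  - intros t t_lt. rewrite tail_app. destruct (Nat.ltb_spec t m); [|lia].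
    rewrite Cnorm_C0. apply rpow_0.
Qed.

Definition reindex (s : nat -> option nat) : Bop :=
  Bop_of (fun x t => match s t with Some u => x u | None => C0 end).

Section Reindex.
Variable s : nat -> option nat.
Hypothesis s_inj : partial_injective s.

Lemma reindex_bounded_linear :
  bounded_linear (fun x t => match s t with Some u => x u | None => C0 end) 1.
Proof.
  split; [|split; [|split]]; [intros; destruct (s _); push_coord; ring..|lra|].
  intros x. rewrite Rmult_1_l. apply lp_norm_le_iff. split; [positivity|]. intros N.
  rewrite (msum_ext _ _ N _
    (fun t => match s t with Some u => rpow (Cnorm (x u)) p | None => 0 end)).
  - apply (rsum_partial_injective_le s (fun u => rpow (Cnorm (x u)) p));
      [exact s_inj|positivity|apply sum_coord_pow_le].
  - intros t _. destruct (s t); [reflexivity|]. rewrite Cnorm_C0. apply rpow_0.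
Qed.

Lemma reindex_app (x : ellp) (t : nat) :
  reindex s x t = match s t with Some u => x u | None => C0 end.
Proof. exact (Bop_of_app _ 1 reindex_bounded_linear x t). Qed.

Lemma opnorm_le_reindex : opnorm_le (reindex s) 1.
Proof. apply opnorm_le_Bop_of, reindex_bounded_linear. Qed.

End Reindex.

Lemma lp_norm_le_basis_vec (m : nat) : lp_norm_le p (fun t => if (t =? m)%nat then C1 else C0) 1.
Proof.
  apply lp_norm_le_iff. split; [lra|]. intros N. rewrite rpow_1.
  apply Rle_trans with (rsum (N + S m) (fun t => rpow (Cnorm (if (t =? m)%nat then C1 else C0)) p));
    [apply rsum_mono; [lia|positivity]|].
  rewrite (msum_single (N + S m) m), Nat.eqb_refl, Cnorm_C1, rpow_1; [lra|lia|].
  intros t _ ne. destruct (Nat.eqb_spec t m); [lia|]. rewrite Cnorm_C0. apply rpow_0.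
Qed.

Definition basis_vec (m : nat) : ellp := exist _ _ (ex_intro _ 1 (lp_norm_le_basis_vec m)).

Lemma basis_vec_app (m t : nat) : basis_vec m t = if (t =? m)%nat then C1 else C0.
Proof. reflexivity. Qed.

Lemma norm_basis_vec (m : nat) : norm (basis_vec m) = 1.
Proof.
  apply Rle_antisym; [apply norm_le_iff, lp_norm_le_basis_vec|].
  rewrite <- Cnorm_C1. change C1 with (if true then C1 else C0). rewrite <- (Nat.eqb_refl m).
  apply (coord_le_norm (basis_vec m) m).
Qed.

Lemma tail_basis_vec (m : nat) : tail m (basis_vec m) = basis_vec m.
Proof.
  apply ellp_ext. intros t. rewrite tail_app, basis_vec_app.
  destruct (Nat.ltb_spec t m), (Nat.eqb_spec t m); auto; lia.
Qed.

Lemma unit_interval_net (eps : R) : 0 < eps ->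
  exists l : list R, forall t, Rabs t <= 1 -> exists s, In s l /\ Rabs (t - s) <= eps.
Proof.
  intros eps_pos. destruct (INR_unbounded (2 / eps)) as [n n_large].
  assert (covers : 2 < INR n * eps).
  { replace 2 with (2 / eps * eps) by (field; lra). apply Rmult_lt_compat_r; auto. }
  exists (map (fun k => -1 + INR k * eps) (seq 0 (S n))). intros t t_le.
  apply Rabs_le_between in t_le.
  assert (nearest : forall k, t <= -1 + INR k * eps ->
     exists j, (j <= k)%nat /\ Rabs (t - (-1 + INR j * eps)) <= eps).
  { induction k as [|k IH]; intros t_below.
    - exists 0%nat. split; auto. simpl in *. rewrite Rabs_pos_eq; lra.
    - destruct (Rle_dec t (-1 + INR k * eps)) as [t_low|t_high].
      + destruct (IH t_low) as (j & j_le & near). exists j; auto.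
      + exists k. split; auto. rewrite S_INR in t_below. rewrite Rabs_pos_eq; lra. }
  destruct (nearest n) as (j & j_le & near); [lra|].
  exists (-1 + INR j * eps). split; auto. apply in_map_iff. exists j. split; auto.
  apply in_seq. lia.
Qed.

Lemma unit_disc_net (eps : R) : 0 < eps ->
  exists l : list CC, forall z, Cnorm z <= 1 -> exists s, In s l /\ Cnorm (Csub z s) <= eps.
Proof.
  intros eps_pos. destruct (unit_interval_net (eps / 2)) as [l net]; [lra|].
  exists (list_prod l l). intros [a b] z_le.
  pose proof (Rabs_fst_le_Cnorm (a, b)). pose proof (Rabs_snd_le_Cnorm (a, b)). simpl in *.
  destruct (net a) as (s & s_in & s_near); [lra|]. destruct (net b) as (t & t_in & t_near); [lra|].
  exists (s, t). split; [apply in_prod; auto|].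
  eapply Rle_trans; [apply Cnorm_le_Rabs_fst_snd|]. unfold Cadd, Copp, Rminus in *; simpl. lra.
Qed.

Lemma compact_head (m : nat) : is_compact (head m).
Proof.
  induction m as [|m IH].
  - replace (head 0) with bzero; [apply compact_zero|]. bop_coords. rewrite head_app. reflexivity.
  - replace (head (S m)) with (head m [+] (head (S m) [-] head m)) by bop_ring.
    apply compact_add; auto. intros eps eps_pos. destruct (unit_disc_net eps eps_pos) as [l net].
    exists (map (fun z => lscale z (basis_vec m)) l). intros x x_le.
    destruct (net (x m)) as (s & s_in & s_near); [pose proof (coord_le_norm x m); lra|].
    exists (lscale s (basis_vec m)). split; [apply in_map_iff; exists s; auto|].
    replace (lsub ((head (S m) [-] head m) x) (lscale s (basis_vec m)))
      with (lscale (Csub (x m) s) (basis_vec m)).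
    + rewrite norm_scale, norm_basis_vec. lra.
    + apply ellp_ext. intros t. unfold_bop. push_coord. rewrite !head_app, basis_vec_app.
      destruct (Nat.ltb_spec t m), (Nat.ltb_spec t (S m)), (Nat.eqb_spec t m);
        try lia; subst; ring.
Qed.

Lemma compact_diag (w : nat -> R) (s : nat) :
  (forall t, (s <= t)%nat -> clip (w t) = 0) -> is_compact (diag w).
Proof.
  intros w_zero. replace (diag w) with (diag w [*] head s); [apply compact_comp_l, compact_head|].
  apply diag_comp. intros t. rewrite (clip_id (below s t)) by apply below_range. unfold below.
  destruct (Nat.ltb_spec t s); [|rewrite w_zero by auto]; ring.
Qed.

End CoordinateOperators.

(** * Compact operators on tails *)

Section Tails.
Context {E : exponent}.
Notation p := pexp.

Definition disjoint (v u : ellp) : Prop := forall t, v t = C0 \/ u t = C0.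

Lemma coord_pow_disjoint (v u : ellp) (t : nat) : disjoint v u ->
  rpow (Cnorm (ladd v u t)) p = rpow (Cnorm (v t)) p + rpow (Cnorm (u t)) p.
Proof.
  intros dis. rewrite coord_add. destruct (dis t) as [-> | ->]; rewrite Cnorm_C0, rpow_0.
  - rewrite Rplus_0_l. do 2 f_equal. ring.
  - rewrite Rplus_0_r. do 2 f_equal. ring.
Qed.

Lemma norm_pow_disjoint_le (v u : ellp) : disjoint v u ->
  rpow (norm (ladd v u)) p <= rpow (norm v) p + rpow (norm u) p.
Proof.
  intros dis. apply norm_pow_le_of_sums. intros N.
  rewrite (msum_ext _ _ N _ _ (fun t _ => coord_pow_disjoint v u t dis)), (msum_add (add := Rplus)).
  apply Rplus_le_compat; apply sum_coord_pow_le.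
Qed.

Lemma sum_norm_pow_le (z : nat -> ellp) (N : nat) (S : R) :
  (forall M, rsum N (fun n => rsum M (fun s => rpow (Cnorm (z n s)) p)) <= S) ->
  rsum N (fun n => rpow (norm (z n)) p) <= S.
Proof.
  revert S. induction N as [|N IH]; intros S sums_le; cbn [msum] in *; [apply (sums_le 0%nat)|].
  set (partial n M := rsum M (fun s => rpow (Cnorm (z n s)) p)).
  assert (partial_mono : forall n M M', (M <= M')%nat -> partial n M <= partial n M')
    by (intros; apply rsum_mono; positivity).
  assert (rpow (norm (z N)) p <= S - rsum N (fun n => rpow (norm (z n)) p)); [|lra].
  apply norm_pow_le_of_sums. intros M'.
  assert (rsum N (fun n => rpow (norm (z n)) p) <= S - partial N M'); [|unfold partial in *; lra].
  apply IH. intros M. change (rsum N (fun n => partial n M) <= S - partial N M').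
  specialize (sums_le (M + M')%nat).
  change (rsum N (fun n => partial n (M + M')%nat) + partial N (M + M')%nat <= S) in sums_le.
  assert (rsum N (fun n => partial n M) <= rsum N (fun n => partial n (M + M')%nat))
    by (apply rsum_le; intros; apply partial_mono; lia).
  pose proof (partial_mono N M' (M + M')%nat ltac:(lia)). lra.
Qed.

Lemma norm_pow_disjoint_ge (v u : ellp) : disjoint v u ->
  rpow (norm v) p + rpow (norm u) p <= rpow (norm (ladd v u)) p.
Proof.
  intros dis.
  pose proof (sum_norm_pow_le (fun n => if (n =? 0)%nat then v else u) 2 (rpow (norm (ladd v u)) p))
    as le. cbn in le. rewrite !Rplus_0_l in le. apply le. intros M. rewrite Rplus_0_l.
  rewrite <- (msum_add (add := Rplus)).
  rewrite <- (msum_ext _ _ M _ _ (fun t _ => coord_pow_disjoint v u t dis)). apply sum_coord_pow_le.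
Qed.

Lemma compact_tail_comp (K : Bop) (eps : R) : is_compact K -> 0 < eps ->
  eventually (fun m => opnorm_le (tail m [*] K) eps).
Proof.
  intros K_cpt eps_pos. destruct (K_cpt (eps / 2)) as [ys net]; [lra|].
  apply filter_imp with (fun m => forall y, In y ys -> norm (tail m y) <= eps / 2);
    [|apply eventually_list; intros; apply norm_tail_small; lra].
  intros m tails_small. apply opnorm_le_of_unit_ball; [lra|]. intros x x_le.
  destruct (net x x_le) as (y & y_in & y_near). specialize (tails_small y y_in). unfold_bop.
  replace (K x) with (ladd y (lsub (K x) y)) by ellp_ring. rewrite bapp_add.
  eapply Rle_trans; [apply norm_add|].
  pose proof (norm_diag_le (fun t => 1 - below m t) (lsub (K x) y)). unfold tail at 2. lra.
Qed.

Definition supported_in (u : ellp) (m M : nat) : Prop :=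
  forall t, (t < m)%nat \/ (M <= t)%nat -> u t = C0.

Lemma hump_exists (K : Bop) (m : nat) (eps : R) : 0 <= eps -> ~ opnorm_le (K [*] tail m) eps ->
  exists u M, norm u <= 1 /\ supported_in u m M /\ eps < norm (K u).
Proof.
  intros eps_nonneg not_le.
  assert (large : exists x, norm x <= 1 /\ eps < norm (K (tail m x))).
  { apply NNPP. intros none. apply not_le, opnorm_le_of_unit_ball; [lra|]. intros x x_le.
    apply Rnot_lt_le. intros K_large. apply none. exists x. auto. }
  destruct large as (x & x_le & K_large). set (slack := norm (K (tail m x)) - eps).
  destruct (opnorm_le_exists K) as (r & r_nonneg & K_le).
  destruct (norm_tail_small (tail m x) (slack / (2 * (r + 1)))) as [M tail_small];
    [unfold slack; positivity|]. specialize (tail_small M (le_n M)).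
  exists (head M (tail m x)), M. split; [|split].
  - eapply Rle_trans; [apply norm_diag_le|]. eapply Rle_trans; [apply norm_diag_le|]. auto.
  - intros t out. rewrite head_app, tail_app.
    destruct (Nat.ltb_spec t M), (Nat.ltb_spec t m); auto; lia.
  - assert (split_K : K (tail m x) = ladd (K (head M (tail m x))) (K (tail M (tail m x)))).
    { rewrite <- bapp_add. f_equal.
      change (tail m x = (head M [+] tail M) (tail m x)). rewrite head_add_tail. reflexivity. }
    pose proof (norm_add (K (head M (tail m x))) (K (tail M (tail m x)))) as triangle.
    rewrite <- split_K in triangle. pose proof (K_le (tail M (tail m x))).
    assert (r * norm (tail M (tail m x)) <= slack / 2); [|unfold slack in *; lra].
    apply Rle_trans with ((r + 1) * (slack / (2 * (r + 1)))); [|right; field; lra].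
    apply Rmult_le_compat; positivity.
Qed.

Definition humps_cluster (K : Bop) (y : ellp) (eps : R) : Prop :=
  forall m, exists u M, norm u <= 1 /\ supported_in u m M /\ norm (lsub (K u) y) <= eps.

Lemma hump_sum (K : Bop) (y : ellp) (eps : R) : humps_cluster K y eps -> forall N m,
  exists v M, supported_in v m M /\ rpow (norm v) p <= INR N /\
    norm (lsub (K v) (lscale (RC (INR N)) y)) <= INR N * eps.
Proof.
  intros humps N m. induction N as [|N (v & M & v_supp & v_le & v_near)].
  - exists lzero, 0%nat. split; [intros t _; reflexivity|]. rewrite bapp_zero, norm_zero, rpow_0.
    split; [simpl; lra|]. replace (lsub lzero (lscale (RC (INR 0)) y)) with lzero
      by (simpl INR; rewrite RC_0; ellp_ring). rewrite norm_zero. simpl; lra.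
  - destruct (humps (Nat.max m M)) as (u & M' & u_le & u_supp & u_near).
    exists (ladd v u), (Nat.max M M'). split; [|split].
    + intros t out. rewrite coord_add, v_supp, u_supp by lia. ring.
    + rewrite S_INR. eapply Rle_trans; [apply norm_pow_disjoint_le|].
      * intros t. destruct (le_lt_dec M t); [left; apply v_supp|right; apply u_supp]; lia.
      * assert (rpow (norm u) p <= 1) by (rewrite <- (rpow_1 p); apply rpow_le; positivity). lra.
    + rewrite S_INR, bapp_add, RC_add, RC_1.
      replace (lsub (ladd (K v) (K u)) (lscale (Cadd (RC (INR N)) C1) y))
        with (ladd (lsub (K v) (lscale (RC (INR N)) y)) (lsub (K u) y)) by ellp_ring.
      eapply Rle_trans; [apply norm_add|]. lra.
Qed.

Lemma linear_le_root (q r a : R) : 1 < q -> 0 <= r ->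
  (forall N, INR N * a <= r * rpow (INR N) (/ q)) -> a <= 0.
Proof.
  intros q_gt1 r_nonneg bound. apply Rnot_lt_le. intros a_pos. set (B := rpow (r / a) q).
  destruct (INR_unbounded (rpow B (/ (q - 1)))) as [N N_large].
  assert (N_pos : 0 < INR N) by (eapply Rle_lt_trans; [|apply N_large]; positivity).
  assert (N_pow : rpow (INR N) q <= B * INR N).
  { unfold B. rewrite <- (rpow_Rinv_rpow (INR N) q) at 2 by lra.
    rewrite <- rpow_mult_distr by positivity. apply rpow_le; [lra|]. split; [lra|].
    apply Rmult_le_reg_r with a; auto. eapply Rle_trans; [apply bound|]. right. field. lra. }
  replace q with (1 + (q - 1)) in N_pow at 1 by ring.
  rewrite rpow_plus, rpow_exponent_1, Rmult_comm in N_pow by lra.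
  apply Rmult_le_reg_r in N_pow; auto.
  apply (Rlt_not_le _ _ N_large), (rpow_le_reg _ _ (q - 1)); [lra|positivity..|].
  rewrite rpow_Rinv_rpow; [auto|lra|unfold B; positivity].
Qed.

(* [N] disjoint humps add up to a vector of norm at most [N ^ (1 / p)] with image near [N y]. *)
Lemma humps_cluster_norm_le (K : Bop) (y : ellp) (eps : R) :
  humps_cluster K y eps -> norm y <= eps.
Proof.
  intros humps. destruct (opnorm_le_exists K) as (r & r_nonneg & K_le).
  assert (norm y - eps <= 0); [|lra].
  apply linear_le_root with p r; [apply pexp_gt1|auto|]. intros N.
  destruct (hump_sum K y eps humps N 0) as (v & M & _ & v_le & v_near).
  assert (v_root : norm v <= rpow (INR N) (/ p)).
  { apply rpow_le_reg with p; [positivity..|].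
    rewrite rpow_Rinv_rpow by auto using pos_INR with sign. auto. }
  pose proof (norm_le_add_norm_sub (lscale (RC (INR N)) y) (K v)) as triangle.
  replace (lsub (lscale (RC (INR N)) y) (K v))
    with (lscale (Copp C1) (lsub (K v) (lscale (RC (INR N)) y))) in triangle by ellp_ring.
  rewrite !norm_scale, Cnorm_opp, Cnorm_C1, Cnorm_RC_nonneg in triangle by apply pos_INR.
  apply Rle_trans with (norm (K v)); [lra|]. eapply Rle_trans; [apply K_le|].
  apply Rmult_le_compat_l; auto.
Qed.

Lemma compact_comp_tail (K : Bop) (eps : R) : is_compact K -> 0 < eps ->
  eventually (fun m => opnorm_le (K [*] tail m) eps).
Proof.
  intros K_cpt eps_pos.
  assert (small : exists m0, opnorm_le (K [*] tail m0) eps).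
  { apply NNPP. intros none. destruct (K_cpt (eps / 2)) as [ys net]; [lra|].
    destruct (list_pigeonhole ys (fun y m => exists u M, norm u <= 1 /\ supported_in u m M /\
      eps < norm (K u) /\ norm (lsub (K u) y) <= eps / 2)) as (y & _ & humps).
    - intros y m m' m_le (u & M & u_le & u_supp & u_near). exists u, M.
      split; [auto|split; [|auto]]. intros t out. apply u_supp. lia.
    - intros m. destruct (hump_exists K m eps) as (u & M & u_le & u_supp & K_large);
        [lra|intros le; apply none; eauto|].
      destruct (net u u_le) as (y & y_in & y_near). exists y. split; auto. exists u, M. auto.
    - assert (norm y <= eps / 2).
      { apply (humps_cluster_norm_le K). intros m.
        destruct (humps m) as (u & M & u_le & u_supp & _ & u_near). eauto. }
      destruct (humps 0%nat) as (u & M & _ & _ & K_large & u_near).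
      pose proof (norm_le_add_norm_sub (K u) y). lra. }
  destruct small as [m0 m0_small]. exists m0. intros m m_ge.
  rewrite <- (tail_comp m0 m m_ge), <- bcomp_assoc.
  apply opnorm_le_contraction_r; [auto|apply opnorm_le_diag].
Qed.

Lemma calkin_norm_le_comp_tail (A : Bop) (r eps : R) : calkin_norm_le A r -> 0 < eps ->
  eventually (fun m => opnorm_le (A [*] tail m) (r + eps)).
Proof.
  intros A_le eps_pos. destruct (A_le (eps / 2)) as (K & K_cpt & AK_le); [lra|].
  apply filter_imp with (fun m => opnorm_le (K [*] tail m) (eps / 2));
    [|apply compact_comp_tail; auto; lra].
  intros m K_small. replace (A [*] tail m) with ((A [+] K) [*] tail m [-] K [*] tail m) by bop_ring.
  replace (r + eps) with (r + eps / 2 + eps / 2) by field.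
  apply opnorm_le_sub; auto. apply opnorm_le_contraction_r; [auto|apply opnorm_le_diag].
Qed.

Lemma calkin_norm_le_tail_comp (A : Bop) (r eps : R) : calkin_norm_le A r -> 0 < eps ->
  eventually (fun m => opnorm_le (tail m [*] A) (r + eps)).
Proof.
  intros A_le eps_pos. destruct (A_le (eps / 2)) as (K & K_cpt & AK_le); [lra|].
  apply filter_imp with (fun m => opnorm_le (tail m [*] K) (eps / 2));
    [|apply compact_tail_comp; auto; lra].
  intros m K_small. replace (tail m [*] A) with (tail m [*] (A [+] K) [-] tail m [*] K) by bop_ring.
  replace (r + eps) with (r + eps / 2 + eps / 2) by field.
  apply opnorm_le_sub; auto. apply opnorm_le_contraction_l; [apply opnorm_le_diag|auto].
Qed.

End Tails.

(** * Quasicentral cutoffs *)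

Section Cutoffs.
Context {E : exponent}.
Notation p := pexp.

Definition commutator (X A : Bop) : Bop := X [*] A [-] A [*] X.

Definition window (m m' : nat) : Bop := head m' [*] tail m.

Lemma window_app (m m' : nat) (x : ellp) (t : nat) :
  window m m' x t = if andb (m <=? t)%nat (t <? m')%nat then x t else C0.
Proof.
  unfold window. unfold_bop. rewrite head_app, tail_app.
  destruct (Nat.ltb_spec t m'), (Nat.ltb_spec t m), (Nat.leb_spec m t); simpl; auto; lia.
Qed.

Lemma opnorm_le_window (m m' : nat) : opnorm_le (window m m') 1.
Proof. apply opnorm_le_contraction_l; apply opnorm_le_diag. Qed.

Section Windows.
Variable ms : nat -> nat.
Hypothesis ms_incr : forall b, (ms b <= ms (S b))%nat.

Lemma sum_norm_window_le (N : nat) (x : ellp) :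
  rsum N (fun b => rpow (norm (window (ms b) (ms (S b)) x)) p) <= rpow (norm (head (ms N) x)) p.
Proof.
  induction N as [|N IH]; simpl; [positivity|]. specialize (ms_incr N).
  replace (head (ms (S N)) x) with (ladd (head (ms N) x) (window (ms N) (ms (S N)) x)).
  - eapply Rle_trans; [apply Rplus_le_compat_r, IH|]. apply norm_pow_disjoint_ge.
    intros t. rewrite head_app, window_app.
    destruct (Nat.ltb_spec t (ms N)), (Nat.leb_spec (ms N) t); simpl; auto; lia.
  - apply ellp_ext. intros t. rewrite coord_add, !head_app, window_app.
    destruct (Nat.ltb_spec t (ms N)), (Nat.leb_spec (ms N) t), (Nat.ltb_spec t (ms (S N)));
      simpl; try lia; ring.
Qed.

Lemma window_sum_support (N : nat) (z : nat -> ellp) (t : nat) : (ms N <= t)%nat ->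
  vsum N (fun b => window (ms b) (ms (S b)) (z b)) t = C0.
Proof.
  rewrite coord_vsum. intros t_ge. apply msum_zero. intros b b_lt. rewrite window_app.
  pose proof (monotone_of_steps le ms ms_incr (S b) N b_lt).
  destruct (Nat.ltb_spec t (ms (S b))); [lia|]. rewrite Bool.andb_false_r. reflexivity.
Qed.

Lemma norm_window_sum_le (N : nat) (z : nat -> ellp) :
  rpow (norm (vsum N (fun b => window (ms b) (ms (S b)) (z b)))) p
    <= rsum N (fun b => rpow (norm (window (ms b) (ms (S b)) (z b))) p).
Proof.
  induction N as [|N IH]; cbn [msum].
  - rewrite norm_zero, rpow_0. lra.
  - eapply Rle_trans; [apply norm_pow_disjoint_le|apply Rplus_le_compat_r, IH].
    intros t. destruct (le_lt_dec (ms N) t); [left; apply window_sum_support; auto|right].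
    rewrite window_app. destruct (Nat.leb_spec (ms N) t); [lia|reflexivity].
Qed.

End Windows.

Lemma opnorm_le_band (ms ms' : nat -> nat) (A : Bop) (r : R) (N : nat) :
  (forall b, (ms b <= ms (S b))%nat) -> (forall b, (ms' b <= ms' (S b))%nat) -> opnorm_le A r ->
  opnorm_le (bsum N (fun b =>
    window (ms b) (ms (S b)) [*] (A [*] window (ms' b) (ms' (S b))))) r.
Proof.
  intros ms_incr ms'_incr [r_nonneg A_le]. split; auto. intros x. rewrite bsum_app. unfold_bop.
  apply rpow_le_reg with p; [positivity..|].
  eapply Rle_trans;
    [apply (norm_window_sum_le ms ms_incr N (fun b => A (window (ms' b) (ms' (S b)) x)))|].
  apply Rle_trans with (rsum N (fun b => rpow r p * rpow (norm (window (ms' b) (ms' (S b)) x)) p)).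
  - apply rsum_le. intros b _. rewrite <- rpow_mult_distr by positivity.
    apply rpow_le; [positivity|]. split; [positivity|]. eapply Rle_trans; [|apply A_le].
    pose proof (proj2 (opnorm_le_window (ms b) (ms (S b))) (A (window (ms' b) (ms' (S b)) x))). lra.
  - rewrite rsum_scal, rpow_mult_distr by positivity. apply Rmult_le_compat_l; [positivity|].
    eapply Rle_trans; [apply (sum_norm_window_le ms' ms'_incr)|]. apply rpow_le; [positivity|].
    split; [positivity|apply norm_diag_le].
Qed.

Lemma commutator_head (m0 m1 m2 : nat) (A : Bop) : (m0 <= m1 <= m2)%nat ->
  commutator (head m1) A =
  (window m0 m1 [*] (A [*] window m1 m2)
   [+] (head m0 [*] A [*] tail m1 [*] head m2 [+] head m1 [*] A [*] tail m2))
  [-] (window m1 m2 [*] (A [*] window m0 m1)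
   [+] (head m2 [*] (tail m1 [*] A [*] head m0) [+] tail m2 [*] A [*] head m1)).
Proof.
  intros m_le. unfold commutator, window.
  assert (tail_split : tail m1 = head m2 [*] tail m1 [+] tail m2).
  { rewrite head_tail_comm. pattern (tail m2) at 1. rewrite <- (tail_comp m1 m2) by lia.
    rewrite <- bcomp_add_r, head_add_tail, bcomp_id_r. reflexivity. }
  assert (head_split : head m1 = head m1 [*] tail m0 [+] head m0).
  { pattern (head m0) at 1. rewrite <- (head_comp m0 m1) by lia.
    rewrite <- bcomp_add_r, (badd_comm (tail m0)), head_add_tail, bcomp_id_r. reflexivity. }
  assert (upper : forall B1 B2 P0 P1 Q1 Q2 : Bop, Q1 = B2 [+] Q2 -> P1 = B1 [+] P0 ->
    P1 [*] A [*] Q1 = B1 [*] (A [*] B2) [+] (P0 [*] (A [*] B2) [+] P1 [*] A [*] Q2)).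
  { intros B1 B2 P0 P1 Q1 Q2 -> P1_split.
    transitivity (P1 [*] (A [*] B2) [+] P1 [*] A [*] Q2); [bop_ring|].
    rewrite P1_split at 1. bop_ring. }
  assert (lower : forall B1 B2 P0 P1 Q1 Q2 : Bop, Q1 = B2 [+] Q2 -> P1 = B1 [+] P0 ->
    Q1 [*] A [*] P1 = B2 [*] (A [*] B1) [+] (B2 [*] (A [*] P0) [+] Q2 [*] A [*] P1)).
  { intros B1 B2 P0 P1 Q1 Q2 -> P1_split.
    transitivity (B2 [*] (A [*] P1) [+] Q2 [*] A [*] P1); [bop_ring|].
    rewrite P1_split at 1. bop_ring. }
  transitivity (head m1 [*] A [*] tail m1 [-] tail m1 [*] A [*] head m1).
  { rewrite tail_eq. bop_ring. }
  rewrite (upper _ _ _ _ _ _ tail_split head_split), (lower _ _ _ _ _ _ tail_split head_split).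
  rewrite !bcomp_assoc, (head_tail_comm m2 m1). reflexivity.
Qed.

Definition nearly_tridiagonal (ms : nat -> nat) (delta : R) (A : Bop) : Prop :=
  forall b, opnorm_le (head (ms b) [*] A [*] tail (ms (S b))) delta /\
            opnorm_le (tail (ms (S b)) [*] A [*] head (ms b)) delta.

Lemma nearly_tridiagonal_exists (l : list Bop) (m0 : nat) (delta : R) : 0 < delta ->
  exists ms, ms 0%nat = m0 /\ (forall b, (ms b <= ms (S b))%nat) /\
    forall A, In A l -> nearly_tridiagonal ms delta A.
Proof.
  intros delta_pos.
  assert (next : forall m, exists m', (m <= m')%nat /\ forall A, In A l ->
    opnorm_le (head m [*] A [*] tail m') delta /\ opnorm_le (tail m' [*] A [*] head m) delta).
  { intros m. destruct (eventually_list l (fun A m' =>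
      opnorm_le (head m [*] A [*] tail m') delta /\ opnorm_le (tail m' [*] A [*] head m) delta))
      as [m' from_m'].
    - intros A _. apply filter_and.
      + apply compact_comp_tail; auto. apply compact_comp_r, compact_head.
      + apply filter_imp with (fun m' => opnorm_le (tail m' [*] (A [*] head m)) delta).
        * intros m'. rewrite bcomp_assoc. auto.
        * apply compact_tail_comp; auto. apply compact_comp_l, compact_head.
    - exists (Nat.max m m'). split; [lia|]. apply from_m'. lia. }
  destruct (choice _ next) as [step step_spec].
  exists (fun b => Nat.iter b step m0). split; [reflexivity|split].
  - intros b. apply step_spec.
  - intros A A_in b. apply step_spec. auto.
Qed.

Definition average_below (ms : nat -> nat) (N t : nat) : R :=
  rsum N (fun b => below (ms (S b)) t) / INR N.

Section Average.
Variables (ms : nat -> nat) (N : nat).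
Hypothesis ms_incr : forall b, (ms b <= ms (S b))%nat.
Hypothesis N_pos : 0 < INR N.

Lemma average_below_range (t : nat) : 0 <= average_below ms N t <= 1.
Proof.
  split; [apply Rle_mult_inv_pos; auto; apply rsum_nonneg; intros; apply below_range|].
  unfold average_below. apply Rmult_le_reg_r with (INR N); auto.
  unfold Rdiv. rewrite Rmult_assoc, Rinv_l, Rmult_1_l, Rmult_1_r by lra.
  rewrite <- (Rmult_1_r (INR N)), <- rsum_const. apply rsum_le. intros; apply below_range.
Qed.

Lemma average_below_one (t : nat) : (t < ms 0)%nat -> average_below ms N t = 1.
Proof.
  intros t_lt. unfold average_below. rewrite (msum_ext _ _ N _ (fun _ => 1)), rsum_const.
  - field. lra.
  - intros b _. unfold below.
    pose proof (monotone_of_steps le ms ms_incr 0 (S b) (Nat.le_0_l _)).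
    destruct (Nat.ltb_spec t (ms (S b))); [reflexivity|lia].
Qed.

Lemma average_below_zero (t : nat) : (ms N <= t)%nat -> average_below ms N t = 0.
Proof.
  intros t_ge. unfold average_below. rewrite msum_zero; [field; lra|].
  intros b b_lt. unfold below.
  pose proof (monotone_of_steps le ms ms_incr (S b) N b_lt).
  destruct (Nat.ltb_spec t (ms (S b))); [lia|reflexivity].
Qed.

Lemma diag_average_below :
  diag (average_below ms N) = RC (/ INR N) [.] bsum N (fun b => head (ms (S b))).
Proof.
  bop_coords. rewrite diag_app, clip_id, coord_bsum by apply average_below_range.
  rewrite (msum_ext _ _ N _ (fun b => Cmul (x t) (RC (below (ms (S b)) t)))).
  - rewrite csum_scal, csum_RC. unfold average_below, Rdiv. rewrite RC_mul. ring.
  - intros b _. unfold head. rewrite diag_app, clip_id by apply below_range. ring.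
Qed.

Lemma opnorm_le_commutator_average (A : Bop) (r delta : R) :
  opnorm_le A r -> nearly_tridiagonal ms delta A ->
  opnorm_le (commutator (diag (average_below ms N)) A) (2 * r / INR N + 4 * delta).
Proof.
  intros A_le A_tri.
  replace (commutator (diag (average_below ms N)) A)
    with (RC (/ INR N) [.] bsum N (fun b => commutator (head (ms (S b))) A)).
  2:{ unfold commutator. rewrite bsum_sub, <- bcomp_bsum_l, <- bcomp_bsum_r, diag_average_below.
      bop_ring. }
  rewrite (msum_ext _ _ N _ _ (fun b _ =>
    commutator_head (ms b) (ms (S b)) (ms (S (S b))) A (conj (ms_incr b) (ms_incr (S b))))).
  rewrite bsum_sub, !msum_add.
  replace (2 * r / INR N + 4 * delta) with (/ INR N *
    ((r + (INR N * delta + INR N * delta)) + (r + (INR N * delta + INR N * delta))))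
      by (field; lra).
  apply opnorm_le_scale_RC; [positivity|].
  assert (sum_le : forall F, (forall b, opnorm_le (F b) delta) ->
    opnorm_le (bsum N F) (INR N * delta))
    by (intros F F_le; rewrite <- rsum_const; apply opnorm_le_bsum; auto).
  apply opnorm_le_sub; (apply opnorm_le_add; [|apply opnorm_le_add; apply sum_le; intros b]).
  - apply (opnorm_le_band ms (fun b => ms (S b))); auto.
  - apply opnorm_le_contraction_r; [exact (proj1 (A_tri b))|apply opnorm_le_diag].
  - exact (proj1 (A_tri (S b))).
  - apply (opnorm_le_band (fun b => ms (S b)) ms); auto.
  - apply opnorm_le_contraction_l; [apply opnorm_le_diag|exact (proj2 (A_tri b))].
  - exact (proj2 (A_tri (S b))).
Qed.

End Average.

Lemma quasicentral_cutoff (l : list Bop) (m0 : nat) (delta : R) : 0 < delta ->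
  exists w : nat -> R, (forall t, 0 <= w t <= 1) /\ (forall t, (t < m0)%nat -> w t = 1) /\
    (exists s, forall t, (s <= t)%nat -> w t = 0) /\
    forall A, In A l -> opnorm_le (commutator (diag w) A) delta.
Proof.
  intros delta_pos.
  destruct (list_common_bound l opnorm_le) as (r & r_nonneg & l_le).
  { intros A r s r_le. apply opnorm_le_mono; auto. }
  { intros A _. destruct (opnorm_le_exists A) as [r A_le]. exists r. split; auto. apply A_le. }
  destruct (INR_unbounded (4 * r / delta)) as [N N_large].
  assert (N_pos : 0 < INR N) by (eapply Rle_lt_trans; [|apply N_large]; positivity).
  destruct (nearly_tridiagonal_exists l m0 (delta / 8)) as (ms & ms_0 & ms_incr & l_tri); [lra|].
  exists (average_below ms N). split; [|split; [|split]].
  - intros t. apply average_below_range; auto.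
  - intros t t_lt. apply average_below_one; auto. lia.
  - exists (ms N). intros t. apply average_below_zero; auto.
  - intros A A_in. apply opnorm_le_mono with (2 * r / INR N + 4 * (delta / 8));
      [|apply opnorm_le_commutator_average; auto].
    assert (2 * r / INR N <= delta / 2); [|lra].
    apply Rmult_le_reg_r with (2 * INR N / delta); [positivity|].
    replace (2 * r / INR N * (2 * INR N / delta)) with (4 * r / delta) by (field; lra).
    replace (delta / 2 * (2 * INR N / delta)) with (INR N) by (field; lra). lra.
Qed.

End Cutoffs.

(** * Rademacher sums and Khinchine's inequality *)

(* The sign of the [i]-th coordinate, [e < 2 ^ k] being read in binary as a point of {-1,1}^k. *)
Definition rad (i e : nat) : R := if Nat.testbit e i then -1 else 1.

Lemma Rabs_rad (i e : nat) : Rabs (rad i e) = 1.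
Proof. unfold rad. destruct (Nat.testbit e i); [rewrite Rabs_left; lra|apply Rabs_R1]. Qed.

Lemma rad_0_even (e : nat) : rad 0 (2 * e) = 1.
Proof. unfold rad. rewrite Nat.testbit_even_0. reflexivity. Qed.
Lemma rad_0_odd (e : nat) : rad 0 (2 * e + 1) = -1.
Proof. unfold rad. rewrite Nat.testbit_odd_0. reflexivity. Qed.
Lemma rad_S_even (i e : nat) : rad (S i) (2 * e) = rad i e.
Proof. unfold rad. rewrite Nat.testbit_even_succ'. reflexivity. Qed.
Lemma rad_S_odd (i e : nat) : rad (S i) (2 * e + 1) = rad i e.
Proof. unfold rad. rewrite Nat.testbit_odd_succ'. reflexivity. Qed.

Lemma pow2_pos (k : nat) : 0 < 2 ^ k.
Proof. apply pow_lt; lra. Qed.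

Lemma INR_pow2 (k : nat) : INR (2 ^ k) = 2 ^ k.
Proof. rewrite pow_INR. reflexivity. Qed.

Definition sign_mean (k : nat) (F : nat -> R) : R := rsum (2 ^ k) (fun e => / 2 ^ k * F e).

Lemma sign_mean_le (k : nat) (F G : nat -> R) :
  (forall e, F e <= G e) -> sign_mean k F <= sign_mean k G.
Proof. intros FG. apply rsum_le. intros e _. apply Rmult_le_compat_l; positivity. Qed.

Lemma sign_mean_ext (k : nat) (F G : nat -> R) :
  (forall e, F e = G e) -> sign_mean k F = sign_mean k G.
Proof. intros FG. apply msum_ext. intros e _. rewrite FG. reflexivity. Qed.

Lemma sign_mean_nonneg (k : nat) (F : nat -> R) : (forall e, 0 <= F e) -> 0 <= sign_mean k F.
Proof. intros F_nonneg. apply rsum_nonneg. positivity. Qed.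

Lemma sign_mean_scal (k : nat) (c : R) (F : nat -> R) :
  sign_mean k (fun e => c * F e) = c * sign_mean k F.
Proof. unfold sign_mean. rewrite <- rsum_scal. apply msum_ext. intros; ring. Qed.

Lemma sign_mean_add (k : nat) (F G : nat -> R) :
  sign_mean k (fun e => F e + G e) = sign_mean k F + sign_mean k G.
Proof. unfold sign_mean. rewrite <- (msum_add (add := Rplus)). apply msum_ext. intros; ring. Qed.

Lemma sign_mean_const (k : nat) (c : R) : sign_mean k (fun _ => c) = c.
Proof. unfold sign_mean. rewrite rsum_const, INR_pow2. field. positivity. Qed.

Lemma sign_mean_S (k : nat) (F : nat -> R) :
  sign_mean (S k) F = sign_mean k (fun e => (F (2 * e)%nat + F (2 * e + 1)%nat) / 2).
Proof.
  unfold sign_mean. change (2 ^ S k)%nat with (2 * 2 ^ k)%nat. rewrite msum_double.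
  apply msum_ext. intros e _. simpl pow. field. positivity.
Qed.

Lemma rad_orthonormal (k i j : nat) : (i < k)%nat -> (j < k)%nat ->
  sign_mean k (fun e => rad i e * rad j e) = if (i =? j)%nat then 1 else 0.
Proof.
  revert i j. induction k as [|k IH]; intros i j i_lt j_lt; [lia|]. rewrite sign_mean_S.
  destruct i as [|i], j as [|j]; cbn [Nat.eqb];
    [rewrite <- (sign_mean_const k 1)|rewrite <- (sign_mean_const k 0)..|rewrite <- IH by lia];
    apply sign_mean_ext; intros e;
    rewrite ?rad_0_even, ?rad_0_odd, ?rad_S_even, ?rad_S_odd; field.
Qed.

Lemma exp_le (x y : R) : x <= y -> exp x <= exp y.
Proof. intros [x_lt| ->]; [apply Rlt_le, exp_increasing; auto|lra]. Qed.

Lemma exp_le_quadratic (a : R) : -1 <= a <= 1 -> exp a <= 1 + a + 2 * (a * a).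
Proof.
  intros a_range. set (u := exp (a / 2)). set (v := 1 - a / 2).
  assert (uv_le : u * v <= 1).
  { replace 1 with (u * exp (- (a / 2))) by
      (unfold u; rewrite <- exp_plus, Rplus_opp_r; apply exp_0).
    apply Rmult_le_compat_l; [unfold u; positivity|]. unfold v.
    pose proof (exp_ineq1_le (- (a / 2))). lra. }
  assert (uv_pos : 0 < u * v) by (unfold u, v; positivity).
  replace (exp a) with (u * u) by (unfold u; rewrite <- exp_plus; f_equal; field).
  apply Rmult_le_reg_r with (v * v); [unfold v; positivity|].
  apply Rle_trans with 1; [nra|]. unfold v.
  replace ((1 + a + 2 * (a * a)) * ((1 - a / 2) * (1 - a / 2)))
    with (1 + a * a * ((1 - a) * (5 / 4 - a / 2))) by field.
  assert (0 <= a * a) by nra. assert (0 <= (1 - a) * (5 / 4 - a / 2)) by positivity. nra.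
Qed.

Lemma exp_add_exp_opp_le (a : R) : (exp a + exp (- a)) / 2 <= exp (2 * (a * a)).
Proof.
  destruct (Rle_dec (Rabs a) 1) as [a_small|a_large].
  - apply Rabs_le_between in a_small. pose proof (exp_le_quadratic a ltac:(lra)).
    pose proof (exp_le_quadratic (- a) ltac:(lra)). pose proof (exp_ineq1_le (2 * (a * a))). lra.
  - assert (Rabs a <= 2 * (a * a)) by (rewrite <- (Rabs_pos_eq (a * a)), Rabs_mult by nra; nra).
    pose proof (Rle_abs a). pose proof (Rle_abs (- a)) as opp_le. rewrite Rabs_Ropp in opp_le.
    pose proof (exp_le a (2 * (a * a)) ltac:(lra)).
    pose proof (exp_le (- a) (2 * (a * a)) ltac:(lra)). lra.
Qed.

Lemma sign_mean_exp_le (k : nat) (a : nat -> R) :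
  sign_mean k (fun e => exp (rsum k (fun i => a i * rad i e)))
    <= exp (2 * rsum k (fun i => a i * a i)).
Proof.
  revert a. induction k as [|k IH]; intros a.
  - rewrite <- (sign_mean_const 0 (exp _)). apply sign_mean_le. intros e. simpl.
    rewrite Rmult_0_r. lra.
  - rewrite sign_mean_S, msum_S_first, Rmult_plus_distr_l, exp_plus.
    rewrite (sign_mean_ext k _ (fun e => (exp (a 0%nat) + exp (- a 0%nat)) / 2 *
       exp (rsum k (fun i => a (S i) * rad i e)))).
    + rewrite sign_mean_scal.
      apply Rmult_le_compat; [positivity|apply sign_mean_nonneg; positivity| |apply IH].
      apply exp_add_exp_opp_le.
    + intros e. rewrite !msum_S_first, rad_0_even, rad_0_odd, !exp_plus.
      rewrite (msum_ext _ _ k (fun i => a (S i) * rad (S i) (2 * e)) (fun i => a (S i) * rad i e))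
        by (intros; rewrite rad_S_even; auto).
      rewrite (msum_ext _ _ k (fun i => a (S i) * rad (S i) (2 * e + 1))
          (fun i => a (S i) * rad i e))
        by (intros; rewrite rad_S_odd; auto).
      replace (a 0%nat * 1) with (a 0%nat) by ring.
      replace (a 0%nat * -1) with (- a 0%nat) by ring. field.
Qed.

Definition l2norm (k : nat) (a : nat -> R) : R := sqrt (rsum k (fun i => a i * a i)).

Lemma l2norm_nonneg (k : nat) (a : nat -> R) : 0 <= l2norm k a.
Proof. apply sqrt_pos. Qed.

#[export] Hint Resolve l2norm_nonneg : sign.

Lemma l2norm_sq (k : nat) (a : nat -> R) : l2norm k a * l2norm k a = rsum k (fun i => a i * a i).
Proof. apply sqrt_sqrt, rsum_nonneg. intros; nra. Qed.

Lemma l2norm_le (k : nat) (a b : nat -> R) (c : R) : 0 <= c ->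
  (forall i, (i < k)%nat -> Rabs (a i) <= c * Rabs (b i)) -> l2norm k a <= c * l2norm k b.
Proof.
  intros c_nonneg a_le. apply Rsqr_incr_0_var; [|positivity]. unfold Rsqr.
  replace (c * l2norm k b * (c * l2norm k b)) with (c * c * (l2norm k b * l2norm k b)) by ring.
  rewrite !l2norm_sq, <- rsum_scal. apply rsum_le. intros i i_lt. specialize (a_le i i_lt).
  rewrite <- (Rabs_pos_eq (a i * a i)), <- (Rabs_pos_eq (b i * b i)), !Rabs_mult by nra.
  replace (c * c * (Rabs (b i) * Rabs (b i))) with (c * Rabs (b i) * (c * Rabs (b i))) by ring.
  apply Rmult_le_compat; positivity.
Qed.

Lemma l2norm_eq_0 (k : nat) (a : nat -> R) (i : nat) : l2norm k a = 0 -> (i < k)%nat -> a i = 0.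
Proof.
  intros a_zero i_lt. pose proof (l2norm_sq k a) as sq. rewrite a_zero in sq.
  pose proof (rsum_ge_term k i (fun i => a i * a i) i_lt (fun i => Rle_0_sqr (a i))) as term_le.
  simpl in *. nra.
Qed.

Lemma l2norm_normalized (k : nat) (a : nat -> R) : l2norm k a <> 0 ->
  rsum k (fun i => a i / l2norm k a * (a i / l2norm k a)) = 1.
Proof.
  intros a_nz. rewrite (msum_ext _ _ k _ (fun i => / (l2norm k a * l2norm k a) * (a i * a i)))
    by (intros; field; auto).
  rewrite rsum_scal, <- l2norm_sq. field. auto.
Qed.

Definition khinchine_const (r : R) : R := rpow r r * (2 * exp 2).

Lemma khinchine_const_pos (r : R) : 0 < r -> 0 < khinchine_const r.
Proof. unfold khinchine_const. positivity. Qed.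

#[export] Hint Extern 1 (0 <= khinchine_const _) => apply Rlt_le, khinchine_const_pos : sign.

Lemma khinchine_unit (k : nat) (a : nat -> R) (r : R) : 0 < r -> rsum k (fun i => a i * a i) <= 1 ->
  sign_mean k (fun e => rpow (Rabs (rsum k (fun i => a i * rad i e))) r) <= khinchine_const r.
Proof.
  intros r_pos a_le.
  apply Rle_trans with (sign_mean k (fun e => rpow r r *
     (exp (rsum k (fun i => a i * rad i e)) + exp (rsum k (fun i => - a i * rad i e))))).
  - apply sign_mean_le. intros e. eapply Rle_trans; [apply rpow_le_exp; positivity|].
    apply Rmult_le_compat_l; [positivity|].
    rewrite (msum_ext _ _ k (fun i => - a i * rad i e) (fun i => -1 * (a i * rad i e))), rsum_scal
      by (intros; ring). set (s := rsum k (fun i => a i * rad i e)).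
    replace (-1 * s) with (- s) by ring. pose proof (exp_pos s). pose proof (exp_pos (- s)).
    unfold Rabs. destruct (Rcase_abs s); lra.
  - rewrite sign_mean_scal, sign_mean_add. apply Rmult_le_compat_l; [positivity|].
    assert (moment : forall b, rsum k (fun i => b i * b i) <= 1 ->
      sign_mean k (fun e => exp (rsum k (fun i => b i * rad i e))) <= exp 2)
      by (intros b b_le; eapply Rle_trans; [apply sign_mean_exp_le|apply exp_le; lra]).
    pose proof (moment a a_le).
    assert (sign_mean k (fun e => exp (rsum k (fun i => - a i * rad i e))) <= exp 2); [|lra].
    apply moment. rewrite (msum_ext _ _ k _ (fun i => a i * a i)) by (intros; ring). auto.
Qed.

Lemma khinchine (k : nat) (a : nat -> R) (r : R) : 0 < r ->
  sign_mean k (fun e => rpow (Rabs (rsum k (fun i => a i * rad i e))) r)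
    <= khinchine_const r * rpow (l2norm k a) r.
Proof.
  intros r_pos. destruct (Req_dec (l2norm k a) 0) as [a_zero|a_nz].
  - rewrite a_zero, rpow_0, Rmult_0_r.
    apply Rle_trans with (sign_mean k (fun _ => 0)); [|rewrite sign_mean_const; lra].
    apply sign_mean_le. intros e.
    rewrite msum_zero, Rabs_R0, rpow_0; [lra|].
    intros i i_lt. rewrite (l2norm_eq_0 k a i a_zero i_lt). ring.
  - pose proof (khinchine_unit k (fun i => a i / l2norm k a) r r_pos) as unit.
    cbv beta in unit. rewrite l2norm_normalized in unit by auto. specialize (unit (Rle_refl 1)).
    apply Rmult_le_compat_r with (r := rpow (l2norm k a) r) in unit; [|positivity].
    eapply Rle_trans; [|apply unit]. rewrite Rmult_comm, <- sign_mean_scal.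
    right. apply sign_mean_ext. intros e. rewrite <- rpow_mult_distr by positivity. f_equal.
    rewrite <- (Rabs_pos_eq (l2norm k a)) at 1 by positivity. rewrite <- Rabs_mult, <- rsum_scal.
    f_equal. apply msum_ext. intros i _. field. auto.
Qed.

Section Holder.
Variables (p q : R).
Hypothesis p_gt1 : 1 < p.
Hypothesis q_pos : 0 < q.
Hypothesis conjugate : / p + / q = 1.
Variables (n : nat) (c f g : nat -> R).
Hypothesis c_nonneg : forall i, 0 <= c i.
Hypothesis f_nonneg : forall i, 0 <= f i.
Hypothesis g_nonneg : forall i, 0 <= g i.

Lemma weighted_Holder_of_pos (a b : R) : 0 < a -> 0 < b ->
  rsum n (fun i => c i * rpow (f i) p) <= rpow a p ->
  rsum n (fun i => c i * rpow (g i) q) <= rpow b q ->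
  rsum n (fun i => c i * (f i * g i)) <= a * b.
Proof.
  intros a_pos b_pos f_le g_le.
  assert (0 < rpow a p) by positivity. assert (0 < rpow b q) by positivity.
  apply Rle_trans with (a * b * (/ p * (/ rpow a p * rsum n (fun i => c i * rpow (f i) p))
    + / q * (/ rpow b q * rsum n (fun i => c i * rpow (g i) q)))).
  - rewrite <- !rsum_scal, <- (msum_add (add := Rplus)), <- rsum_scal. apply rsum_le. intros i _.
    replace (c i * (f i * g i)) with (a * b * (c i * ((/ a * f i) * (/ b * g i)))) by (field; lra).
    apply Rmult_le_compat_l; [positivity|].
    pose proof (Young_inequality (/ a * f i) (/ b * g i) p q) as Young.
    rewrite !rpow_mult_distr, !rpow_Rinv in Young by positivity.
    replace (/ p * (/ rpow a p * (c i * rpow (f i) p)) + / q * (/ rpow b q * (c i * rpow (g i) q)))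
      with (c i * (/ rpow a p * rpow (f i) p / p + / rpow b q * rpow (g i) q / q)) by (field; lra).
    apply Rmult_le_compat_l; [auto|]. apply Young; positivity.
  - apply Rmult_le_compat_l with (r := / rpow a p) in f_le; [|positivity].
    apply Rmult_le_compat_l with (r := / rpow b q) in g_le; [|positivity].
    rewrite Rinv_l in f_le, g_le by lra.
    rewrite <- (Rmult_1_r (a * b)) at 2. apply Rmult_le_compat_l; [positivity|].
    rewrite <- conjugate. rewrite <- (Rmult_1_r (/ p)) at 2. rewrite <- (Rmult_1_r (/ q)) at 2.
    apply Rplus_le_compat; apply Rmult_le_compat_l; positivity.
Qed.

Lemma weighted_Holder (a b : R) : 0 <= a -> 0 < b ->
  rsum n (fun i => c i * rpow (f i) p) <= rpow a p ->
  rsum n (fun i => c i * rpow (g i) q) <= rpow b q ->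
  rsum n (fun i => c i * (f i * g i)) <= a * b.
Proof.
  intros a_nonneg b_pos f_le g_le. apply le_epsilon. intros eps eps_pos.
  assert (0 < eps / b) by positivity.
  replace (a * b + eps) with ((a + eps / b) * b) by (field; lra).
  apply weighted_Holder_of_pos; auto; [lra|].
  eapply Rle_trans; [apply f_le|]. apply rpow_le; lra.
Qed.

End Holder.

Lemma khinchine_dual (p q : R) (k : nat) (F : nat -> R) : 1 < p -> 0 < q -> / p + / q = 1 ->
  rpow (l2norm k (fun i => sign_mean k (fun e => F e * rad i e))) p
    <= rpow (khinchine_const q) (p / q) * sign_mean k (fun e => rpow (Rabs (F e)) p).
Proof.
  intros p_gt1 q_pos conjugate. set (a := fun i => sign_mean k (fun e => F e * rad i e)).
  assert (mean_nonneg : 0 <= sign_mean k (fun e => rpow (Rabs (F e)) p))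
    by (apply sign_mean_nonneg; positivity).
  pose proof (khinchine_const_pos q q_pos) as const_pos.
  destruct (l2norm_nonneg k a) as [a_pos|<-]; [|rewrite rpow_0; positivity].
  set (b i := a i / l2norm k a). set (S e := rsum k (fun i => b i * rad i e)).
  assert (b_unit : rsum k (fun i => b i * b i) = 1) by (apply l2norm_normalized; lra).
  assert (pairing : l2norm k a = sign_mean k (fun e => F e * S e)).
  { transitivity (rsum k (fun i => b i * a i)).
    - rewrite (msum_ext _ _ k _ (fun i => l2norm k a * (b i * b i))), rsum_scal, b_unit
        by (intros; unfold b; field; lra). ring.
    - unfold a, S, sign_mean.
      rewrite (msum_ext _ _ k _
        (fun i => rsum (2 ^ k) (fun e => b i * (/ 2 ^ k * (F e * rad i e)))))
        by (intros; symmetry; apply rsum_scal).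
      rewrite msum_swap. apply msum_ext. intros e _. rewrite <- !rsum_scal.
      apply msum_ext. intros; ring. }
  assert (bound : l2norm k a <= rpow (sign_mean k (fun e => rpow (Rabs (F e)) p)) (/ p)
                                * rpow (khinchine_const q) (/ q)).
  { rewrite pairing. apply Rle_trans with (sign_mean k (fun e => Rabs (F e) * Rabs (S e))).
    - apply sign_mean_le. intros e. rewrite <- Rabs_mult. apply Rle_abs.
    - apply weighted_Holder with p q; try positivity; rewrite rpow_Rinv_rpow by lra;
        [apply Rle_refl|].
      apply khinchine_unit; lra. }
  eapply Rle_trans; [apply rpow_le; [lra|split; [lra|apply bound]]|].
  rewrite rpow_mult_distr, rpow_Rinv_rpow, rpow_rpow by positivity.
  replace (/ q * p) with (p / q) by (unfold Rdiv; ring). lra.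
Qed.

Definition rad_sum (k : nat) (c : nat -> CC) (e : nat) : CC :=
  csum k (fun i => Cmul (RC (rad i e)) (c i)).

Definition rad_coeff (k : nat) (F : nat -> CC) (i : nat) : CC :=
  csum (2 ^ k) (fun e => Cmul (RC (rad i e / 2 ^ k)) (F e)).

Lemma khinchine_complex (k : nat) (c : nat -> CC) (p : R) : 1 <= p ->
  sign_mean k (fun e => rpow (Cnorm (rad_sum k c e)) p)
    <= rpow 2 p * (2 * khinchine_const p) * rpow (l2norm k (fun i => Cnorm (c i))) p.
Proof.
  intros p_ge1.
  assert (part : forall part : CC -> R,
    (forall z, Rabs (part z) <= Cnorm z) ->
    (forall e, part (rad_sum k c e) = rsum k (fun i => part (c i) * rad i e)) ->
    sign_mean k (fun e => rpow (Rabs (part (rad_sum k c e))) p)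
      <= khinchine_const p * rpow (l2norm k (fun i => Cnorm (c i))) p).
  { intros part part_le part_sum.
    rewrite (sign_mean_ext k _ (fun e => rpow (Rabs (rsum k (fun i => part (c i) * rad i e))) p))
      by (intros; rewrite part_sum; auto).
    eapply Rle_trans; [apply khinchine; lra|]. apply Rmult_le_compat_l; [positivity|].
    apply rpow_le; [lra|]. split; [positivity|].
    rewrite <- (Rmult_1_l (l2norm k (fun i => Cnorm (c i)))). apply l2norm_le; [lra|].
    intros i _. rewrite Rmult_1_l, (Rabs_pos_eq (Cnorm (c i))) by positivity. apply part_le. }
  apply Rle_trans with (sign_mean k (fun e => rpow 2 p *
    (rpow (Rabs (fst (rad_sum k c e))) p + rpow (Rabs (snd (rad_sum k c e))) p))).
  - apply sign_mean_le. intros e. eapply Rle_trans; [|apply rpow_add_le; positivity].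
    apply rpow_le; [lra|]. split; [positivity|apply Cnorm_le_Rabs_fst_snd].
  - rewrite sign_mean_scal, sign_mean_add, !Rmult_assoc.
    apply Rmult_le_compat_l; [positivity|]. rewrite <- Rplus_diag.
    apply Rplus_le_compat; apply part; auto using Rabs_fst_le_Cnorm, Rabs_snd_le_Cnorm;
      intros e; unfold rad_sum; [rewrite fst_csum|rewrite snd_csum];
      apply msum_ext; intros; unfold RC, Cmul; simpl; ring.
Qed.

Lemma l2norm_Cnorm_le (k : nat) (c : nat -> CC) :
  l2norm k (fun i => Cnorm (c i)) <= l2norm k (fun i => fst (c i)) + l2norm k (fun i => snd (c i)).
Proof.
  pose proof (l2norm_nonneg k (fun i => fst (c i))).
  pose proof (l2norm_nonneg k (fun i => snd (c i))).
  apply Rsqr_incr_0_var; [|lra]. unfold Rsqr. rewrite l2norm_sq.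
  rewrite (msum_ext _ _ k _ _ (fun i _ => Cnorm_sq (c i))), (msum_add (add := Rplus)).
  rewrite <- !l2norm_sq. nra.
Qed.

Lemma khinchine_dual_complex (p q : R) (k : nat) (F : nat -> CC) : 1 < p -> 0 < q ->
  / p + / q = 1 ->
  rpow (l2norm k (fun i => Cnorm (rad_coeff k F i))) p
    <= rpow 2 p * (2 * rpow (khinchine_const q) (p / q))
      * sign_mean k (fun e => rpow (Cnorm (F e)) p).
Proof.
  intros p_gt1 q_pos conjugate. set (K := rpow (khinchine_const q) (p / q)).
  assert (part : forall part : CC -> R, (forall z, Rabs (part z) <= Cnorm z) ->
    (forall i, part (rad_coeff k F i) = sign_mean k (fun e => part (F e) * rad i e)) ->
    rpow (l2norm k (fun i => part (rad_coeff k F i))) p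
      <= K * sign_mean k (fun e => rpow (Cnorm (F e)) p)).
  { intros part part_le part_coeff. unfold l2norm.
    rewrite (msum_ext _ _ k _ (fun i => sign_mean k (fun e => part (F e) * rad i e) *
      sign_mean k (fun e => part (F e) * rad i e))) by (intros; rewrite part_coeff; auto).
    eapply Rle_trans; [apply (khinchine_dual p q k (fun e => part (F e))); auto|].
    apply Rmult_le_compat_l; [unfold K; positivity|]. apply sign_mean_le. intros e.
    apply rpow_le; [|split]; positivity. }
  eapply Rle_trans; [apply rpow_le; [lra|split; [positivity|apply l2norm_Cnorm_le]]|].
  eapply Rle_trans; [apply rpow_add_le; positivity|]. rewrite !Rmult_assoc.
  apply Rmult_le_compat_l; [positivity|]. rewrite <- Rplus_diag.
  apply Rplus_le_compat; apply part; auto using Rabs_fst_le_Cnorm, Rabs_snd_le_Cnorm;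
    intros i; unfold rad_coeff, sign_mean; [rewrite fst_csum|rewrite snd_csum];
    apply msum_ext; intros; unfold RC, Cmul, Rdiv; simpl; ring.
Qed.

(* The projection of [F] onto the span of the Rademacher functions, followed by a multiplier. *)
Lemma rademacher_multiplier_bounded (p : R) : 1 < p -> exists K, 0 <= K /\
  forall k (F b : nat -> CC) beta, 0 <= beta -> (forall i, (i < k)%nat -> Cnorm (b i) <= beta) ->
  sign_mean k (fun e => rpow (Cnorm (rad_sum k (fun i => Cmul (b i) (rad_coeff k F i)) e)) p)
  <= rpow (K * beta) p * sign_mean k (fun e => rpow (Cnorm (F e)) p).
Proof.
  intros p_gt1. set (q := p / (p - 1)).
  assert (q_pos : 0 < q) by (unfold q; positivity).
  set (Kp := rpow 2 p * (2 * khinchine_const p)).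
  set (Kq := rpow 2 p * (2 * rpow (khinchine_const q) (p / q))).
  assert (Kp_nonneg : 0 <= Kp)
    by (unfold Kp; pose proof (khinchine_const_pos p ltac:(lra)); positivity).
  assert (Kq_nonneg : 0 <= Kq) by (unfold Kq; positivity).
  exists (rpow (Kp * Kq) (/ p)). split; [positivity|]. intros k F b beta beta_nonneg b_le.
  rewrite rpow_mult_distr, rpow_Rinv_rpow by positivity.
  eapply Rle_trans; [apply khinchine_complex; lra|]. fold Kp.
  set (A := l2norm k (fun i => Cnorm (rad_coeff k F i))).
  apply Rle_trans with (Kp * rpow (beta * A) p).
  - apply Rmult_le_compat_l; auto. apply rpow_le; [lra|]. split; [positivity|].
    apply l2norm_le; auto. intros i i_lt. rewrite !Rabs_pos_eq, Cnorm_mul by positivity.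
    apply Rmult_le_compat_r; positivity.
  - pose proof (khinchine_dual_complex p q k F p_gt1 q_pos ltac:(unfold q; field; lra)) as dual.
    fold Kq A in dual. unfold A in *. rewrite rpow_mult_distr by positivity.
    apply Rmult_le_compat_l with (r := Kp * rpow beta p) in dual; [|positivity]. lra.
Qed.

(** * Continuous functions and compact subsets of R^d *)

Section Functions.
Variables (d : nat) (M : pt -> Prop).

Lemma cont_const (c : CC) : cont_on d M (fun _ => c).
Proof.
  intros x _ eps eps_pos. exists 1. split; [lra|]. intros.
  replace (Csub c c) with C0 by ring. rewrite Cnorm_C0. auto.
Qed.

Lemma cont_add (f g : fn) : cont_on d M f -> cont_on d M g -> cont_on d M (fadd f g).
Proof.
  intros f_cont g_cont x Mx eps eps_pos.
  destruct (f_cont x Mx (eps / 2)) as (r & r_pos & f_near); [lra|].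
  destruct (g_cont x Mx (eps / 2)) as (s & s_pos & g_near); [lra|].
  exists (Rmin r s). split; [apply Rmin_glb_lt; auto|]. intros y My near_xy.
  pose proof (Rmin_l r s). pose proof (Rmin_r r s).
  specialize (f_near y My ltac:(lra)). specialize (g_near y My ltac:(lra)). unfold fadd.
  replace (Csub (Cadd (f y) (g y)) (Cadd (f x) (g x)))
    with (Cadd (Csub (f y) (f x)) (Csub (g y) (g x))) by ring.
  eapply Rle_lt_trans; [apply Cnorm_add|]. lra.
Qed.

Lemma cont_mul (f g : fn) : cont_on d M f -> cont_on d M g -> cont_on d M (fmul f g).
Proof.
  intros f_cont g_cont x Mx eps eps_pos. set (K := Cnorm (f x) + Cnorm (g x) + 1).
  pose proof (Cnorm_nonneg (f x)). pose proof (Cnorm_nonneg (g x)).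
  assert (K_pos : 0 < K) by (unfold K; lra). set (e := Rmin 1 (eps / (2 * K))).
  assert (e_pos : 0 < e) by (apply Rmin_glb_lt; positivity).
  assert (eK_lt : e * K < eps).
  { apply Rle_lt_trans with (eps / (2 * K) * K); [apply Rmult_le_compat_r; [lra|apply Rmin_r]|].
    replace (eps / (2 * K) * K) with (eps / 2) by (field; lra). lra. }
  destruct (f_cont x Mx e e_pos) as (r & r_pos & f_near).
  destruct (g_cont x Mx e e_pos) as (s & s_pos & g_near).
  exists (Rmin r s). split; [apply Rmin_glb_lt; auto|]. intros y My near_xy.
  pose proof (Rmin_l r s). pose proof (Rmin_r r s).
  specialize (f_near y My ltac:(lra)). specialize (g_near y My ltac:(lra)). unfold fmul.
  set (u := Csub (f y) (f x)) in *. set (v := Csub (g y) (g x)) in *.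
  replace (Csub (Cmul (f y) (g y)) (Cmul (f x) (g x)))
    with (Cadd (Cmul u v) (Cadd (Cmul u (g x)) (Cmul (f x) v))) by (unfold u, v; ring).
  eapply Rle_lt_trans; [apply Cnorm_add|].
  eapply Rle_lt_trans; [apply Rplus_le_compat_l, Cnorm_add|]. rewrite !Cnorm_mul.
  apply Rle_lt_trans with (e * 1 + (e * Cnorm (g x) + Cnorm (f x) * e)); [|unfold K in eK_lt; lra].
  pose proof (Rmin_l 1 (eps / (2 * K)) : e <= 1).
  repeat apply Rplus_le_compat; apply Rmult_le_compat; positivity.
Qed.

Lemma cont_scale (c : CC) (f : fn) : cont_on d M f -> cont_on d M (fscale c f).
Proof. intros f_cont. apply (cont_mul (fun _ => c)); auto. apply cont_const. Qed.

Definition fsum (k : nat) (F : nat -> fn) : fn := fun y => csum k (fun i => F i y).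

Lemma cont_fsum (k : nat) (F : nat -> fn) :
  (forall i, (i < k)%nat -> cont_on d M (F i)) -> cont_on d M (fsum k F).
Proof.
  induction k as [|k IH]; intros F_cont; [apply cont_const|].
  apply (cont_add (fsum k F) (F k)); auto.
Qed.

End Functions.

Definition near (d : nat) (x y : pt) (r : R) : Prop :=
  forall i, (i < d)%nat -> Rabs (x i - y i) < r.

Lemma near_refl (d : nat) (x : pt) (r : R) : 0 < r -> near d x x r.
Proof. intros r_pos i _. rewrite Rminus_diag, Rabs_R0. auto. Qed.

Lemma near_weaken (d : nat) (x y : pt) (r s : R) : r <= s -> near d x y r -> near d x y s.
Proof. intros r_le xy_near i i_lt. specialize (xy_near i i_lt). lra. Qed.

Lemma near_trans (d : nat) (x y z : pt) (r s : R) :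
  near d x y r -> near d y z s -> near d x z (r + s).
Proof.
  intros xy_near yz_near i i_lt. specialize (xy_near i i_lt). specialize (yz_near i i_lt).
  replace (x i - z i) with ((x i - y i) + (y i - z i)) by ring.
  pose proof (Rabs_triang (x i - y i) (y i - z i)). lra.
Qed.

Section CompactSubsets.
Variable d : nat.
Hypothesis d_pos : (1 <= d)%nat.

Lemma dist_rsum (x y : pt) : dist d x y = sqrt (rsum d (fun i => (x i - y i) * (x i - y i))).
Proof. unfold dist. rewrite sum_f_R0_rsum. do 2 f_equal. lia. Qed.

Lemma near_of_dist (x y : pt) (r : R) : dist d x y < r -> near d x y r.
Proof.
  rewrite dist_rsum. intros dist_lt i i_lt. eapply Rle_lt_trans; [|apply dist_lt].
  rewrite <- sqrt_Rsqr_abs. apply sqrt_le_1_alt.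
  apply (rsum_ge_term d i (fun i => (x i - y i) * (x i - y i)) i_lt). intros; apply Rle_0_sqr.
Qed.

Lemma dist_le_of_near (x y : pt) (r : R) : 0 <= r -> near d x y r -> dist d x y <= INR d * r.
Proof.
  intros r_nonneg xy_near. rewrite dist_rsum.
  assert (d_ge1 : 1 <= INR d) by (apply (le_INR 1); auto).
  rewrite <- (sqrt_Rsqr (INR d * r)) by nra. apply sqrt_le_1_alt.
  apply Rle_trans with (rsum d (fun _ => r * r)).
  - apply rsum_le. intros i i_lt. specialize (xy_near i i_lt). pose proof (Rabs_pos (x i - y i)).
    rewrite <- (Rabs_pos_eq ((x i - y i) * (x i - y i))), Rabs_mult by apply Rle_0_sqr.
    apply Rmult_le_compat; lra.
  - rewrite rsum_const. unfold Rsqr. assert (0 <= r * r) by nra.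
    replace (INR d * r * (INR d * r)) with (INR d * (INR d * (r * r))) by ring.
    apply Rmult_le_compat_l; nra.
Qed.

Lemma box_open (x : pt) (r : R) : open_set d (fun y => near d x y r).
Proof.
  intros y xy_near.
  destruct (list_common_radius (seq 0 d) (fun i r' => Rabs (x i - y i) + r' <= r))
    as (r' & r'_pos & slack).
  - intros i s t t_le s_slack. lra.
  - intros i i_in. apply in_seq in i_in. specialize (xy_near i ltac:(lia)).
    exists (r - Rabs (x i - y i)). lra.
  - exists r'. split; auto. intros z yz_dist i i_lt.
    specialize (slack i ltac:(apply in_seq; lia)). pose proof (near_of_dist y z r' yz_dist i i_lt).
    replace (x i - z i) with ((x i - y i) + (y i - z i)) by ring.
    pose proof (Rabs_triang (x i - y i) (y i - z i)). lra.
Qed.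

Variable M : pt -> Prop.
Hypothesis M_compact : compact_set d M.

Lemma compact_boxes (Q : pt -> R -> Prop) :
  (forall x, M x -> exists r, 0 < r /\ Q x r) ->
  exists l : list (pt * R), (forall c, In c l -> 0 < snd c /\ Q (fst c) (snd c)) /\
    forall y, M y -> exists c, In c l /\ near d (fst c) y (snd c).
Proof.
  intros local.
  destruct (M_compact {c : pt * R | 0 < snd c /\ Q (fst c) (snd c)}
    (fun c y => near d (fst (proj1_sig c)) y (snd (proj1_sig c)))) as [l covers].
  - intros c. apply box_open.
  - intros x Mx. destruct (local x Mx) as (r & r_pos & Qxr).
    exists (exist _ (x, r) (conj r_pos Qxr)). apply near_refl; auto.
  - exists (map (@proj1_sig _ _) l). split.
    + intros c c_in. apply in_map_iff in c_in as ([c' c'_spec] & <- & _). exact c'_spec.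
    + intros y My. destruct (covers y My) as (c & c_in & near_cy).
      exists (proj1_sig c). split; auto. apply in_map; auto.
Qed.

Lemma compact_coord_bounded :
  exists B, 0 <= B /\ forall x, M x -> forall i, (i < d)%nat -> Rabs (x i) <= B.
Proof.
  destruct (compact_boxes (fun x r => r = 1)) as (l & radius & covers).
  { intros x _. exists 1. split; [lra|auto]. }
  destruct (list_common_bound (list_prod l (seq 0 d)) (fun c B => Rabs (fst (fst c) (snd c)) <= B))
    as (B & B_nonneg & centers_le).
  { intros; lra. }
  { intros c _. eexists. split; [apply Rabs_pos|apply Rle_refl]. }
  exists (B + 1). split; [lra|]. intros y My i i_lt.
  destruct (covers y My) as (c & c_in & near_cy). destruct (radius c c_in) as [_ r_eq].
  specialize (near_cy i i_lt). rewrite r_eq in near_cy.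
  specialize (centers_le (c, i) ltac:(apply in_prod; auto; apply in_seq; lia)). simpl in centers_le.
  replace (y i) with (fst c i - (fst c i - y i)) by ring.
  eapply Rle_trans; [apply Rabs_triang|]. rewrite Rabs_Ropp. lra.
Qed.

Lemma cont_near (f : fn) (x : pt) (eps : R) : cont_on d M f -> M x -> 0 < eps ->
  exists r, 0 < r /\ forall y, M y -> near d x y (2 * r) -> Cnorm (Csub (f y) (f x)) < eps.
Proof.
  intros f_cont Mx eps_pos. destruct (f_cont x Mx eps eps_pos) as (del & del_pos & f_near).
  assert (d_ge1 : 1 <= INR d) by (apply (le_INR 1); auto).
  set (r := del / (4 * INR d)). assert (r_pos : 0 < r) by (unfold r; positivity).
  exists r. split; auto. intros y My near_xy. apply f_near; auto.
  eapply Rle_lt_trans; [apply dist_le_of_near; [|apply near_xy]; lra|].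
  replace (INR d * (2 * r)) with (del / 2) by (unfold r; field; lra). lra.
Qed.

Lemma cont_uniform (f : fn) (eps : R) : cont_on d M f -> 0 < eps ->
  exists r, 0 < r /\ forall x y, M x -> M y -> near d x y r -> Cnorm (Csub (f y) (f x)) <= eps.
Proof.
  intros f_cont eps_pos.
  destruct (compact_boxes (fun x r => forall y, M y -> near d x y (2 * r) ->
     Cnorm (Csub (f y) (f x)) < eps / 2)) as (l & osc & covers).
  { intros x Mx. apply cont_near; auto. lra. }
  destruct (list_common_radius l (fun c r => r <= snd c)) as (r & r_pos & r_le).
  { intros c s t t_le s_le. lra. }
  { intros c c_in. exists (snd c). split; [apply osc; auto|lra]. }
  exists r. split; auto. intros x y Mx My near_xy.
  destruct (covers x Mx) as (c & c_in & near_cx). destruct (osc c c_in) as [c_pos c_osc].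
  specialize (r_le c c_in).
  assert (x_osc : Cnorm (Csub (f x) (f (fst c))) < eps / 2)
    by (apply c_osc; auto; apply near_weaken with (snd c); auto; lra).
  assert (y_osc : Cnorm (Csub (f y) (f (fst c))) < eps / 2).
  { apply c_osc; auto. apply near_weaken with (snd c + r); [lra|]. apply near_trans with x; auto. }
  replace (Csub (f y) (f x)) with (Cadd (Csub (f y) (f (fst c))) (Copp (Csub (f x) (f (fst c)))))
    by ring.
  eapply Rle_trans; [apply Cnorm_add|]. rewrite Cnorm_opp. lra.
Qed.

Lemma cont_bounded (f : fn) : cont_on d M f -> exists s, sup_le M f s.
Proof.
  intros f_cont.
  destruct (compact_boxes (fun x r => forall y, M y -> near d x y (2 * r) ->
     Cnorm (Csub (f y) (f x)) < 1)) as (l & osc & covers).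
  { intros x Mx. apply cont_near; auto. lra. }
  destruct (list_common_bound l (fun c B => Cnorm (f (fst c)) <= B)) as (B & B_nonneg & centers_le).
  { intros; lra. }
  { intros c _. eexists. split; [apply Cnorm_nonneg|apply Rle_refl]. }
  exists (B + 1). intros y My. destruct (covers y My) as (c & c_in & near_cy).
  destruct (osc c c_in) as [c_pos c_osc].
  assert (y_osc : Cnorm (Csub (f y) (f (fst c))) < 1)
    by (apply c_osc; auto; apply near_weaken with (snd c); auto; lra).
  specialize (centers_le c c_in).
  replace (f y) with (Cadd (f (fst c)) (Csub (f y) (f (fst c)))) by ring.
  eapply Rle_trans; [apply Cnorm_add|]. lra.
Qed.

End CompactSubsets.

(** * Partitions of unity of bounded multiplicity *)

Definition tent (s : R) : R := Rmax 0 (1 - Rabs s).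

Lemma tent_nonneg (s : R) : 0 <= tent s.
Proof. apply Rmax_l. Qed.

Lemma tent_le_1 (s : R) : tent s <= 1.
Proof. apply Rmax_lub; [lra|]. pose proof (Rabs_pos s). lra. Qed.

Lemma tent_zero (s : R) : 1 <= Rabs s -> tent s = 0.
Proof. intros. apply Rmax_left. lra. Qed.

Lemma tent_lipschitz (s t : R) : Rabs (tent s - tent t) <= Rabs (s - t).
Proof.
  unfold tent, Rmax. repeat destruct Rle_dec; unfold Rabs in *; repeat destruct Rcase_abs; lra.
Qed.

Lemma tent_add_shift (s : R) : 0 <= s <= 1 -> tent s + tent (s - 1) = 1.
Proof.
  intros. unfold tent, Rmax, Rabs. repeat destruct Rle_dec; repeat destruct Rcase_abs; lra.
Qed.

Section Grid.
Variables (B mesh : R) (m : nat).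
Hypothesis mesh_pos : 0 < mesh.
Hypothesis m_large : 2 * B / mesh + 2 < INR m.

Definition grid_coord (k : nat) (u : R) : R := (u + B) / mesh - INR k.
Definition grid_fun (k : nat) (u : R) : R := sqrt (tent (grid_coord k u)).

Lemma grid_fun_nonneg (k : nat) (u : R) : 0 <= grid_fun k u.
Proof. apply sqrt_pos. Qed.

Lemma grid_fun_sq (k : nat) (u : R) : grid_fun k u * grid_fun k u = tent (grid_coord k u).
Proof. apply sqrt_sqrt, tent_nonneg. Qed.

Lemma grid_fun_le_1 (k : nat) (u : R) : grid_fun k u <= 1.
Proof. rewrite <- sqrt_1. apply sqrt_le_1_alt, tent_le_1. Qed.

Lemma Rabs_grid_coord_sub (k : nat) (u v : R) :
  Rabs (grid_coord k u - grid_coord k v) = Rabs (u - v) / mesh.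
Proof.
  replace (grid_coord k u - grid_coord k v) with ((u - v) * / mesh)
    by (unfold grid_coord; field; lra).
  rewrite Rabs_mult, (Rabs_pos_eq (/ mesh)) by positivity. reflexivity.
Qed.

Lemma grid_fun_continuous (k : nat) (u eps : R) : 0 < eps ->
  exists r, 0 < r /\ forall v, Rabs (u - v) < r -> Rabs (grid_fun k v - grid_fun k u) < eps.
Proof.
  intros eps_pos.
  destruct (continuity_pt_sqrt (tent (grid_coord k u)) (tent_nonneg _) eps eps_pos)
    as (del & del_pos & sqrt_near).
  exists (del * mesh). split; [positivity|]. intros v near_uv. unfold grid_fun.
  destruct (Req_dec (tent (grid_coord k u)) (tent (grid_coord k v))) as [<-|ne].
  - rewrite Rminus_diag, Rabs_R0. auto.
  - apply (sqrt_near (tent (grid_coord k v))). split; [split; [exact I|exact ne]|].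
    eapply Rle_lt_trans; [apply tent_lipschitz|]. rewrite Rabs_grid_coord_sub, Rabs_minus_sym.
    apply Rmult_lt_reg_r with mesh; auto. unfold Rdiv. rewrite Rmult_assoc, Rinv_l; lra.
Qed.

Lemma grid_fun_near (k : nat) (u v : R) :
  grid_fun k u <> 0 -> grid_fun k v <> 0 -> Rabs (u - v) < 2 * mesh.
Proof.
  assert (in_cell : forall w, grid_fun k w <> 0 -> Rabs (grid_coord k w) < 1).
  { intros w w_nz. apply Rnot_le_lt. intros far. apply w_nz. unfold grid_fun.
    rewrite tent_zero by auto. apply sqrt_0. }
  intros u_nz v_nz. apply in_cell in u_nz, v_nz.
  assert (close : Rabs (grid_coord k u - grid_coord k v) < 2).
  { eapply Rle_lt_trans; [apply Rabs_triang|]. rewrite Rabs_Ropp. lra. }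
  rewrite Rabs_grid_coord_sub in close. apply Rmult_lt_compat_r with (r := mesh) in close; auto.
  unfold Rdiv in close. rewrite Rmult_assoc, Rinv_l in close; lra.
Qed.

Lemma grid_cell (u : R) : Rabs u <= B -> exists j, (S j < m)%nat /\ 0 <= grid_coord j u <= 1 /\
  forall i, i <> j -> i <> S j -> tent (grid_coord i u) = 0.
Proof.
  intros u_le. apply Rabs_le_between in u_le.
  assert (u_nonneg : 0 <= (u + B) / mesh) by positivity.
  assert (u_max : (u + B) / mesh <= 2 * B / mesh) by (apply Rmult_le_compat_r; [positivity|lra]).
  destruct (archimed ((u + B) / mesh)) as [up_gt up_le].
  assert (up_pos : (0 < up ((u + B) / mesh))%Z) by (apply lt_IZR; simpl; lra).
  set (j := Z.to_nat (up ((u + B) / mesh) - 1)).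
  assert (j_eq : INR j = IZR (up ((u + B) / mesh)) - 1).
  { unfold j. rewrite INR_IZR_INZ, Z2Nat.id, minus_IZR by lia. reflexivity. }
  exists j. split; [apply INR_lt; rewrite S_INR; lra|]. unfold grid_coord. split; [lra|].
  intros i ne_j ne_Sj. apply tent_zero.
  destruct (le_lt_dec i j) as [i_le|i_gt].
  - assert (far : (S i <= j)%nat) by lia. apply le_INR in far. rewrite S_INR in far.
    rewrite Rabs_pos_eq; lra.
  - assert (far : (S (S j) <= i)%nat) by lia. apply le_INR in far. rewrite !S_INR in far.
    rewrite Rabs_left1; lra.
Qed.

Lemma grid_fun_sum_sq (u : R) : Rabs u <= B -> rsum m (fun k => grid_fun k u * grid_fun k u) = 1.
Proof.
  intros u_le. destruct (grid_cell u u_le) as (j & j_lt & j_range & others).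
  rewrite (msum_two_terms m j), !grid_fun_sq; [|auto|intros; rewrite grid_fun_sq; auto].
  replace (grid_coord (S j) u) with (grid_coord j u - 1)
    by (unfold grid_coord; rewrite S_INR; ring).
  apply tent_add_shift; auto.
Qed.

Lemma grid_fun_sum_le (u : R) : Rabs u <= B -> rsum m (fun k => grid_fun k u) <= 2.
Proof.
  intros u_le. destruct (grid_cell u u_le) as (j & j_lt & _ & others).
  rewrite (msum_two_terms m j); auto.
  - pose proof (grid_fun_le_1 j u). pose proof (grid_fun_le_1 (S j) u). lra.
  - intros i ne_j ne_Sj. unfold grid_fun. rewrite others by auto. apply sqrt_0.
Qed.

End Grid.

Record partition : Type := Partition {
  part_size : nat;
  part_fun : nat -> pt -> R;
  part_point : nat -> pt }.

Record is_partition (d : nat) (M : pt -> Prop) (mesh mult : R) (P : partition) : Prop := {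
  part_point_in : forall i, M (part_point P i);
  part_fun_cont : forall i, cont_on d M (fun y => RC (part_fun P i y));
  part_fun_nonneg : forall i y, 0 <= part_fun P i y;
  part_sum_sq : forall y, M y ->
    rsum (part_size P) (fun i => part_fun P i y * part_fun P i y) = 1;
  part_sum_le : forall y, M y -> rsum (part_size P) (fun i => part_fun P i y) <= mult;
  part_near : forall i y, M y -> part_fun P i y <> 0 -> near d (part_point P i) y mesh }.

Arguments part_point_in {d M mesh mult P}.
Arguments part_fun_cont {d M mesh mult P}.
Arguments part_fun_nonneg {d M mesh mult P}.
Arguments part_sum_sq {d M mesh mult P}.
Arguments part_sum_le {d M mesh mult P}.
Arguments part_near {d M mesh mult P}.

Lemma part_fun_nonzero (d : nat) (M : pt -> Prop) (mesh mult : R) (P : partition) (y : pt) :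
  is_partition d M mesh mult P -> M y -> exists i, (i < part_size P)%nat /\ part_fun P i y <> 0.
Proof.
  intros P_part My. apply NNPP. intros none.
  pose proof (part_sum_sq P_part y My) as sum_one. rewrite msum_zero in sum_one; [lra|].
  intros i i_lt. destruct (Req_dec (part_fun P i y) 0) as [-> |nz]; [ring|]. destruct none. eauto.
Qed.

Section PartitionExists.
Variables (d : nat) (M : pt -> Prop).

Lemma cont_grid_fun (B mesh : R) (l j : nat) : 0 < mesh -> (j < d)%nat ->
  cont_on d M (fun y => RC (grid_fun B mesh l (y j))).
Proof.
  intros mesh_pos j_lt x _ eps eps_pos.
  destruct (grid_fun_continuous B mesh mesh_pos l (x j) eps eps_pos) as (r & r_pos & c_near).
  exists r. split; auto. intros y _ near_xy. rewrite <- RC_opp, <- RC_add, Cnorm_RC.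
  apply c_near, (near_of_dist d); auto; lia.
Qed.

Lemma grid_partition (B mesh : R) (j : nat) : 0 < mesh -> (j <= d)%nat ->
  exists (k : nat) (g : nat -> pt -> R),
    (forall i, cont_on d M (fun y => RC (g i y))) /\ (forall i x, 0 <= g i x) /\
    (forall x, (forall i, (i < d)%nat -> Rabs (x i) <= B) ->
       rsum k (fun i => g i x * g i x) = 1 /\ rsum k (fun i => g i x) <= 2 ^ j) /\
    (forall i x y, g i x <> 0 -> g i y <> 0 -> near j x y (2 * mesh)).
Proof.
  intros mesh_pos j_le. destruct (INR_unbounded (2 * B / mesh + 2)) as [m m_large].
  induction j as [|j IH].
  { exists 1%nat, (fun _ _ => 1). split; [|split; [|split]].
    - intros i. apply cont_const.
    - intros; lra.
    - intros x _. simpl. lra.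
    - intros i x y _ _ l l_lt. lia. }
  destruct IH as (k & g & g_cont & g_nonneg & g_sum & g_near); [lia|].
  set (c := grid_fun B mesh).
  exists (k * m)%nat, (fun t x => g (t / m)%nat x * c (t mod m)%nat (x j)).
  split; [|split; [|split]].
  - intros t. replace (fun y => RC (g (t / m)%nat y * c (t mod m)%nat (y j)))
      with (fmul (fun y => RC (g (t / m)%nat y)) (fun y => RC (c (t mod m)%nat (y j))))
      by (apply functional_extensionality; intros; unfold fmul; rewrite RC_mul; auto).
    apply cont_mul; [auto|apply cont_grid_fun; auto].
  - intros t x. apply Rmult_le_pos; [auto|apply grid_fun_nonneg].
  - intros x x_le. destruct (g_sum x x_le) as [g_sum_sq g_sum_le]. specialize (x_le j ltac:(lia)).
    assert (m_pos : (0 < m)%nat)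
      by (destruct (grid_cell B mesh m mesh_pos m_large (x j) x_le); lia).
    split.
    + rewrite (msum_ext _ _ _ _ (fun t => (fun i l => (g i x * g i x) * (c l (x j) * c l (x j)))
         (t / m)%nat (t mod m)%nat)) by (intros; ring).
      rewrite (msum_mul k m (fun i l => (g i x * g i x) * (c l (x j) * c l (x j)))) by auto.
      rewrite <- g_sum_sq. apply msum_ext. intros i _. unfold c.
      rewrite rsum_scal, grid_fun_sum_sq by auto. ring.
    + rewrite (msum_mul k m (fun i l => g i x * c l (x j))) by auto.
      apply Rle_trans with (rsum k (fun i => 2 * g i x)); [|rewrite rsum_scal; simpl; lra].
      apply rsum_le. intros i _. rewrite rsum_scal, Rmult_comm.
      apply Rmult_le_compat_r; [auto|apply grid_fun_sum_le; auto].
  - intros t x y x_nz y_nz l l_lt.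
    assert (factors : forall z, g (t / m)%nat z * c (t mod m)%nat (z j) <> 0 ->
      g (t / m)%nat z <> 0 /\ c (t mod m)%nat (z j) <> 0)
      by (intros z z_nz; split; intros zero; apply z_nz; rewrite zero; ring).
    apply factors in x_nz as [gx_nz cx_nz]. apply factors in y_nz as [gy_nz cy_nz].
    destruct (Nat.eq_dec l j) as [->|ne]; [eapply grid_fun_near; eauto|].
    apply (g_near (t / m)%nat); auto; lia.
Qed.

Hypothesis d_pos : (1 <= d)%nat.
Hypothesis M_compact : compact_set d M.
Hypothesis M_inhabited : exists x, M x.

Lemma partition_exists (mesh : R) : 0 < mesh -> exists P, is_partition d M mesh (2 ^ d) P.
Proof.
  intros mesh_pos. destruct M_inhabited as [x0 Mx0].
  destruct (compact_coord_bounded d d_pos M M_compact) as (B & B_nonneg & M_bounded).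
  destruct (grid_partition B (mesh / 2) d) as (k & g & g_cont & g_nonneg & g_sum & g_near);
    [lra|auto|].
  assert (centers : forall i, exists x, M x /\ ((exists y, M y /\ g i y <> 0) -> g i x <> 0)).
  { intros i. destruct (classic (exists y, M y /\ g i y <> 0)) as [(y & My & y_nz)|none];
      [exists y|exists x0]; tauto. }
  destruct (choice _ centers) as [x x_spec]. exists (Partition k g x). split; simpl; auto.
  - intros i. apply x_spec.
  - intros y My. apply g_sum. auto.
  - intros y My. apply g_sum. auto.
  - intros i y My y_nz. replace mesh with (2 * (mesh / 2)) by field.
    apply (g_near i); auto. apply x_spec. eauto.
Qed.

End PartitionExists.

(** * The decomposition of l^p as an l^p-sum of copies of l^p *)

Section Slices.
Context {E : exponent}.
Notation p := pexp.

Definition slice_index (n t : nat) : option nat := Some (to_nat (n, t)).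
Definition embed_index (n t : nat) : option nat :=
  if (fst (of_nat t) =? n)%nat then Some (snd (of_nat t)) else None.

Definition slice (n : nat) : Bop := reindex (slice_index n).
Definition embed (n : nat) : Bop := reindex (embed_index n).

Lemma slice_index_injective (n : nat) : partial_injective (slice_index n).
Proof.
  intros t t' u code code'. rewrite <- code' in code. unfold slice_index in code.
  apply (f_equal (option_map of_nat)) in code. cbn [option_map] in code.
  rewrite !cancel_of_to in code. congruence.
Qed.

Lemma embed_index_injective (n : nat) : partial_injective (embed_index n).
Proof.
  intros t t' s. unfold embed_index.
  destruct (Nat.eqb_spec (fst (of_nat t)) n); [intros [= <-]|discriminate].
  destruct (Nat.eqb_spec (fst (of_nat t')) n); [intros [= snd_eq]|discriminate].
  rewrite <- (cancel_to_of t), <- (cancel_to_of t'), (surjective_pairing (of_nat t)),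
    (surjective_pairing (of_nat t')). congruence.
Qed.

Lemma slice_app (n : nat) (x : ellp) (t : nat) : slice n x t = x (to_nat (n, t)).
Proof. exact (reindex_app _ (slice_index_injective n) x t). Qed.

Lemma embed_app (n : nat) (x : ellp) (t : nat) :
  embed n x t = if (fst (of_nat t) =? n)%nat then x (snd (of_nat t)) else C0.
Proof.
  unfold embed. rewrite reindex_app by apply embed_index_injective. unfold embed_index.
  destruct (_ =? n)%nat; reflexivity.
Qed.

Lemma opnorm_le_slice (n : nat) : opnorm_le (slice n) 1.
Proof. apply opnorm_le_reindex, slice_index_injective. Qed.

Lemma opnorm_le_embed (n : nat) : opnorm_le (embed n) 1.
Proof. apply opnorm_le_reindex, embed_index_injective. Qed.

Lemma slice_embed (m n : nat) : slice m [*] embed n = if (m =? n)%nat then bid else bzero.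
Proof.
  bop_coords. rewrite slice_app, embed_app, cancel_of_to. cbn [fst snd].
  destruct (m =? n)%nat; reflexivity.
Qed.

Lemma slice_embed_same (n : nat) : slice n [*] embed n = bid.
Proof. rewrite slice_embed, Nat.eqb_refl. reflexivity. Qed.

Lemma coord_slice (x : ellp) (t : nat) : x t = slice (fst (of_nat t)) x (snd (of_nat t)).
Proof. rewrite slice_app, <- surjective_pairing, cancel_to_of. reflexivity. Qed.

Lemma slice_ext (x y : ellp) : (forall n, slice n x = slice n y) -> x = y.
Proof.
  intros slices_eq. apply ellp_ext. intros t. rewrite (coord_slice x), (coord_slice y), slices_eq.
  reflexivity.
Qed.

Lemma Bop_slice_ext (A B : Bop) : (forall n, slice n [*] A = slice n [*] B) -> A = B.
Proof.
  intros slices_eq. apply Bop_ext. intros x. apply slice_ext. intros n.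
  change ((slice n [*] A) x = (slice n [*] B) x). rewrite slices_eq. reflexivity.
Qed.

Lemma sum_coord_slice_pow_le (x : ellp) (N M : nat) :
  rsum N (fun n => rsum M (fun s => rpow (Cnorm (slice n x s)) p)) <= rpow (norm x) p.
Proof.
  apply (rsum_pairs_le (fun n s => rpow (Cnorm (slice n x s)) p)); [positivity|].
  intros K. eapply Rle_trans; [right|apply (sum_coord_pow_le x K)].
  apply msum_ext. intros t _. rewrite <- coord_slice. reflexivity.
Qed.

Lemma sum_norm_slice_le (x : ellp) (N : nat) :
  rsum N (fun n => rpow (norm (slice n x)) p) <= rpow (norm x) p.
Proof. apply sum_norm_pow_le. apply sum_coord_slice_pow_le. Qed.

Lemma sum_glued_pow_le (z : nat -> ellp) (S : R) :
  (forall N, rsum N (fun n => rpow (norm (z n)) p) <= S) ->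
  forall N, rsum N (fun t => rpow (Cnorm (z (fst (of_nat t)) (snd (of_nat t)))) p) <= S.
Proof.
  intros norms_le. apply (rsum_of_nat_le (fun n s => rpow (Cnorm (z n s)) p)); [positivity|].
  intros N M. eapply Rle_trans; [|apply (norms_le N)]. apply rsum_le. intros n _.
  apply sum_coord_pow_le.
Qed.

Lemma norm_pow_le_of_slices (x : ellp) (S : R) :
  (forall N, rsum N (fun n => rpow (norm (slice n x)) p) <= S) -> rpow (norm x) p <= S.
Proof.
  intros slices_le. apply norm_pow_le_of_sums. intros N.
  rewrite (msum_ext _ _ N _ (fun t => rpow (Cnorm (slice (fst (of_nat t)) x (snd (of_nat t)))) p))
    by (intros; rewrite <- coord_slice; auto).
  apply (sum_glued_pow_le (fun n => slice n x)). auto.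
Qed.

Definition column (V : nat -> Bop) : Bop :=
  Bop_of (fun x t => V (fst (of_nat t)) x (snd (of_nat t))).

Definition column_bound (V : nat -> Bop) (B : R) : Prop :=
  0 <= B /\ forall x N, rsum N (fun n => rpow (norm (V n x)) p) <= rpow (B * norm x) p.

Lemma column_bounded_linear (V : nat -> Bop) (B : R) : column_bound V B ->
  bounded_linear (fun x t => V (fst (of_nat t)) x (snd (of_nat t))) B.
Proof.
  intros [B_nonneg V_le]. split; [|split; [|split; [auto|]]].
  - intros x y t. rewrite bapp_add. reflexivity.
  - intros c x t. rewrite bapp_scale. reflexivity.
  - intros x. apply lp_norm_le_iff. split; [positivity|].
    apply (sum_glued_pow_le (fun n => V n x)). apply V_le.
Qed.

Lemma slice_column (V : nat -> Bop) (B : R) (n : nat) : column_bound V B ->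
  slice n [*] column V = V n.
Proof.
  intros V_bound. bop_coords. rewrite slice_app. unfold column.
  rewrite (Bop_of_app _ B (column_bounded_linear V B V_bound)), cancel_of_to. reflexivity.
Qed.

Lemma opnorm_le_column (V : nat -> Bop) (B : R) : column_bound V B -> opnorm_le (column V) B.
Proof. intros. apply opnorm_le_Bop_of, column_bounded_linear; auto. Qed.

Lemma column_bound_comp (V X : nat -> Bop) (B : R) :
  0 <= B -> (forall n x, norm (V n (X n x)) <= B * norm (X n x)) -> column_bound X 1 ->
  column_bound (fun n => V n [*] X n) B.
Proof.
  intros B_nonneg V_le [_ X_le]. split; auto. intros x N. specialize (X_le x N).
  rewrite Rmult_1_l in X_le. rewrite rpow_mult_distr by positivity.
  eapply Rle_trans; [|apply Rmult_le_compat_l; [apply rpow_nonneg|apply X_le]].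
  rewrite <- rsum_scal. apply rsum_le. intros n _. rewrite <- rpow_mult_distr by positivity.
  apply rpow_le; [positivity|]. split; [positivity|]. apply V_le.
Qed.

Lemma column_bound_slice : column_bound slice 1.
Proof. split; [lra|]. intros x N. rewrite Rmult_1_l. apply sum_norm_slice_le. Qed.

Definition block_diag (A : nat -> Bop) : Bop := column (fun n => A n [*] slice n).

Section BlockDiag.
Variables (A : nat -> Bop) (B : R).
Hypothesis A_le : forall n, opnorm_le (A n) B.

Lemma column_bound_block_diag : column_bound (fun n => A n [*] slice n) B.
Proof.
  apply column_bound_comp; [apply (opnorm_le_nonneg (A 0%nat)), A_le| |apply column_bound_slice].
  intros n x. apply A_le.
Qed.

Lemma opnorm_le_block_diag : opnorm_le (block_diag A) B.
Proof. apply opnorm_le_column, column_bound_block_diag. Qed.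

Lemma slice_block_diag (n : nat) : slice n [*] block_diag A = A n [*] slice n.
Proof. exact (slice_column _ B n column_bound_block_diag). Qed.

Lemma block_diag_embed (n : nat) : block_diag A [*] embed n = embed n [*] A n.
Proof.
  apply Bop_slice_ext. intros m.
  rewrite <- !bcomp_assoc, slice_block_diag, bcomp_assoc, !slice_embed.
  destruct (Nat.eqb_spec m n) as [->|];
    [rewrite bcomp_id_r, bcomp_id_l|rewrite bcomp_zero_r, bcomp_zero_l]; reflexivity.
Qed.

End BlockDiag.

Definition first_slices (N : nat) : Bop := bsum N (fun n => embed n [*] slice n).

Lemma slice_bsum_embed (m N : nat) (F : nat -> Bop) :
  slice m [*] bsum N (fun n => embed n [*] F n) = if (m <? N)%nat then F m else bzero.
Proof.
  assert (other : forall n, n <> m -> slice m [*] (embed n [*] F n) = bzero).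
  { intros n ne. rewrite <- bcomp_assoc, slice_embed.
    destruct (Nat.eqb_spec m n); [congruence|apply bcomp_zero_l]. }
  rewrite bcomp_bsum_r. destruct (Nat.ltb_spec m N).
  - rewrite (msum_single N m) by auto.
    rewrite <- bcomp_assoc, slice_embed_same, bcomp_id_l. reflexivity.
  - apply msum_zero. intros n n_lt. apply other. lia.
Qed.

Lemma norm_sub_first_slices_le (x : ellp) (N : nat) :
  norm (lsub x (first_slices N x)) <= norm (tail N x).
Proof.
  apply norm_le_pointwise. intros t. push_coord. rewrite (coord_slice (first_slices N x)).
  replace (slice (fst (of_nat t)) (first_slices N x))
    with ((if (fst (of_nat t) <? N)%nat then slice (fst (of_nat t)) else bzero) x)
    by (rewrite <- (slice_bsum_embed _ N slice); reflexivity).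
  rewrite tail_app. pose proof (fst_of_nat_le t). destruct (Nat.ltb_spec (fst (of_nat t)) N).
  - rewrite <- coord_slice. replace (Cadd (x t) (Cmul (Copp C1) (x t))) with C0 by ring.
    rewrite Cnorm_C0. positivity.
  - destruct (Nat.ltb_spec t N); [lia|]. cbn [bapp bzero]. rewrite coord_zero.
    right. f_equal. ring.
Qed.

Lemma first_slices_comp_sub (N k : nat) :
  first_slices (N + k) [-] first_slices N [*] first_slices (N + k)
  = bsum k (fun i => embed (N + i) [*] slice (N + i)).
Proof.
  replace (first_slices N [*] first_slices (N + k)) with (first_slices N).
  - unfold first_slices. rewrite msum_split. bop_ring.
  - unfold first_slices at 2. rewrite bcomp_bsum_l. apply msum_ext. intros i i_lt.
    rewrite bcomp_assoc. unfold first_slices. rewrite slice_bsum_embed.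
    destruct (Nat.ltb_spec i (N + k)); [reflexivity|lia].
Qed.

Lemma norm_le_of_first_slices (A : Bop) (x : ellp) (b : R) (N0 : nat) :
  (forall k, norm (A (first_slices (N0 + k) x)) <= b) -> norm (A x) <= b.
Proof.
  intros partial_le. apply le_epsilon. intros eps eps_pos.
  destruct (opnorm_le_exists A) as (r & r_nonneg & A_le).
  destruct (norm_tail_small x (eps / (r + 1))) as [m0 tail_small]; [positivity|].
  specialize (partial_le m0). specialize (tail_small (N0 + m0)%nat ltac:(lia)).
  pose proof (norm_sub_first_slices_le x (N0 + m0)).
  pose proof (norm_le_add_norm_sub (A x) (A (first_slices (N0 + m0) x))) as triangle.
  rewrite <- bapp_sub in triangle.
  assert (norm (A (lsub x (first_slices (N0 + m0) x))) <= eps); [|lra].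
  eapply Rle_trans; [apply A_le|].
  apply Rle_trans with ((r + 1) * (eps / (r + 1))); [|right; field; lra].
  apply Rmult_le_compat; positivity.
Qed.

Lemma pow_half_small (c eps : R) : 0 < eps -> eventually (fun N => c * (/ 2) ^ N <= eps).
Proof.
  intros eps_pos. pose proof (Rabs_pos c).
  destruct (pow_lt_1_zero (/ 2)) with (y := eps / (Rabs c + 1)) as [N pow_small];
    [rewrite Rabs_pos_eq; lra|positivity|].
  exists N. intros m m_ge. specialize (pow_small m m_ge).
  assert (pow_pos : 0 < (/ 2) ^ m) by positivity. rewrite Rabs_pos_eq in pow_small by lra.
  pose proof (Rle_abs c).
  apply Rle_trans with ((Rabs c + 1) * (eps / (Rabs c + 1))); [|right; field; lra].
  apply Rle_trans with ((Rabs c + 1) * (/ 2) ^ m); nra.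
Qed.

Lemma opnorm_le_geometric_bsum (k N : nat) (c : R) (F : nat -> Bop) : 0 <= c ->
  (forall i, opnorm_le (F i) (c * (/ 2) ^ (N + i))) -> opnorm_le (bsum k F) (2 * c * (/ 2) ^ N).
Proof.
  intros c_nonneg F_le. apply opnorm_le_mono with (rsum k (fun i => c * (/ 2) ^ (N + i))).
  - rewrite rsum_scal.
    eapply Rle_trans; [apply Rmult_le_compat_l; [auto|apply geometric_tail]|]. lra.
  - apply opnorm_le_bsum. auto.
Qed.

Lemma compact_of_columns (D : Bop) (c : R) : 0 <= c -> (forall n, is_compact (D [*] embed n)) ->
  eventually (fun n => opnorm_le (D [*] embed n) (c * (/ 2) ^ n)) -> is_compact D.
Proof.
  intros c_nonneg cols_cpt [n0 cols_le]. apply compact_limit. intros eps eps_pos.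
  destruct (pow_half_small (2 * c) eps eps_pos) as [n1 small]. set (N := (n0 + n1)%nat).
  exists (D [*] first_slices N). split.
  { unfold first_slices. rewrite bcomp_bsum_r. apply compact_bsum. intros i _.
    rewrite <- bcomp_assoc. apply compact_comp_r; auto. }
  split; [lra|]. intros x. apply norm_le_of_first_slices with N. intros k.
  replace ((D [-] D [*] first_slices N) (first_slices (N + k) x))
    with (bsum k (fun i => D [*] embed (N + i) [*] slice (N + i)) x).
  - assert (sum_le : opnorm_le (bsum k (fun i => D [*] embed (N + i) [*] slice (N + i)))
      (2 * c * (/ 2) ^ N)).
    { apply opnorm_le_geometric_bsum; auto. intros i.
      apply opnorm_le_contraction_r; [apply cols_le; unfold N; lia|apply opnorm_le_slice]. }
    eapply Rle_trans; [apply sum_le|].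
    apply Rmult_le_compat_r; [positivity|apply small; unfold N; lia].
  - change ((D [-] D [*] first_slices N) (first_slices (N + k) x))
      with (((D [-] D [*] first_slices N) [*] first_slices (N + k)) x).
    f_equal.
    transitivity (D [*] (first_slices (N + k) [-] first_slices N [*] first_slices (N + k)));
      [|bop_ring].
    rewrite first_slices_comp_sub, bcomp_bsum_r. apply msum_ext. intros. apply bcomp_assoc.
Qed.

Lemma compact_of_rows (D : Bop) (c : R) : 0 <= c -> (forall n, is_compact (slice n [*] D)) ->
  eventually (fun n => opnorm_le (slice n [*] D) (c * (/ 2) ^ n)) -> is_compact D.
Proof.
  intros c_nonneg rows_cpt [n0 rows_le]. apply compact_limit. intros eps eps_pos.
  destruct (pow_half_small (2 * c) eps eps_pos) as [n1 small]. set (N := (n0 + n1)%nat).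
  exists (first_slices N [*] D). split.
  { unfold first_slices. rewrite bcomp_bsum_l. apply compact_bsum. intros i _.
    rewrite bcomp_assoc. apply compact_comp_l; auto. }
  split; [lra|]. intros x.
  replace ((D [-] first_slices N [*] D) x) with ((bid [-] first_slices N) (D x)) by reflexivity.
  apply norm_le_of_first_slices with N. intros k.
  replace ((bid [-] first_slices N) (first_slices (N + k) (D x)))
    with (bsum k (fun i => embed (N + i) [*] (slice (N + i) [*] D)) x).
  - assert (sum_le : opnorm_le (bsum k (fun i => embed (N + i) [*] (slice (N + i) [*] D)))
      (2 * c * (/ 2) ^ N)).
    { apply opnorm_le_geometric_bsum; auto. intros i.
      apply opnorm_le_contraction_l; [apply opnorm_le_embed|apply rows_le; unfold N; lia]. }
    eapply Rle_trans; [apply sum_le|].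
    apply Rmult_le_compat_r; [positivity|apply small; unfold N; lia].
  - change ((bid [-] first_slices N) (first_slices (N + k) (D x)))
      with (((bid [-] first_slices N) [*] first_slices (N + k) [*] D) x).
    f_equal.
    transitivity ((first_slices (N + k) [-] first_slices N [*] first_slices (N + k)) [*] D);
      [|bop_ring].
    rewrite first_slices_comp_sub, bcomp_bsum_l. apply msum_ext. intros. symmetry.
    apply bcomp_assoc.
Qed.

End Slices.

(** * Row operators of locally finite width *)

Lemma window_sum_pow_le (N n0 width : nat) (a : nat -> R) (q : R) : 1 <= q -> (0 < width)%nat ->
  (n0 + width <= N)%nat -> (forall n, 0 <= a n) ->
  (forall n, a n <> 0 -> (n0 <= n < n0 + width)%nat) ->
  rpow (rsum N a) q <= rpow (INR width) q * rsum N (fun n => rpow (a n) q).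
Proof.
  intros q_ge1 width_pos N_ge a_nonneg a_support.
  assert (a_zero : forall n, ~ (n0 <= n < n0 + width)%nat -> a n = 0)
    by (intros n out; apply NNPP; intros nz; auto).
  assert (restrict : forall F : nat -> R, (forall n, ~ (n0 <= n < n0 + width)%nat -> F n = 0) ->
    rsum N F = rsum width (fun i => F (n0 + i)%nat)).
  { intros F F_zero. replace N with (n0 + (width + (N - (n0 + width))))%nat by lia.
    rewrite !msum_split, (msum_zero n0), (msum_zero (N - _)), Rplus_0_l, Rplus_0_r; auto;
      intros; apply F_zero; lia. }
  rewrite (restrict a a_zero), (restrict (fun n => rpow (a n) q))
    by (intros; rewrite a_zero by auto; apply rpow_0).
  assert (width_ge1 : 1 <= INR width) by (apply (le_INR 1); lia).
  pose proof (rpow_mean width (fun i => a (n0 + i)%nat) q q_ge1 width_pos (fun i => a_nonneg _))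
    as mean.
  set (S := rsum width (fun i => a (n0 + i)%nat)) in *.
  set (Sq := rsum width (fun i => rpow (a (n0 + i)%nat) q)) in *.
  assert (S_nonneg : 0 <= S) by (apply rsum_nonneg; auto).
  assert (Sq_nonneg : 0 <= Sq) by (apply rsum_nonneg; positivity).
  replace S with (INR width * (S / INR width)) by (field; lra).
  rewrite rpow_mult_distr by positivity. apply Rmult_le_compat_l; [positivity|].
  eapply Rle_trans; [apply mean|]. apply Rmult_le_reg_r with (INR width); [lra|].
  unfold Rdiv. rewrite Rmult_assoc, Rinv_l by lra. apply Rmult_le_compat_l; lra.
Qed.

Section Rows.
Context {E : exponent}.
Notation p := pexp.
Variables (reach width : nat) (W : nat -> Bop) (B : R).

(* The sum is finite because [W n] is required not to reach the coordinates [t] with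
   [t + reach <= n]. *)
Definition row : Bop :=
  Bop_of (fun y t => csum (t + reach) (fun n => W n (slice n y) t)).

Definition row_local : Prop :=
  (forall n t x, (t + reach <= n)%nat -> W n x t = C0) /\
  (forall t, exists n0, forall n x, W n x t <> C0 -> (n0 <= n < n0 + width)%nat).

Hypothesis width_pos : (0 < width)%nat.
Hypothesis W_local : row_local.
Hypothesis W_le : forall n, opnorm_le (W n) B.

Lemma row_coord_pow_le (y : ellp) (t : nat) :
  rpow (Cnorm (csum (t + reach) (fun n => W n (slice n y) t))) p
  <= rpow (INR width) p * rsum (t + reach) (fun n => rpow (Cnorm (W n (slice n y) t)) p).
Proof.
  destruct W_local as [far window]. destruct (window t) as [n0 n0_window].
  set (a n := Cnorm (W n (slice n y) t)). set (N := (t + reach + (n0 + width))%nat).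
  assert (a_far : forall n, a (t + reach + n)%nat = 0)
    by (intros; unfold a; rewrite far by lia; apply Cnorm_C0).
  apply Rle_trans with (rpow (rsum N a) p).
  - apply rpow_le; [positivity|]. split; [positivity|]. eapply Rle_trans; [apply Cnorm_csum|].
    apply (rsum_mono _ _ a); [unfold N; lia|unfold a; positivity].
  - eapply Rle_trans; [apply (window_sum_pow_le N n0 width)|].
    + apply pexp_ge1.
    + auto.
    + unfold N. lia.
    + unfold a. positivity.
    + intros n a_nz. apply (n0_window n (slice n y)). intros zero. apply a_nz. unfold a.
      rewrite zero. apply Cnorm_C0.
    + apply Rmult_le_compat_l; [positivity|]. unfold N. rewrite msum_split.
      rewrite (msum_zero (n0 + width)) by (intros; rewrite a_far; apply rpow_0).
      rewrite Rplus_0_r. apply Rle_refl.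
Qed.

Lemma row_bounded_linear :
  bounded_linear (fun y t => csum (t + reach) (fun n => W n (slice n y) t)) (INR width * B).
Proof.
  pose proof (opnorm_le_nonneg _ _ (W_le 0%nat)) as B_nonneg. pose proof (pos_INR width).
  split; [|split; [|split; [positivity|]]].
  - intros x y t. rewrite <- (msum_add (add := Cadd)). apply msum_ext. intros.
    push_bapp. reflexivity.
  - intros c x t. rewrite <- csum_scal. apply msum_ext. intros. push_bapp. reflexivity.
  - intros y. apply lp_norm_le_iff. split; [positivity|]. intros T.
    apply Rle_trans with (rsum T (fun t => rpow (INR width) p *
      rsum (T + reach) (fun n => rpow (Cnorm (W n (slice n y) t)) p))).
    + apply rsum_le. intros t t_lt. eapply Rle_trans; [apply row_coord_pow_le|].
      apply Rmult_le_compat_l; [positivity|]. apply rsum_mono; [lia|positivity].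
    + rewrite rsum_scal, msum_swap, Rmult_assoc, rpow_mult_distr by positivity.
      apply Rmult_le_compat_l; [positivity|].
      apply Rle_trans with (rsum (T + reach) (fun n => rpow (norm ((W n [*] slice n) y)) p)).
      * apply rsum_le. intros n _. apply sum_coord_pow_le.
      * apply (column_bound_block_diag W B W_le).
Qed.

Lemma row_app (y : ellp) (t : nat) : row y t = csum (t + reach) (fun n => W n (slice n y) t).
Proof. exact (Bop_of_app _ _ row_bounded_linear y t). Qed.

Lemma row_embed (n : nat) : row [*] embed n = W n.
Proof.
  bop_coords. rewrite row_app.
  assert (slice_eq : forall m, slice m (embed n x) = if (m =? n)%nat then x else lzero).
  { intros m. change ((slice m [*] embed n) x = if (m =? n)%nat then x else lzero).
    rewrite slice_embed. destruct (m =? n)%nat; reflexivity. }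
  assert (other : forall m, m <> n -> W m (slice m (embed n x)) t = C0).
  { intros m ne. rewrite slice_eq. destruct (Nat.eqb_spec m n); [lia|].
    rewrite bapp_zero. reflexivity. }
  destruct (le_lt_dec (t + reach) n) as [out|inside].
  - rewrite (proj1 W_local) by auto. apply msum_zero. intros m m_lt. apply other. lia.
  - rewrite (msum_single _ n) by auto. rewrite slice_eq, Nat.eqb_refl. reflexivity.
Qed.

End Rows.

(** * Even and odd coordinates, and two-by-two operator matrices *)

Definition even_index (t : nat) : option nat := Some (2 * t)%nat.
Definition odd_index (t : nat) : option nat := Some (2 * t + 1)%nat.
Definition even_preindex (t : nat) : option nat := if Nat.even t then Some (Nat.div2 t) else None.
Definition odd_preindex (t : nat) : option nat := if Nat.even t then None else Some (Nat.div2 t).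

Lemma even_index_injective : partial_injective even_index.
Proof. intros t t' u [= <-] [= eq]. lia. Qed.

Lemma odd_index_injective : partial_injective odd_index.
Proof. intros t t' u [= <-] [= eq]. lia. Qed.

Lemma div2_of_even (t : nat) : Nat.even t = true -> (2 * Nat.div2 t = t)%nat.
Proof.
  intros t_even. pose proof (Nat.div2_odd t) as split_t.
  rewrite <- Nat.negb_even, t_even in split_t. simpl in *. lia.
Qed.

Lemma div2_of_odd (t : nat) : Nat.even t = false -> (2 * Nat.div2 t + 1 = t)%nat.
Proof.
  intros t_odd. pose proof (Nat.div2_odd t) as split_t.
  rewrite <- Nat.negb_even, t_odd in split_t. simpl in *. lia.
Qed.

Lemma even_preindex_injective : partial_injective even_preindex.
Proof.
  intros t t' u. unfold even_preindex.
  destruct (Nat.even t) eqn:t_even; [intros [= <-]|discriminate].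
  destruct (Nat.even t') eqn:t'_even; [intros [= eq]|discriminate].
  rewrite <- (div2_of_even t), <- (div2_of_even t') by auto. congruence.
Qed.

Lemma odd_preindex_injective : partial_injective odd_preindex.
Proof.
  intros t t' u. unfold odd_preindex.
  destruct (Nat.even t) eqn:t_even; [discriminate|intros [= <-]].
  destruct (Nat.even t') eqn:t'_even; [discriminate|intros [= eq]].
  rewrite <- (div2_of_odd t), <- (div2_of_odd t') by auto. congruence.
Qed.

Section EvenOdd.
Context {E : exponent}.

Definition even_part : Bop := reindex even_index.
Definition odd_part : Bop := reindex odd_index.
Definition even_incl : Bop := reindex even_preindex.
Definition odd_incl : Bop := reindex odd_preindex.

Lemma even_part_app (x : ellp) (t : nat) : even_part x t = x (2 * t)%nat.
Proof. exact (reindex_app _ even_index_injective x t). Qed.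

Lemma odd_part_app (x : ellp) (t : nat) : odd_part x t = x (2 * t + 1)%nat.
Proof. exact (reindex_app _ odd_index_injective x t). Qed.

Lemma even_incl_app (x : ellp) (t : nat) :
  even_incl x t = if Nat.even t then x (Nat.div2 t) else C0.
Proof.
  unfold even_incl. rewrite reindex_app by apply even_preindex_injective. unfold even_preindex.
  destruct (Nat.even t); reflexivity.
Qed.

Lemma odd_incl_app (x : ellp) (t : nat) :
  odd_incl x t = if Nat.even t then C0 else x (Nat.div2 t).
Proof.
  unfold odd_incl. rewrite reindex_app by apply odd_preindex_injective. unfold odd_preindex.
  destruct (Nat.even t); reflexivity.
Qed.

Lemma opnorm_le_even_part : opnorm_le even_part 1.
Proof. apply opnorm_le_reindex, even_index_injective. Qed.
Lemma opnorm_le_odd_part : opnorm_le odd_part 1.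
Proof. apply opnorm_le_reindex, odd_index_injective. Qed.
Lemma opnorm_le_even_incl : opnorm_le even_incl 1.
Proof. apply opnorm_le_reindex, even_preindex_injective. Qed.
Lemma opnorm_le_odd_incl : opnorm_le odd_incl 1.
Proof. apply opnorm_le_reindex, odd_preindex_injective. Qed.

Lemma even_double (t : nat) : Nat.even (2 * t) = true.
Proof. rewrite Nat.even_mul. reflexivity. Qed.

Lemma even_double_add_1 (t : nat) : Nat.even (2 * t + 1) = false.
Proof. rewrite Nat.even_add, even_double. reflexivity. Qed.

Lemma even_part_even_incl (x : ellp) : even_part (even_incl x) = x.
Proof.
  apply ellp_ext. intros t. rewrite even_part_app, even_incl_app, even_double, Nat.div2_double.
  reflexivity.
Qed.

Lemma even_part_odd_incl (x : ellp) : even_part (odd_incl x) = lzero.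
Proof.
  apply ellp_ext. intros t. rewrite even_part_app, odd_incl_app, even_double. reflexivity.
Qed.

Lemma odd_part_even_incl (x : ellp) : odd_part (even_incl x) = lzero.
Proof.
  apply ellp_ext. intros t. rewrite odd_part_app, even_incl_app, even_double_add_1. reflexivity.
Qed.

Lemma odd_part_odd_incl (x : ellp) : odd_part (odd_incl x) = x.
Proof.
  apply ellp_ext. intros t. rewrite odd_part_app, odd_incl_app, even_double_add_1, Nat.add_1_r.
  rewrite Nat.div2_succ_double. reflexivity.
Qed.

Lemma even_incl_add_odd_incl : even_incl [*] even_part [+] odd_incl [*] odd_part = bid.
Proof.
  bop_coords. rewrite even_incl_app, odd_incl_app, even_part_app, odd_part_app.
  destruct (Nat.even t) eqn:t_even; [rewrite div2_of_even by auto|rewrite div2_of_odd by auto];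
    ring.
Qed.

Lemma Bop_even_odd_ext (A B : Bop) :
  even_part [*] A = even_part [*] B -> odd_part [*] A = odd_part [*] B -> A = B.
Proof.
  intros even_eq odd_eq.
  rewrite <- (bcomp_id_l A), <- (bcomp_id_l B), <- even_incl_add_odd_incl.
  rewrite !bcomp_add_l, !bcomp_assoc, even_eq, odd_eq.
  reflexivity.
Qed.

Definition mat (a b c d : Bop) : Bop :=
  even_incl [*] (a [*] even_part [+] b [*] odd_part)
  [+] odd_incl [*] (c [*] even_part [+] d [*] odd_part).

Definition dsum (a b : Bop) : Bop := mat a bzero bzero b.

End EvenOdd.

Ltac mat_ring := intros; unfold dsum, mat; apply Bop_ext; intro; unfold_bop;
  repeat first [rewrite bapp_add | rewrite bapp_scale | rewrite bapp_zero
    | rewrite even_part_even_incl | rewrite even_part_odd_incl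
    | rewrite odd_part_even_incl | rewrite odd_part_odd_incl];
  ellp_ring.

Section Matrices.
Context {E : exponent}.

Lemma mat_mul (a b c d a' b' c' d' : Bop) : mat a b c d [*] mat a' b' c' d'
  = mat (a [*] a' [+] b [*] c') (a [*] b' [+] b [*] d')
        (c [*] a' [+] d [*] c') (c [*] b' [+] d [*] d').
Proof. mat_ring. Qed.

Lemma mat_id : mat bid bzero bzero bid = bid.
Proof. rewrite <- even_incl_add_odd_incl at 3. mat_ring. Qed.

#[global] Instance mat_calkin_eq :
  Proper (calkin_eq ==> calkin_eq ==> calkin_eq ==> calkin_eq ==> calkin_eq) mat.
Proof.
  intros a a' aa' b b' bb' c c' cc' d d' dd'. unfold mat. rewrite aa', bb', cc', dd'. reflexivity.
Qed.

#[global] Instance dsum_calkin_eq : Proper (calkin_eq ==> calkin_eq ==> calkin_eq) dsum.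
Proof. intros a a' aa' b b' bb'. unfold dsum. rewrite aa', bb'. reflexivity. Qed.

Lemma dsum_mul (a b a' b' : Bop) : dsum a b [*] dsum a' b' = dsum (a [*] a') (b [*] b').
Proof. mat_ring. Qed.
Lemma dsum_add (a b a' b' : Bop) : dsum (a [+] a') (b [+] b') = dsum a b [+] dsum a' b'.
Proof. mat_ring. Qed.
Lemma dsum_scale (c : CC) (a b : Bop) : dsum (c [.] a) (c [.] b) = c [.] dsum a b.
Proof. mat_ring. Qed.
Lemma dsum_id : dsum bid bid = bid.
Proof. apply mat_id. Qed.
Lemma dsum_corner (a b : Bop) : odd_part [*] dsum a b [*] odd_incl = b.
Proof. mat_ring. Qed.

Lemma compact_dsum (a b : Bop) : is_compact a -> is_compact b -> is_compact (dsum a b).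
Proof.
  rewrite <- !calkin_eq_zero. intros -> ->. apply calkin_eq_of_eq. mat_ring.
Qed.

Lemma opnorm_le_dsum (a b : Bop) (r s : R) :
  opnorm_le a r -> opnorm_le b s -> opnorm_le (dsum a b) (r + s).
Proof.
  intros a_le b_le.
  replace (dsum a b) with (even_incl [*] (a [*] even_part) [+] odd_incl [*] (b [*] odd_part))
    by mat_ring.
  apply opnorm_le_add.
  - apply opnorm_le_contraction_l; [apply opnorm_le_even_incl|].
    apply opnorm_le_contraction_r; [auto|apply opnorm_le_even_part].
  - apply opnorm_le_contraction_l; [apply opnorm_le_odd_incl|].
    apply opnorm_le_contraction_r; [auto|apply opnorm_le_odd_part].
Qed.

Lemma calkin_norm_le_dsum (a b : Bop) (r s : R) :
  calkin_norm_le a r -> calkin_norm_le b s -> calkin_norm_le (dsum a b) (r + s).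
Proof.
  intros a_le b_le eps eps_pos.
  destruct (a_le (eps / 2)) as (K & K_cpt & aK_le); [lra|].
  destruct (b_le (eps / 2)) as (L & L_cpt & bL_le); [lra|].
  exists (dsum K L). split; [apply compact_dsum; auto|].
  rewrite <- dsum_add. replace (r + s + eps) with (r + eps / 2 + (s + eps / 2)) by field.
  apply opnorm_le_dsum; auto.
Qed.

End Matrices.

(** * Rademacher functions as operators *)

Section RademacherOperators.
Context {E : exponent}.
Notation p := pexp.

(* The first [2 ^ k] slices of l^p(N; l^p) form, after normalization, the space
   L^p({-1,1}^k; l^p) for the uniform probability: [rad_tensor k i] is tensoring with the i-th
   Rademacher function and [rad_pair k i] is pairing with it. *)
Definition rad_scale (k : nat) : R := rpow (2 ^ k) (/ p).
Definition rad_tensor (k i : nat) : Bop :=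
  bsum (2 ^ k) (fun e => RC (rad i e / rad_scale k) [.] embed e).
Definition rad_pair (k i : nat) : Bop :=
  bsum (2 ^ k) (fun e => RC (rad_scale k * (rad i e / 2 ^ k)) [.] slice e).

Definition rad_encode (k : nat) (A : nat -> Bop) : Bop := bsum k (fun i => rad_tensor k i [*] A i).
Definition rad_decode (k : nat) (A : nat -> Bop) : Bop := bsum k (fun i => A i [*] rad_pair k i).
Definition rad_mult (k : nat) (b : nat -> CC) : Bop := rad_encode k (fun i => b i [.] rad_pair k i).
Definition sign_sum (k : nat) (A : nat -> Bop) (e : nat) : Bop :=
  bsum k (fun i => RC (rad i e) [.] A i).

Lemma rad_scale_pos (k : nat) : 0 < rad_scale k.
Proof. unfold rad_scale. positivity. Qed.

Lemma rpow_rad_scale (k : nat) : rpow (rad_scale k) p = 2 ^ k.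
Proof. apply rpow_Rinv_rpow; [positivity|]. pose proof (pow2_pos k). lra. Qed.

Lemma slice_rad_tensor (k i e : nat) :
  slice e [*] rad_tensor k i
  = if (e <? 2 ^ k)%nat then RC (rad i e / rad_scale k) [.] bid else bzero.
Proof.
  unfold rad_tensor.
  rewrite (msum_ext _ _ _ _ (fun e => embed e [*] (RC (rad i e / rad_scale k) [.] bid)))
    by (intros; bop_ring).
  exact (slice_bsum_embed e (2 ^ k) (fun e => RC (rad i e / rad_scale k) [.] bid)).
Qed.

Lemma rad_pair_rad_tensor (k i j : nat) : (i < k)%nat -> (j < k)%nat ->
  rad_pair k i [*] rad_tensor k j = if (i =? j)%nat then bid else bzero.
Proof.
  intros i_lt j_lt. pose proof (rad_scale_pos k). pose proof (pow2_pos k). unfold rad_pair.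
  rewrite bcomp_bsum_l, (msum_ext _ _ _ _ (fun e => RC (/ 2 ^ k * (rad i e * rad j e)) [.] bid)).
  - rewrite <- bscale_csum, csum_RC.
    change (rsum (2 ^ k) _) with (sign_mean k (fun e => rad i e * rad j e)).
    rewrite rad_orthonormal by auto.
    destruct (i =? j)%nat; [rewrite RC_1; apply bscale_1|rewrite RC_0; apply bscale_0].
  - intros e e_lt. rewrite bcomp_scale_l, slice_rad_tensor.
    destruct (Nat.ltb_spec e (2 ^ k)); [|lia].
    rewrite bscale_bscale, <- RC_mul. do 2 f_equal. field. lra.
Qed.

Lemma rad_pair_embed_outside (k i : nat) : rad_pair k i [*] embed (2 ^ k) = bzero.
Proof.
  unfold rad_pair. rewrite bcomp_bsum_l. apply msum_zero. intros e e_lt.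
  rewrite bcomp_scale_l, slice_embed. destruct (Nat.eqb_spec e (2 ^ k)); [lia|]. bop_ring.
Qed.

Lemma rad_encode_comp (k : nat) (A : nat -> Bop) (X : Bop) :
  rad_encode k A [*] X = rad_encode k (fun i => A i [*] X).
Proof. unfold rad_encode. rewrite bcomp_bsum_l. apply msum_ext. intros. apply bcomp_assoc. Qed.

Lemma comp_rad_decode (k : nat) (A : nat -> Bop) (X : Bop) :
  X [*] rad_decode k A = rad_decode k (fun i => X [*] A i).
Proof.
  unfold rad_decode. rewrite bcomp_bsum_r. apply msum_ext. intros. symmetry. apply bcomp_assoc.
Qed.

Lemma rad_encode_sub (k : nat) (A B : nat -> Bop) :
  rad_encode k (fun i => A i [-] B i) = rad_encode k A [-] rad_encode k B.
Proof. unfold rad_encode. rewrite <- bsum_sub. apply msum_ext. intros. bop_ring. Qed.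

Lemma rad_decode_sub (k : nat) (A B : nat -> Bop) :
  rad_decode k (fun i => A i [-] B i) = rad_decode k A [-] rad_decode k B.
Proof. unfold rad_decode. rewrite <- bsum_sub. apply msum_ext. intros. bop_ring. Qed.

Lemma rad_pair_rad_encode (k i : nat) (A : nat -> Bop) : (i < k)%nat ->
  rad_pair k i [*] rad_encode k A = A i.
Proof.
  intros i_lt. unfold rad_encode. rewrite bcomp_bsum_r, (msum_single k i); auto.
  - rewrite <- bcomp_assoc, rad_pair_rad_tensor, Nat.eqb_refl, bcomp_id_l by auto. reflexivity.
  - intros j j_lt ne. rewrite <- bcomp_assoc, rad_pair_rad_tensor by auto.
    destruct (Nat.eqb_spec i j); [lia|apply bcomp_zero_l].
Qed.

Lemma rad_decode_rad_encode (k : nat) (A B : nat -> Bop) :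
  rad_decode k A [*] rad_encode k B = bsum k (fun i => A i [*] B i).
Proof.
  unfold rad_decode. rewrite bcomp_bsum_l. apply msum_ext. intros i i_lt.
  rewrite bcomp_assoc, rad_pair_rad_encode by auto. reflexivity.
Qed.

Lemma slice_rad_encode (k e : nat) (A : nat -> Bop) :
  slice e [*] rad_encode k A
  = if (e <? 2 ^ k)%nat then RC (/ rad_scale k) [.] sign_sum k A e else bzero.
Proof.
  unfold rad_encode, sign_sum.
  rewrite bcomp_bsum_r, (msum_ext _ _ k _ (fun i => slice e [*] rad_tensor k i [*] A i))
    by (intros; symmetry; apply bcomp_assoc).
  destruct (e <? 2 ^ k)%nat eqn:e_lt.
  - rewrite bscale_bsum. apply msum_ext. intros i _. rewrite slice_rad_tensor, e_lt.
    unfold Rdiv. rewrite RC_mul. bop_ring.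
  - apply msum_zero. intros i _. rewrite slice_rad_tensor, e_lt. apply bcomp_zero_l.
Qed.

Lemma slice_rad_encode_outside (k : nat) (A : nat -> Bop) :
  slice (2 ^ k) [*] rad_encode k A = bzero.
Proof. rewrite slice_rad_encode, Nat.ltb_irrefl. reflexivity. Qed.

Lemma rad_decode_embed_outside (k : nat) (A : nat -> Bop) :
  rad_decode k A [*] embed (2 ^ k) = bzero.
Proof.
  unfold rad_decode. rewrite bcomp_bsum_l. apply msum_zero. intros i _.
  rewrite bcomp_assoc, rad_pair_embed_outside. apply bcomp_zero_r.
Qed.

Lemma rad_mult_eq_decode (k : nat) (b : nat -> CC) :
  rad_mult k b = rad_decode k (fun i => b i [.] rad_tensor k i).
Proof. apply msum_ext. intros. bop_ring. Qed.

Lemma rad_mult_rad_encode (k : nat) (b : nat -> CC) (A : nat -> Bop) :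
  rad_mult k b [*] rad_encode k A = rad_encode k (fun i => b i [.] A i).
Proof.
  rewrite rad_mult_eq_decode, rad_decode_rad_encode. apply msum_ext. intros. bop_ring.
Qed.

Lemma rad_decode_rad_mult (k : nat) (b : nat -> CC) (A : nat -> Bop) :
  rad_decode k A [*] rad_mult k b = rad_decode k (fun i => b i [.] A i).
Proof.
  unfold rad_mult. rewrite rad_decode_rad_encode. apply msum_ext. intros. bop_ring.
Qed.

Lemma rad_mult_embed_outside (k : nat) (b : nat -> CC) : rad_mult k b [*] embed (2 ^ k) = bzero.
Proof. rewrite rad_mult_eq_decode. apply rad_decode_embed_outside. Qed.

Lemma slice_rad_mult_outside (k : nat) (b : nat -> CC) : slice (2 ^ k) [*] rad_mult k b = bzero.
Proof. apply slice_rad_encode_outside. Qed.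

Lemma rad_mult_mul (k : nat) (b c : nat -> CC) :
  rad_mult k b [*] rad_mult k c = rad_mult k (fun i => Cmul (b i) (c i)).
Proof.
  unfold rad_mult at 2. rewrite rad_mult_rad_encode. apply msum_ext. intros. bop_ring.
Qed.

Lemma rad_mult_add (k : nat) (b c : nat -> CC) :
  rad_mult k (fun i => Cadd (b i) (c i)) = rad_mult k b [+] rad_mult k c.
Proof.
  unfold rad_mult, rad_encode. rewrite <- (msum_add (add := badd)). apply msum_ext. intros.
  bop_ring.
Qed.

Lemma rad_mult_scale (k : nat) (c : CC) (b : nat -> CC) :
  rad_mult k (fun i => Cmul c (b i)) = c [.] rad_mult k b.
Proof. unfold rad_mult, rad_encode. rewrite bscale_bsum. apply msum_ext. intros. bop_ring. Qed.

Lemma rad_mult_zero (k : nat) : rad_mult k (fun _ => C0) = bzero.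
Proof. apply msum_zero. intros. bop_ring. Qed.

Lemma norm_pow_le_of_initial_slices (x : ellp) (K : nat) (S : R) :
  (forall n, (K <= n)%nat -> slice n x = lzero) ->
  rsum K (fun n => rpow (norm (slice n x)) p) <= S -> rpow (norm x) p <= S.
Proof.
  intros slices_zero sum_le. apply norm_pow_le_of_slices. intros N.
  apply Rle_trans with (rsum (K + N) (fun n => rpow (norm (slice n x)) p));
    [apply rsum_mono; [lia|positivity]|].
  rewrite msum_split, (msum_zero N); [lra|].
  intros n _. rewrite slices_zero, norm_zero by lia. apply rpow_0.
Qed.

Lemma slice_rad_encode_app (k e : nat) (A : nat -> Bop) (x : ellp) : (e < 2 ^ k)%nat ->
  slice e (rad_encode k A x) = lscale (RC (/ rad_scale k)) (sign_sum k A e x).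
Proof.
  intros e_lt. change (slice e (rad_encode k A x)) with ((slice e [*] rad_encode k A) x).
  rewrite slice_rad_encode. destruct (Nat.ltb_spec e (2 ^ k)); [reflexivity|lia].
Qed.

Lemma slice_rad_encode_zero (k e : nat) (A : nat -> Bop) (x : ellp) : (2 ^ k <= e)%nat ->
  slice e (rad_encode k A x) = lzero.
Proof.
  intros e_ge. change (slice e (rad_encode k A x)) with ((slice e [*] rad_encode k A) x).
  rewrite slice_rad_encode. destruct (Nat.ltb_spec e (2 ^ k)); [lia|reflexivity].
Qed.

Lemma coord_rad_pair (k i : nat) (y : ellp) (s : nat) :
  rad_pair k i y s = Cmul (RC (rad_scale k)) (rad_coeff k (fun e => slice e y s) i).
Proof.
  unfold rad_pair, rad_coeff. rewrite coord_bsum, <- csum_scal. apply msum_ext. intros e _.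
  unfold_bop. push_coord. rewrite RC_mul. ring.
Qed.

Lemma coord_slice_rad_mult (k : nat) (b : nat -> CC) (y : ellp) (e s : nat) : (e < 2 ^ k)%nat ->
  slice e (rad_mult k b y) s
  = rad_sum k (fun i => Cmul (b i) (rad_coeff k (fun e' => slice e' y s) i)) e.
Proof.
  intros e_lt. pose proof (rad_scale_pos k). unfold rad_mult. rewrite slice_rad_encode_app by auto.
  unfold sign_sum, rad_sum. rewrite coord_scale, coord_bsum, <- csum_scal.
  apply msum_ext. intros i _. unfold_bop. push_coord. rewrite coord_rad_pair.
  assert (inv : Cmul (RC (/ rad_scale k)) (RC (rad_scale k)) = C1)
    by (rewrite <- RC_mul, Rinv_l by lra; apply RC_1).
  transitivity (Cmul (Cmul (RC (/ rad_scale k)) (RC (rad_scale k)))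
    (Cmul (RC (rad i e)) (Cmul (b i) (rad_coeff k (fun e' => slice e' y s) i)))); [ring|].
  rewrite inv. ring.
Qed.

Lemma sign_mean_le_iff (k : nat) (F G : nat -> R) (c : R) :
  sign_mean k F <= c * sign_mean k G <-> rsum (2 ^ k) F <= c * rsum (2 ^ k) G.
Proof.
  unfold sign_mean. rewrite !rsum_scal. pose proof (pow2_pos k). split; intros le.
  - apply Rmult_le_reg_l with (/ 2 ^ k); [positivity|]. lra.
  - replace (c * (/ 2 ^ k * rsum (2 ^ k) G)) with (/ 2 ^ k * (c * rsum (2 ^ k) G)) by ring.
    apply Rmult_le_compat_l; [positivity|auto].
Qed.

Lemma rad_mult_bounded : exists K, 0 <= K /\ forall k b beta, 0 <= beta ->
  (forall i, (i < k)%nat -> Cnorm (b i) <= beta) -> opnorm_le (rad_mult k b) (K * beta).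
Proof.
  destruct (rademacher_multiplier_bounded p pexp_gt1) as (K & K_nonneg & multiplier_le).
  exists K. split; auto. intros k b beta beta_nonneg b_le.
  split; [positivity|]. intros y. apply rpow_le_reg with p; [positivity..|].
  rewrite rpow_mult_distr by positivity.
  apply norm_pow_le_of_initial_slices with (2 ^ k)%nat;
    [intros; apply slice_rad_encode_zero; auto|].
  apply sum_norm_pow_le. intros N. rewrite msum_swap.
  apply Rle_trans with (rsum N (fun s => rpow (K * beta) p *
    rsum (2 ^ k) (fun e => rpow (Cnorm (slice e y s)) p))).
  - apply rsum_le. intros s _.
    rewrite (msum_ext _ _ (2 ^ k) _ _ (fun e e_lt =>
      f_equal (fun z => rpow (Cnorm z) p) (coord_slice_rad_mult k b y e s e_lt))).
    apply sign_mean_le_iff, multiplier_le; auto.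
  - rewrite rsum_scal, msum_swap. apply Rmult_le_compat_l; [positivity|].
    apply sum_coord_slice_pow_le.
Qed.

Lemma sign_sum_comp_r (k : nat) (F : nat -> Bop) (e : nat) (A : Bop) :
  sign_sum k (fun i => F i [*] A) e = sign_sum k F e [*] A.
Proof. unfold sign_sum. rewrite bcomp_bsum_l. apply msum_ext. intros. bop_ring. Qed.

Lemma sign_sum_comp_l (k : nat) (F : nat -> Bop) (e : nat) (A : Bop) :
  sign_sum k (fun i => A [*] F i) e = A [*] sign_sum k F e.
Proof. unfold sign_sum. rewrite bcomp_bsum_r. apply msum_ext. intros. bop_ring. Qed.

Lemma sign_sum_sub (k : nat) (F G : nat -> Bop) (e : nat) :
  sign_sum k (fun i => F i [-] G i) e = sign_sum k F e [-] sign_sum k G e.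
Proof. unfold sign_sum. rewrite <- bsum_sub. apply msum_ext. intros. bop_ring. Qed.

Section RademacherBounds.
Variables (k : nat) (A : nat -> Bop) (B : R).
Hypothesis sign_sums_le : forall e, (e < 2 ^ k)%nat -> opnorm_le (sign_sum k A e) B.

Lemma pow2_pos_nat : (0 < 2 ^ k)%nat.
Proof. pose proof (Nat.pow_nonzero 2 k). lia. Qed.

Lemma sign_sum_bound_nonneg : 0 <= B.
Proof. apply (opnorm_le_nonneg (sign_sum k A 0)), sign_sums_le, pow2_pos_nat. Qed.

Lemma opnorm_le_rad_encode : opnorm_le (rad_encode k A) B.
Proof.
  pose proof sign_sum_bound_nonneg as B_nonneg. pose proof (rad_scale_pos k).
  split; auto. intros x. apply rpow_le_reg with p; [positivity..|].
  apply norm_pow_le_of_initial_slices with (2 ^ k)%nat;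
    [intros; apply slice_rad_encode_zero; auto|].
  apply Rle_trans with (rsum (2 ^ k) (fun _ => / 2 ^ k * rpow (B * norm x) p)).
  - apply rsum_le. intros e e_lt. rewrite slice_rad_encode_app, norm_scale, Cnorm_RC_nonneg
      by positivity.
    rewrite rpow_mult_distr, rpow_Rinv, rpow_rad_scale by positivity.
    apply Rmult_le_compat_l; [positivity|]. apply rpow_le; [positivity|]. split; [positivity|].
    apply sign_sums_le; auto.
  - rewrite rsum_const, INR_pow2, <- Rmult_assoc, Rinv_r by positivity. lra.
Qed.

Lemma rad_decode_eq :
  rad_decode k A = RC (rad_scale k / 2 ^ k) [.] bsum (2 ^ k) (fun e => sign_sum k A e [*] slice e).
Proof.
  unfold rad_decode, rad_pair, sign_sum.
  rewrite (msum_ext _ _ k _ (fun i => bsum (2 ^ k) (fun e =>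
    RC (rad_scale k / 2 ^ k) [.] (RC (rad i e) [.] A i [*] slice e)))).
  - rewrite msum_swap, bscale_bsum. apply msum_ext. intros e _. rewrite bcomp_bsum_l, bscale_bsum.
    reflexivity.
  - intros i _. rewrite bcomp_bsum_r. apply msum_ext. intros e _. unfold Rdiv. rewrite !RC_mul.
    bop_ring.
Qed.

Lemma mean_norm_slice_pow_le (y : ellp) :
  rpow (rad_scale k * (rsum (2 ^ k) (fun e => norm (slice e y)) / 2 ^ k)) p <= rpow (norm y) p.
Proof.
  pose proof (rad_scale_pos k). pose proof (pow2_pos k).
  assert (mean_nonneg : 0 <= rsum (2 ^ k) (fun e => norm (slice e y)) / 2 ^ k)
    by (apply Rle_mult_inv_pos; auto; apply rsum_nonneg; positivity).
  rewrite rpow_mult_distr, rpow_rad_scale by positivity.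
  pose proof (rpow_mean (2 ^ k) (fun e => norm (slice e y)) p pexp_ge1 pow2_pos_nat
    (fun _ => norm_nonneg _)) as mean_le. rewrite INR_pow2 in mean_le.
  apply Rle_trans with (2 ^ k * (rsum (2 ^ k) (fun e => rpow (norm (slice e y)) p) / 2 ^ k)).
  - apply Rmult_le_compat_l; [lra|auto].
  - replace (2 ^ k * (rsum (2 ^ k) (fun e => rpow (norm (slice e y)) p) / 2 ^ k))
      with (rsum (2 ^ k) (fun e => rpow (norm (slice e y)) p)) by (field; lra).
    apply sum_norm_slice_le.
Qed.

Lemma opnorm_le_rad_decode : opnorm_le (rad_decode k A) B.
Proof.
  pose proof sign_sum_bound_nonneg as B_nonneg. pose proof (rad_scale_pos k).
  pose proof (pow2_pos k).
  split; auto. intros y. rewrite rad_decode_eq. cbn [bapp bscale]. rewrite bsum_app.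
  rewrite norm_scale, Cnorm_RC_nonneg by positivity.
  assert (sum_le : norm (vsum (2 ^ k) (fun e => (sign_sum k A e [*] slice e) y))
    <= B * rsum (2 ^ k) (fun e => norm (slice e y))).
  { eapply Rle_trans; [apply norm_vsum|]. rewrite <- rsum_scal. apply rsum_le. intros e e_lt.
    apply sign_sums_le; auto. }
  assert (mean_le : rad_scale k * (rsum (2 ^ k) (fun e => norm (slice e y)) / 2 ^ k) <= norm y).
  { apply rpow_le_reg with p; [positivity|..|apply mean_norm_slice_pow_le]; [|positivity].
    assert (0 <= rsum (2 ^ k) (fun e => norm (slice e y))) by (apply rsum_nonneg; positivity).
    positivity. }
  apply Rle_trans with (B * (rad_scale k * (rsum (2 ^ k) (fun e => norm (slice e y)) / 2 ^ k))).
  - replace (B * (rad_scale k * (rsum (2 ^ k) (fun e => norm (slice e y)) / 2 ^ k)))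
      with (rad_scale k / 2 ^ k * (B * rsum (2 ^ k) (fun e => norm (slice e y)))) by (field; lra).
    apply Rmult_le_compat_l; positivity.
  - apply Rmult_le_compat_l; auto.
Qed.

End RademacherBounds.
End RademacherOperators.

(** * Homomorphisms of C(M) into bounded operators, exactly and modulo the compacts *)

Section Homomorphisms.
Context {E : exponent}.
Variables (d : nat) (M : pt -> Prop).

Record homomorphism (eqv : Bop -> Bop -> Prop) (bound : Bop -> R -> Prop) (C : R) (T : fn -> Bop) :
  Prop := {
  hom_bound_nonneg : 0 <= C;
  hom_ext : forall f g, cont_on d M f -> cont_on d M g -> feq M f g -> eqv (T f) (T g);
  hom_add : forall f g, cont_on d M f -> cont_on d M g -> eqv (T (fadd f g)) (T f [+] T g);
  hom_scale : forall c f, cont_on d M f -> eqv (T (fscale c f)) (c [.] T f);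
  hom_mul : forall f g, cont_on d M f -> cont_on d M g -> eqv (T (fmul f g)) (T f [*] T g);
  hom_one : eqv (T fone) bid;
  hom_bounded : forall f s, cont_on d M f -> sup_le M f s -> bound (T f) (C * s) }.

End Homomorphisms.

Arguments hom_bound_nonneg {E d M eqv bound C T}.
Arguments hom_ext {E d M eqv bound C T}.
Arguments hom_add {E d M eqv bound C T}.
Arguments hom_scale {E d M eqv bound C T}.
Arguments hom_mul {E d M eqv bound C T}.
Arguments hom_one {E d M eqv bound C T}.
Arguments hom_bounded {E d M eqv bound C T}.

Notation representation d M := (homomorphism d M eq opnorm_le).
Notation hom_mod d M := (homomorphism d M calkin_eq calkin_norm_le).

Definition hom_dsum {E : exponent} (T1 T2 : fn -> Bop) (f : fn) : Bop := dsum (T1 f) (T2 f).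

Section HomomorphismProperties.
Context {E : exponent}.
Variables (d : nat) (M : pt -> Prop).
Context {eqv : Bop -> Bop -> Prop} {eqv_equiv : Equivalence eqv}
  {badd_eqv : Proper (eqv ==> eqv ==> eqv) badd}
  {bscale_eqv : forall c, Proper (eqv ==> eqv) (bscale c)}
  {dsum_eqv : Proper (eqv ==> eqv ==> eqv) dsum} {bound : Bop -> R -> Prop}.

Section Lincomb.
Variables (C : R) (T : fn -> Bop).
Hypothesis T_hom : homomorphism d M eqv bound C T.

Lemma hom_zero (f : fn) : cont_on d M f -> feq M f (fun _ => C0) -> eqv (T f) bzero.
Proof.
  intros f_cont f_zero. rewrite (hom_ext T_hom f (fscale C0 f)); auto using cont_scale.
  - rewrite (hom_scale T_hom), bscale_0 by auto. reflexivity.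
  - intros x Mx. unfold fscale. rewrite f_zero by auto. ring.
Qed.

Lemma hom_fsum (k : nat) (F : nat -> fn) : (forall i, (i < k)%nat -> cont_on d M (F i)) ->
  eqv (T (fsum k F)) (bsum k (fun i => T (F i))).
Proof.
  induction k as [|k IH]; intros F_cont.
  - apply hom_zero; [apply cont_const|]. intros x _. reflexivity.
  - change (fsum (S k) F) with (fadd (fsum k F) (F k)).
    rewrite (hom_add T_hom) by auto using cont_fsum. simpl. rewrite IH by auto. reflexivity.
Qed.

Lemma hom_lincomb (k : nat) (c : nat -> CC) (F : nat -> fn) :
  (forall i, (i < k)%nat -> cont_on d M (F i)) ->
  eqv (T (fsum k (fun i => fscale (c i) (F i)))) (bsum k (fun i => c i [.] T (F i))).
Proof.
  intros F_cont. rewrite hom_fsum by auto using cont_scale. apply (msum_proper _ _ eqv).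
  intros i i_lt. apply (hom_scale T_hom). auto.
Qed.

End Lincomb.

Lemma homomorphism_dsum (B1 B2 : R) (T1 T2 : fn -> Bop) :
  (forall a b r s, bound a r -> bound b s -> bound (dsum a b) (r + s)) ->
  homomorphism d M eqv bound B1 T1 -> homomorphism d M eqv bound B2 T2 ->
  homomorphism d M eqv bound (B1 + B2) (hom_dsum T1 T2).
Proof.
  intros bound_dsum T1_hom T2_hom. unfold hom_dsum. split.
  - pose proof (hom_bound_nonneg T1_hom). pose proof (hom_bound_nonneg T2_hom). lra.
  - intros f g f_cont g_cont fg.
    rewrite (hom_ext T1_hom f g), (hom_ext T2_hom f g) by auto. reflexivity.
  - intros f g f_cont g_cont.
    rewrite (hom_add T1_hom), (hom_add T2_hom), dsum_add by auto. reflexivity.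
  - intros c f f_cont. rewrite (hom_scale T1_hom), (hom_scale T2_hom), dsum_scale by auto.
    reflexivity.
  - intros f g f_cont g_cont.
    rewrite (hom_mul T1_hom), (hom_mul T2_hom), dsum_mul by auto. reflexivity.
  - rewrite (hom_one T1_hom), (hom_one T2_hom), dsum_id. reflexivity.
  - intros f s f_cont f_le. rewrite Rmult_plus_distr_r.
    apply bound_dsum; [apply (hom_bounded T1_hom)|apply (hom_bounded T2_hom)]; auto.
Qed.

Lemma hom_mod_of_representation (C : R) (T : fn -> Bop) :
  representation d M C T -> hom_mod d M C T.
Proof.
  intros T_rep. split; intros; try apply calkin_eq_of_eq; try apply calkin_norm_le_of_opnorm_le;
    apply T_rep; auto.
Qed.

Lemma representation_point (x0 : pt) : M x0 -> representation d M 1 (fun f => f x0 [.] bid).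
Proof.
  intros Mx0. split; [lra|..].
  - intros f g _ _ fg. rewrite fg by auto. reflexivity.
  - intros f g _ _. unfold fadd. bop_ring.
  - intros c f _. unfold fscale. bop_ring.
  - intros f g _ _. unfold fmul. bop_ring.
  - unfold fone. bop_ring.
  - intros f s _ f_le. apply opnorm_le_mono with (Cnorm (f x0) * 1).
    + specialize (f_le x0 Mx0). lra.
    + apply opnorm_le_scale, opnorm_le_id.
Qed.

Lemma representation_block_diag (C : R) (T : nat -> fn -> Bop) :
  (forall f, cont_on d M f -> exists s, sup_le M f s) ->
  (forall n, representation d M C (T n)) ->
  representation d M C (fun f => block_diag (fun n => T n f)).
Proof.
  intros cont_bounded T_rep.
  assert (slice_T : forall f n, cont_on d M f ->
    slice n [*] block_diag (fun n => T n f) = T n f [*] slice n).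
  { intros f n f_cont. destruct (cont_bounded f f_cont) as [s f_le].
    apply (slice_block_diag (fun m => T m f) (C * s)). intros m.
    apply (hom_bounded (T_rep m)); auto. }
  split.
  - apply (hom_bound_nonneg (T_rep 0%nat)).
  - intros f g f_cont g_cont fg. apply Bop_slice_ext. intros n. rewrite !slice_T by auto.
    rewrite (hom_ext (T_rep n) f g) by auto. reflexivity.
  - intros f g f_cont g_cont. apply Bop_slice_ext. intros n.
    rewrite bcomp_add_r, !slice_T by auto using cont_add.
    rewrite (hom_add (T_rep n)), bcomp_add_l by auto. reflexivity.
  - intros c f f_cont. apply Bop_slice_ext. intros n.
    rewrite bcomp_scale_r, !slice_T by auto using cont_scale.
    rewrite (hom_scale (T_rep n)), bcomp_scale_l by auto. reflexivity.
  - intros f g f_cont g_cont. apply Bop_slice_ext. intros n.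
    rewrite <- bcomp_assoc, !slice_T, bcomp_assoc, slice_T, <- bcomp_assoc by auto using cont_mul.
    rewrite (hom_mul (T_rep n)) by auto. reflexivity.
  - apply Bop_slice_ext. intros n. rewrite slice_T by apply cont_const.
    rewrite (hom_one (T_rep n)), bcomp_id_l, bcomp_id_r. reflexivity.
  - intros f s f_cont f_le. apply opnorm_le_block_diag. intros n.
    apply (hom_bounded (T_rep n)); auto.
Qed.

End HomomorphismProperties.

(** * The model representation *)

Section PointValues.
Context {E : exponent}.
Variables (d : nat) (M : pt -> Prop) (x0 : pt).
Hypothesis Mx0 : M x0.

(* Acts on the i-th Rademacher function as [f (x i)], on the complement of their span as [f x0]. *)
Definition rad_values (k : nat) (x : nat -> pt) (f : fn) : Bop :=
  f x0 [.] bid [+] rad_mult k (fun i => Csub (f (x i)) (f x0)).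

Lemma representation_rad_values : exists K, forall k x, (forall i, M (x i)) ->
  representation d M K (rad_values k x).
Proof.
  destruct rad_mult_bounded as (K & K_nonneg & rad_mult_le).
  exists (1 + K * 2). intros k x Mx. unfold rad_values. split; [lra|..].
  - intros f g _ _ fg. rewrite (fg x0 Mx0). do 2 f_equal. apply functional_extensionality.
    intros i. rewrite (fg (x i) (Mx i)). reflexivity.
  - intros f g _ _. unfold fadd.
    replace (fun i => Csub (Cadd (f (x i)) (g (x i))) (Cadd (f x0) (g x0)))
      with (fun i => Cadd (Csub (f (x i)) (f x0)) (Csub (g (x i)) (g x0)))
      by (apply functional_extensionality; intros; ring).
    rewrite rad_mult_add. bop_ring.
  - intros c f _. unfold fscale.
    replace (fun i => Csub (Cmul c (f (x i))) (Cmul c (f x0)))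
      with (fun i => Cmul c (Csub (f (x i)) (f x0)))
      by (apply functional_extensionality; intros; ring).
    rewrite rad_mult_scale. bop_ring.
  - intros f g _ _. unfold fmul.
    set (b i := Csub (f (x i)) (f x0)). set (c i := Csub (g (x i)) (g x0)).
    replace (fun i => Csub (Cmul (f (x i)) (g (x i))) (Cmul (f x0) (g x0)))
      with (fun i => Cadd (Cadd (Cmul (f x0) (c i)) (Cmul (g x0) (b i))) (Cmul (b i) (c i)))
      by (apply functional_extensionality; intros; unfold b, c; ring).
    rewrite !rad_mult_add, !rad_mult_scale, <- rad_mult_mul. bop_ring.
  - replace (fun i => Csub (fone (x i)) (fone x0)) with (fun _ : nat => C0)
      by (apply functional_extensionality; intros; unfold fone; ring).
    rewrite rad_mult_zero. unfold fone. bop_ring.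
  - intros f s _ f_le. pose proof (f_le x0 Mx0). pose proof (Cnorm_nonneg (f x0)).
    replace ((1 + K * 2) * s) with (s + K * (2 * s)) by ring. apply opnorm_le_add.
    + apply opnorm_le_mono with (Cnorm (f x0) * 1); [lra|apply opnorm_le_scale, opnorm_le_id].
    + apply rad_mult_le; [lra|]. intros i _. eapply Rle_trans; [apply Cnorm_add|].
      rewrite Cnorm_opp. specialize (f_le (x i) (Mx i)). lra.
Qed.

Variables (k : nat) (x : nat -> pt) (f : fn).

Lemma rad_values_rad_encode (A : nat -> Bop) :
  rad_values k x f [*] rad_encode k A = rad_encode k (fun i => f (x i) [.] A i).
Proof.
  unfold rad_values. rewrite bcomp_add_l, rad_mult_rad_encode, bcomp_scale_l, bcomp_id_l.
  unfold rad_encode. rewrite bscale_bsum, <- (msum_add (add := badd)). apply msum_ext. intros.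
  bop_ring.
Qed.

Lemma rad_decode_rad_values (A : nat -> Bop) :
  rad_decode k A [*] rad_values k x f = rad_decode k (fun i => f (x i) [.] A i).
Proof.
  unfold rad_values. rewrite bcomp_add_r, rad_decode_rad_mult, bcomp_scale_r, bcomp_id_r.
  unfold rad_decode. rewrite bscale_bsum, <- (msum_add (add := badd)). apply msum_ext. intros.
  bop_ring.
Qed.

Lemma rad_values_embed_outside : rad_values k x f [*] embed (2 ^ k) = f x0 [.] embed (2 ^ k).
Proof. unfold rad_values. rewrite bcomp_add_l, rad_mult_embed_outside. bop_ring. Qed.

Lemma slice_rad_values_outside : slice (2 ^ k) [*] rad_values k x f = f x0 [.] slice (2 ^ k).
Proof. unfold rad_values. rewrite bcomp_add_r, slice_rad_mult_outside. bop_ring. Qed.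

End PointValues.

Lemma Cnorm_le_calkin_norm_scalar {E : exponent} (z : CC) (s : R) :
  calkin_norm_le (z [.] bid) s -> Cnorm z <= s.
Proof.
  intros z_le. apply le_epsilon. intros eps eps_pos.
  destruct (calkin_norm_le_comp_tail _ _ _ z_le eps_pos) as [m tail_le].
  destruct (tail_le m (le_n m)) as [_ scalar_le]. specialize (scalar_le (basis_vec m)).
  cbn [bapp bcomp bscale bid] in scalar_le.
  rewrite tail_basis_vec, norm_scale, norm_basis_vec in scalar_le. lra.
Qed.

Section SingleRademacher.
Context {E : exponent}.
Variables (k i : nat).
Hypothesis i_lt : (i < k)%nat.

Let unit_at (j : nat) : Bop := if (j =? i)%nat then bid else bzero.

Lemma opnorm_le_sign_sum_unit_at (e : nat) : opnorm_le (sign_sum k unit_at e) 1.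
Proof.
  unfold sign_sum. rewrite (msum_single k i); auto; unfold unit_at.
  - rewrite Nat.eqb_refl. apply opnorm_le_mono with (Cnorm (RC (rad i e)) * 1).
    + rewrite Cnorm_RC, Rabs_rad. lra.
    + apply opnorm_le_scale, opnorm_le_id.
  - intros j _ ne. destruct (Nat.eqb_spec j i); [lia|bop_ring].
Qed.

Lemma rad_encode_unit_at : rad_encode k unit_at = rad_tensor k i.
Proof.
  unfold rad_encode, unit_at. rewrite (msum_single k i), Nat.eqb_refl; auto; [apply bcomp_id_r|].
  intros j _ ne. destruct (Nat.eqb_spec j i); [lia|apply bcomp_zero_r].
Qed.

Lemma rad_decode_unit_at : rad_decode k unit_at = rad_pair k i.
Proof.
  unfold rad_decode, unit_at. rewrite (msum_single k i), Nat.eqb_refl; auto; [apply bcomp_id_l|].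
  intros j _ ne. destruct (Nat.eqb_spec j i); [lia|apply bcomp_zero_l].
Qed.

Lemma opnorm_le_rad_tensor : opnorm_le (rad_tensor k i) 1.
Proof.
  rewrite <- rad_encode_unit_at. apply opnorm_le_rad_encode. auto using opnorm_le_sign_sum_unit_at.
Qed.

Lemma opnorm_le_rad_pair : opnorm_le (rad_pair k i) 1.
Proof.
  rewrite <- rad_decode_unit_at. apply opnorm_le_rad_decode. auto using opnorm_le_sign_sum_unit_at.
Qed.

Lemma rad_pair_rad_values_rad_tensor (x0 : pt) (x : nat -> pt) (f : fn) :
  rad_pair k i [*] rad_values x0 k x f [*] rad_tensor k i = f (x i) [.] bid.
Proof.
  rewrite <- rad_encode_unit_at, bcomp_assoc, rad_values_rad_encode, rad_pair_rad_encode by auto.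
  unfold unit_at. rewrite Nat.eqb_refl. reflexivity.
Qed.

End SingleRademacher.

Section Model.
Context {E : exponent}.
Variables (d : nat) (M : pt -> Prop) (x0 : pt) (P : nat -> partition).
Hypothesis d_pos : (1 <= d)%nat.
Hypothesis M_compact : compact_set d M.
Hypothesis Mx0 : M x0.
Hypothesis points_in : forall n i, M (part_point (P n) i).

Definition model_stage (n : nat) (f : fn) : Bop :=
  rad_values x0 (part_size (P n)) (part_point (P n)) f.
Definition model (f : fn) : Bop := block_diag (fun n => model_stage n f).

Lemma representation_model : exists K, representation d M K model.
Proof.
  destruct (representation_rad_values d M x0 Mx0) as [K rad_values_rep]. exists K.
  apply representation_block_diag; [intros; eapply cont_bounded; eauto|].
  intros n. apply rad_values_rep, points_in.
Qed.

Lemma model_stage_bounded (f : fn) : cont_on d M f ->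
  exists r, forall n, opnorm_le (model_stage n f) r.
Proof.
  intros f_cont. destruct (cont_bounded d d_pos M M_compact f f_cont) as [s f_le].
  destruct (representation_rad_values d M x0 Mx0) as [K rad_values_rep].
  exists (K * s). intros n. apply (hom_bounded (rad_values_rep _ _ (points_in n))); auto.
Qed.

Lemma slice_model (f : fn) (n : nat) : cont_on d M f ->
  slice n [*] model f = model_stage n f [*] slice n.
Proof.
  intros f_cont. destruct (model_stage_bounded f f_cont) as [r stage_le].
  exact (slice_block_diag _ r stage_le n).
Qed.

Lemma model_embed (f : fn) (n : nat) : cont_on d M f ->
  model f [*] embed n = embed n [*] model_stage n f.
Proof.
  intros f_cont. destruct (model_stage_bounded f f_cont) as [r stage_le].
  exact (block_diag_embed _ r stage_le n).
Qed.

Lemma Cnorm_point_le_calkin_norm_model (f : fn) (s : R) (n i : nat) :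
  cont_on d M f -> (i < part_size (P n))%nat -> calkin_norm_le (model f) s ->
  Cnorm (f (part_point (P n) i)) <= s.
Proof.
  intros f_cont i_lt model_le. set (k := part_size (P n)) in *.
  apply Cnorm_le_calkin_norm_scalar. replace s with (1 * s * 1) by ring.
  replace (f (part_point (P n) i) [.] bid)
    with ((rad_pair k i [*] slice n) [*] model f [*] (embed n [*] rad_tensor k i)).
  - apply calkin_norm_le_comp; auto;
      [apply opnorm_le_contraction_l|apply opnorm_le_contraction_r];
      auto using opnorm_le_rad_pair, opnorm_le_slice, opnorm_le_embed, opnorm_le_rad_tensor.
  - rewrite <- (rad_pair_rad_values_rad_tensor k i i_lt x0), <- bcomp_assoc.
    rewrite (bcomp_assoc (rad_pair k i)), slice_model, (bcomp_assoc _ (_ [*] slice n)) by auto.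
    rewrite (bcomp_assoc _ (slice n)), slice_embed_same, bcomp_id_r. reflexivity.
Qed.

End Model.

(** * Quasicentral partitions of the identity *)

Section QuasicentralPartitions.
Context {E : exponent}.
Notation p := pexp.

Record cutoffs (lists : nat -> list Bop) (tol : nat -> R) (ms : nat -> nat) (w : nat -> nat -> R) :
  Prop := {
  cutoff_zero : forall t, w 0%nat t = 0;
  cutoff_range : forall m t, 0 <= w m t <= 1;
  cutoff_one : forall m t, (1 <= m)%nat -> (t < ms (S m))%nat -> w m t = 1;
  cutoff_exhaust : forall m t, (t < m)%nat -> w m t = 1;
  cutoff_nested : forall m t, w m t <> 0 -> w (S m) t = 1;
  cutoff_finite : forall m, exists s, forall t, (s <= t)%nat -> w m t = 0;
  cutoff_commutator : forall m A, In A (lists m) -> opnorm_le (commutator (diag (w m)) A) (tol m) }.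

Arguments cutoff_zero {lists tol ms w}.
Arguments cutoff_range {lists tol ms w}.
Arguments cutoff_one {lists tol ms w}.
Arguments cutoff_exhaust {lists tol ms w}.
Arguments cutoff_nested {lists tol ms w}.
Arguments cutoff_finite {lists tol ms w}.
Arguments cutoff_commutator {lists tol ms w}.

Definition is_cutoff (l : list Bop) (tol : R) (m s : nat) (w : nat -> R) : Prop :=
  (forall t, 0 <= w t <= 1) /\ (forall t, (t < m)%nat -> w t = 1) /\
  (forall t, (s <= t)%nat -> w t = 0) /\
  forall A, In A l -> opnorm_le (commutator (diag w) A) tol.

Lemma is_cutoff_exists (l : list Bop) (tol : R) (m : nat) : 0 < tol ->
  exists c : nat * (nat -> R), is_cutoff l tol m (fst c) (snd c).
Proof.
  intros tol_pos.
  destruct (quasicentral_cutoff l m tol tol_pos) as (w & range & one & (s & zero) & comm_le).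
  exists (s, w). split; auto.
Qed.

Lemma cutoffs_exist (lists : nat -> list Bop) (tol : nat -> R) (ms : nat -> nat) :
  (forall m, 0 < tol m) -> exists w, cutoffs lists tol ms w.
Proof.
  intros tol_pos.
  set (start := fun m s => Nat.max s (Nat.max (ms (S m)) m)).
  destruct (choice (fun ms' c => is_cutoff (lists (fst ms')) (tol (fst ms'))
    (start (fst ms') (snd ms')) (fst c) (snd c))) as [next next_cutoff].
  { intros [m s]. apply is_cutoff_exists. auto. }
  set (stage := fix stage m : nat * (nat -> R) :=
    match m with O => (0%nat, fun _ => 0) | S m' => next (S m', fst (stage m')) end).
  assert (stage_cutoff : forall m, is_cutoff (lists (S m)) (tol (S m))
    (start (S m) (fst (stage m))) (fst (stage (S m))) (snd (stage (S m))))
    by (intros m; exact (next_cutoff (S m, fst (stage m)))).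
  assert (stage_zero : forall m t, (fst (stage m) <= t)%nat -> snd (stage m) t = 0)
    by (intros [|m]; [reflexivity|apply stage_cutoff]).
  exists (fun m => snd (stage m)). split.
  - reflexivity.
  - intros [|m] t; [simpl; lra|apply stage_cutoff].
  - intros [|m] t m_ge t_lt; [lia|]. apply stage_cutoff. unfold start. lia.
  - intros [|m] t t_lt; [lia|]. apply stage_cutoff. unfold start. lia.
  - intros m t nz. apply stage_cutoff. unfold start.
    destruct (le_lt_dec (fst (stage m)) t) as [t_ge|]; [|lia]. destruct nz. auto.
  - intros m. exists (fst (stage m)). apply stage_zero.
  - intros [|m] A A_in; [|apply stage_cutoff; auto]. simpl. rewrite diag_zero.
    replace (commutator bzero A) with bzero by (unfold commutator; bop_ring).
    apply opnorm_le_mono with 0; [apply Rlt_le, tol_pos|apply opnorm_le_zero].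
Qed.

Variables (lists : nat -> list Bop) (tol : nat -> R) (ms : nat -> nat) (w : nat -> nat -> R).
Hypothesis w_cutoffs : cutoffs lists tol ms w.

Definition gap (a b : nat) : Bop := diag (fun t => w b t - w a t).
Definition cut (n : nat) : Bop := gap n (n + 1).
(* For [n = 0] the truncated [n - 1] is [0], and [w 0 = 0]. *)
Definition wide_cut (n : nat) : Bop := gap (n - 1) (n + 2).

Lemma cutoff_mono (a b t : nat) : (a <= b)%nat -> w a t <= w b t.
Proof.
  intros a_le. apply (monotone_of_steps Rle (fun m => w m t)); auto. intros m.
  pose proof (cutoff_range w_cutoffs m t).
  destruct (Req_dec (w m t) 0) as [zero|nz].
  - rewrite zero. apply (cutoff_range w_cutoffs).
  - rewrite (cutoff_nested w_cutoffs m t nz). lra.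
Qed.

Lemma cutoff_one_mono (a b t : nat) : (a <= b)%nat -> w a t = 1 -> w b t = 1.
Proof.
  intros a_le a_one. pose proof (cutoff_mono a b t a_le).
  pose proof (cutoff_range w_cutoffs b t). lra.
Qed.

Lemma cutoff_diff_range (a b t : nat) : (a <= b)%nat -> 0 <= w b t - w a t <= 1.
Proof.
  intros a_le. pose proof (cutoff_mono a b t a_le).
  pose proof (cutoff_range w_cutoffs a t). pose proof (cutoff_range w_cutoffs b t). lra.
Qed.

Lemma gap_app (a b t : nat) (x : ellp) : (a <= b)%nat ->
  gap a b x t = Cmul (RC (w b t - w a t)) (x t).
Proof.
  intros a_le. unfold gap. rewrite diag_app, clip_id by (apply cutoff_diff_range; auto).
  reflexivity.
Qed.

Lemma gap_eq_sub (a b : nat) : (a <= b)%nat -> gap a b = diag (w b) [-] diag (w a).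
Proof.
  intros a_le. bop_coords. rewrite gap_app, !diag_app, !clip_id
    by (auto; apply (cutoff_range w_cutoffs)).
  unfold Rminus. rewrite RC_add, RC_opp. ring.
Qed.

Lemma opnorm_le_gap (a b : nat) : opnorm_le (gap a b) 1.
Proof. apply opnorm_le_diag. Qed.

Lemma compact_gap (a b : nat) : (a <= b)%nat -> is_compact (gap a b).
Proof.
  intros a_le. destruct (cutoff_finite w_cutoffs b) as [s zero].
  apply compact_diag with s. intros t t_ge. rewrite clip_id by (apply cutoff_diff_range; auto).
  pose proof (cutoff_diff_range a b t a_le). pose proof (cutoff_range w_cutoffs a t).
  specialize (zero t t_ge). lra.
Qed.

Lemma opnorm_le_commutator_gap (a b : nat) (A : Bop) : (a <= b)%nat ->
  In A (lists a) -> In A (lists b) -> opnorm_le (commutator (gap a b) A) (tol b + tol a).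
Proof.
  intros a_le in_a in_b.
  replace (commutator (gap a b) A) with (commutator (diag (w b)) A [-] commutator (diag (w a)) A)
    by (rewrite gap_eq_sub by auto; unfold commutator; bop_ring).
  apply opnorm_le_sub; apply (cutoff_commutator w_cutoffs); auto.
Qed.

Lemma tail_wide_cut (n : nat) : (2 <= n)%nat -> tail (ms n) [*] wide_cut n = wide_cut n.
Proof.
  intros n_ge. unfold wide_cut. bop_coords. rewrite tail_app.
  destruct (Nat.ltb_spec t (ms n)); [|reflexivity]. rewrite gap_app by lia.
  assert (one : w (n - 1)%nat t = 1)
    by (apply (cutoff_one w_cutoffs); [lia|replace (S (n - 1)) with n by lia; auto]).
  rewrite (cutoff_one_mono (n - 1) (n + 2) t), one, Rminus_diag, RC_0 by (lia || auto). ring.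
Qed.

Lemma wide_cut_tail (n : nat) : (2 <= n)%nat -> wide_cut n [*] tail (ms n) = wide_cut n.
Proof. intros n_ge. rewrite <- (tail_wide_cut n n_ge) at 2. apply diag_comm. Qed.

Lemma wide_cut_cut (n : nat) : wide_cut n [*] cut n = cut n.
Proof.
  unfold wide_cut, cut. bop_coords. rewrite !gap_app by lia.
  destruct (Req_dec (w (n + 1)%nat t - w n t) 0) as [-> |nz]; [rewrite RC_0; ring|].
  pose proof (cutoff_range w_cutoffs n t).
  pose proof (cutoff_range w_cutoffs (n + 1)%nat t).
  pose proof (cutoff_mono n (n + 1) t ltac:(lia)).
  assert (outer : w (n + 2)%nat t = 1).
  { replace (n + 2)%nat with (S (n + 1)) by lia.
    apply (cutoff_nested w_cutoffs). intros zero. lra. }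
  assert (inner : w (n - 1)%nat t = 0).
  { apply NNPP. intros inner_nz. apply nz.
    destruct n as [|n]; [destruct inner_nz; apply (cutoff_zero w_cutoffs)|].
    replace (S n - 1)%nat with n in inner_nz by lia.
    pose proof (cutoff_nested w_cutoffs n t inner_nz) as one.
    rewrite one, (cutoff_one_mono (S n) (S n + 1) t) by (lia || auto). ring. }
  rewrite outer, inner, Rminus_0_r, RC_1. ring.
Qed.

Lemma tail_cut (n : nat) : (2 <= n)%nat -> tail (ms n) [*] cut n = cut n.
Proof. intros n_ge. rewrite <- wide_cut_cut, <- bcomp_assoc, tail_wide_cut; auto. Qed.

Lemma cutoff_telescope (N t : nat) : rsum N (fun n => w (n + 1)%nat t - w n t) = w N t.
Proof.
  induction N as [|N IH]; cbn [msum]; [rewrite (cutoff_zero w_cutoffs); auto|].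
  rewrite IH. replace (N + 1)%nat with (S N) by lia. ring.
Qed.

Lemma sum_cut_app (x : ellp) (t : nat) : csum (t + 2) (fun n => cut n x t) = x t.
Proof.
  rewrite (msum_ext _ _ _ _ (fun n => Cmul (x t) (RC (w (n + 1)%nat t - w n t)))).
  - rewrite csum_scal, csum_RC, cutoff_telescope, (cutoff_exhaust w_cutoffs), RC_1 by lia. ring.
  - intros n _. unfold cut. rewrite gap_app by lia. ring.
Qed.

Lemma column_bound_cut : column_bound cut 1.
Proof.
  split; [lra|]. intros x N. rewrite Rmult_1_l. apply (sum_norm_pow_le (fun n => cut n x)).
  intros K. rewrite msum_swap. eapply Rle_trans; [|apply (sum_coord_pow_le x K)].
  apply rsum_le. intros t _. set (a := rpow (Cnorm (x t)) p).
  assert (a_nonneg : 0 <= a) by (unfold a; positivity).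
  apply Rle_trans with (rsum N (fun n => a * (w (n + 1)%nat t - w n t))).
  - apply rsum_le. intros n _. pose proof (cutoff_diff_range n (n + 1) t ltac:(lia)).
    unfold cut. rewrite gap_app, Cnorm_mul, Cnorm_RC_nonneg, rpow_mult_distr by (lia || positivity).
    rewrite Rmult_comm. apply Rmult_le_compat_l; auto. apply rpow_le_self; [positivity|lra].
  - rewrite rsum_scal, cutoff_telescope. pose proof (cutoff_range w_cutoffs N t). nra.
Qed.

Lemma row_local_wide_cut (A : nat -> Bop) : row_local 2 4 (fun n => wide_cut n [*] A n).
Proof.
  unfold wide_cut. split.
  - intros n t x n_ge. cbn [bapp bcomp].
    rewrite gap_app, !(cutoff_exhaust w_cutoffs), Rminus_diag, RC_0 by lia. ring.
  - intros t. destruct (dec_inh_nat_subset_has_unique_least_element (fun v => w v t = 1))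
      as (v & (v_one & v_least) & _).
    { intros v. apply classic. }
    { exists (S t). apply (cutoff_exhaust w_cutoffs). lia. }
    exists (v - 3)%nat. intros n x nz. cbn [bapp bcomp] in nz. rewrite gap_app in nz by lia.
    assert (diff_nz : w (n + 2)%nat t - w (n - 1)%nat t <> 0)
      by (intros zero; apply nz; rewrite zero, RC_0; ring).
    assert (outer_nz : w (n + 2)%nat t <> 0).
    { pose proof (cutoff_mono (n - 1) (n + 2) t ltac:(lia)).
      pose proof (cutoff_range w_cutoffs (n - 1)%nat t). lra. }
    pose proof (v_least _ (cutoff_nested w_cutoffs _ _ outer_nz)).
    destruct (le_lt_dec v (n - 1)) as [v_le|]; [|lia]. destruct diff_nz.
    rewrite (cutoff_one_mono v (n - 1) t), (cutoff_one_mono v (n + 2) t) by (lia || auto). ring.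
Qed.

End QuasicentralPartitions.

(** * Approximation schemes *)

Record approximation_scheme (d : nat) (M : pt -> Prop) (P : nat -> partition) (mesh : nat -> R)
  (tests : nat -> list fn) : Prop := {
  scheme_partition : forall n, is_partition d M (mesh n) (2 ^ d) (P n);
  scheme_mesh : forall n, mesh n <= (/ 2) ^ n;
  scheme_cont : forall n f, In f (tests n) -> cont_on d M f;
  scheme_mono : forall m n f, (m <= n)%nat -> In f (tests m) -> In f (tests n);
  scheme_osc : forall n f x y, In f (tests n) -> M x -> M y -> near d x y (mesh n) ->
    Cnorm (Csub (f y) (f x)) <= (/ 2) ^ n;
  scheme_dense : forall f eps, cont_on d M f -> 0 < eps ->
    exists n k (u : nat -> fn) (c : nat -> CC), (forall i, (i < k)%nat -> In (u i) (tests n)) /\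
    sup_le M (fadd f (fscale (Copp C1) (fsum k (fun i => fscale (c i) (u i))))) eps }.

Arguments scheme_partition {d M P mesh tests}.
Arguments scheme_mesh {d M P mesh tests}.
Arguments scheme_cont {d M P mesh tests}.
Arguments scheme_mono {d M P mesh tests}.
Arguments scheme_osc {d M P mesh tests}.
Arguments scheme_dense {d M P mesh tests}.

Definition part_square (P : partition) (i : nat) : fn :=
  fun y => RC (part_fun P i y * part_fun P i y).

Section Partition.
Variables (d : nat) (M : pt -> Prop) (mesh mult : R) (P : partition).
Hypothesis P_part : is_partition d M mesh mult P.

Lemma cont_part_square (i : nat) : cont_on d M (part_square P i).
Proof.
  replace (part_square P i)
    with (fmul (fun y => RC (part_fun P i y)) (fun y => RC (part_fun P i y))).
  - apply cont_mul; apply (part_fun_cont P_part).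
  - apply functional_extensionality. intros y. unfold fmul, part_square. rewrite RC_mul.
    reflexivity.
Qed.

Lemma sup_le_sub_part_squares (f : fn) (eps : R) :
  (forall x y, M x -> M y -> near d x y mesh -> Cnorm (Csub (f y) (f x)) <= eps) ->
  sup_le M (fadd f (fscale (Copp C1)
    (fsum (part_size P) (fun i => fscale (f (part_point P i)) (part_square P i))))) eps.
Proof.
  intros f_osc y My. set (k := part_size P). set (g i := part_fun P i y).
  assert (sum_one : rsum k (fun i => g i * g i) = 1) by exact (part_sum_sq P_part y My).
  assert (g_sq_nonneg : forall i, 0 <= g i * g i) by (intros; apply Rle_0_sqr).
  set (term i := Cmul (RC (g i * g i)) (Csub (f y) (f (part_point P i)))).
  replace (fadd _ _ y) with (csum k term).
  - eapply Rle_trans; [apply Cnorm_csum|].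
    apply Rle_trans with (rsum k (fun i => eps * (g i * g i))); [|rewrite rsum_scal, sum_one; lra].
    apply rsum_le. intros i _. unfold term. rewrite Cnorm_mul, Cnorm_RC_nonneg, Rmult_comm by auto.
    destruct (Req_dec (g i) 0) as [-> |nz]; [lra|].
    apply Rmult_le_compat_r; auto. apply f_osc; auto; [apply (part_point_in P_part)|].
    apply (part_near P_part); auto.
  - unfold fadd, fscale, fsum, part_square. fold g. rewrite <- csum_scal.
    transitivity (Cadd (Cmul (f y) (csum k (fun i => RC (g i * g i))))
      (csum k (fun i => Cmul (Copp C1) (Cmul (f (part_point P i)) (RC (g i * g i)))))).
    + rewrite <- csum_scal, <- (msum_add (add := Cadd)). apply msum_ext. intros. unfold term. ring.
    + rewrite csum_RC, sum_one, RC_1. f_equal. ring.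
Qed.

End Partition.

Section SchemeExists.
Variables (d : nat) (M : pt -> Prop).
Hypothesis d_pos : (1 <= d)%nat.
Hypothesis M_compact : compact_set d M.
Hypothesis M_inhabited : exists x, M x.

Lemma common_modulus (l : list fn) (eps : R) : 0 < eps -> (forall f, In f l -> cont_on d M f) ->
  exists r, 0 < r <= eps /\ forall f x y, In f l -> M x -> M y -> near d x y r ->
    Cnorm (Csub (f y) (f x)) <= eps.
Proof.
  intros eps_pos l_cont.
  destruct (list_common_radius l (fun f r => forall x y, M x -> M y -> near d x y r ->
    Cnorm (Csub (f y) (f x)) <= eps)) as (r & r_pos & l_osc).
  - intros f r s s_le f_osc x y Mx My xy_near. apply f_osc; auto. apply near_weaken with s; auto.
  - intros f f_in. apply cont_uniform; auto.
  - pose proof (Rmin_l r eps). pose proof (Rmin_r r eps). exists (Rmin r eps). split.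
    + split; [apply Rmin_glb_lt; auto|auto].
    + intros f x y f_in Mx My xy_near. apply l_osc; auto. apply near_weaken with (Rmin r eps); auto.
Qed.

Lemma approximation_scheme_exists : exists P mesh tests, approximation_scheme d M P mesh tests.
Proof.
  assert (half_pos : forall n, 0 < (/ 2) ^ n) by (intros; apply pow_lt; lra).
  destruct (choice _ (fun m =>
    partition_exists d M d_pos M_compact M_inhabited ((/ 2) ^ m) (half_pos m))) as [Q Q_part].
  set (tests := fun n =>
    flat_map (fun m => map (part_square (Q m)) (seq 0 (part_size (Q m)))) (seq 0 (S n))).
  assert (in_tests : forall n f, In f (tests n) <-> exists m i,
    (m <= n)%nat /\ (i < part_size (Q m))%nat /\ f = part_square (Q m) i).
  { intros n f. unfold tests. rewrite in_flat_map. split.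
    - intros (m & m_in & f_in). apply in_map_iff in f_in as (i & <- & i_in).
      apply in_seq in m_in, i_in. exists m, i. repeat split; lia.
    - intros (m & i & m_le & i_lt & ->). exists m. split; [apply in_seq; lia|].
      apply in_map, in_seq. lia. }
  assert (tests_cont : forall n f, In f (tests n) -> cont_on d M f).
  { intros n f (m & i & _ & _ & ->)%in_tests. eapply cont_part_square; eauto. }
  destruct (choice _ (fun n => common_modulus (tests n) ((/ 2) ^ n) (half_pos n) (tests_cont n)))
    as [mesh mesh_spec].
  destruct (choice _ (fun n =>
    partition_exists d M d_pos M_compact M_inhabited (mesh n) (proj1 (proj1 (mesh_spec n)))))
    as [P P_part].
  exists P, mesh, tests. split; auto.
  - intros n. apply mesh_spec.
  - intros m n f m_le (m' & i & m'_le & i_lt & ->)%in_tests. apply in_tests.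
    exists m', i. repeat split; auto. lia.
  - intros n. apply mesh_spec.
  - intros f eps f_cont eps_pos.
    destruct (cont_uniform d d_pos M M_compact f eps f_cont eps_pos) as (r & r_pos & f_osc).
    destruct (pow_half_small 1 r r_pos) as [m half_small].
    specialize (half_small m (le_n m)). rewrite Rmult_1_l in half_small.
    exists m, (part_size (Q m)), (part_square (Q m)), (fun i => f (part_point (Q m) i)). split.
    + intros i i_lt. apply in_tests. eauto.
    + apply (sup_le_sub_part_squares d M _ _ _ (Q_part m)). intros x y Mx My xy_near.
      apply f_osc; auto. apply near_weaken with ((/ 2) ^ m); auto.
Qed.

End SchemeExists.

(** * Dilation of an extension along one partition *)

Section DilationStage.
Context {E : exponent}.
Variables (d : nat) (M : pt -> Prop) (x0 : pt) (P : partition) (mesh mult delta : R)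
  (tests : list fn).
Hypothesis P_part : is_partition d M mesh mult P.
Hypothesis delta_range : 0 < delta <= 1.
Hypothesis tests_cont : forall f, In f tests -> cont_on d M f.
Hypothesis tests_osc : forall f x y, In f tests -> M x -> M y -> near d x y mesh ->
  Cnorm (Csub (f y) (f x)) <= delta.
Variables (T : fn -> Bop) (C : R).
Hypothesis T_hom : hom_mod d M C T.

Local Notation k := (part_size P).
Local Notation point := (part_point P).

Definition bump (i : nat) : fn := fun y => RC (part_fun P i y).
Definition lift (i : nat) : Bop := T (bump i).
Definition sign_lift (e : nat) : Bop := sign_sum k lift e.
Definition sampled (f : fn) (e : nat) : Bop := sign_sum k (fun i => f (point i) [.] lift i) e.
Definition defect : Bop := bsum k (fun i => lift i [*] lift i) [-] bid.
Definition left_error (f : fn) (e : nat) : Bop := T f [*] sign_lift e [-] sampled f e.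
Definition right_error (f : fn) (e : nat) : Bop := sign_lift e [*] T f [-] sampled f e.

Definition signed_bump (e : nat) : fn := fsum k (fun i => fscale (RC (rad i e)) (bump i)).

Lemma cont_bump (i : nat) : cont_on d M (bump i).
Proof. apply (part_fun_cont P_part). Qed.

Lemma cont_signed_bump (e : nat) : cont_on d M (signed_bump e).
Proof. apply cont_fsum. auto using cont_scale, cont_bump. Qed.

Lemma sign_lift_calkin_eq (e : nat) : T (signed_bump e) =K sign_lift e.
Proof. apply (hom_lincomb d M C T T_hom). auto using cont_bump. Qed.

Lemma Cnorm_signed_term_le (e i : nat) (y : pt) (z : CC) :
  Cnorm (Cmul (RC (rad i e)) (Cmul (bump i y) z)) = part_fun P i y * Cnorm z.
Proof.
  pose proof (part_fun_nonneg P_part i y). unfold bump.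
  rewrite !Cnorm_mul, Cnorm_RC, Rabs_rad, Cnorm_RC_nonneg by auto. ring.
Qed.

Lemma calkin_norm_sign_lift_le (e : nat) : calkin_norm_le (sign_lift e) (C * mult).
Proof.
  apply (calkin_norm_le_calkin_eq _ _ _ (sign_lift_calkin_eq e)).
  apply (hom_bounded T_hom); [apply cont_signed_bump|]. intros y My.
  eapply Rle_trans; [apply Cnorm_csum|]. eapply Rle_trans; [|apply (part_sum_le P_part y My)].
  apply rsum_le. intros i _. unfold fscale.
  replace (bump i y) with (Cmul (bump i y) C1) by ring.
  rewrite Cnorm_signed_term_le, Cnorm_C1. lra.
Qed.

Lemma compact_defect : is_compact defect.
Proof.
  change (bsum k (fun i => lift i [*] lift i) =K bid). rewrite <- (hom_one T_hom).
  transitivity (T (fsum k (fun i => fmul (bump i) (bump i)))).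
  - rewrite (hom_fsum d M C T T_hom) by auto using cont_mul, cont_bump.
    apply calkin_eq_bsum. intros i _. symmetry. apply (hom_mul T_hom); apply cont_bump.
  - apply (hom_ext T_hom); [auto using cont_fsum, cont_mul, cont_bump|apply cont_const|].
    intros y My. unfold fsum, fone, fmul, bump.
    rewrite (msum_ext _ _ _ _ (fun i => RC (part_fun P i y * part_fun P i y)))
      by (intros; rewrite RC_mul; auto).
    rewrite csum_RC, (part_sum_sq P_part y My). apply RC_1.
Qed.

Definition sampling_error (f : fn) (e : nat) : fn := fadd (fmul f (signed_bump e))
  (fscale (Copp C1) (fsum k (fun i => fscale (Cmul (RC (rad i e)) (f (point i))) (bump i)))).

Lemma left_error_calkin_eq (f : fn) (e : nat) : cont_on d M f ->
  T (sampling_error f e) =K left_error f e.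
Proof.
  intros f_cont. unfold sampling_error, left_error, sampled, sign_sum, bsub.
  rewrite (hom_add T_hom), (hom_mul T_hom), (hom_scale T_hom), sign_lift_calkin_eq,
    (hom_lincomb d M C T T_hom)
    by auto 6 using cont_mul, cont_scale, cont_fsum, cont_bump, cont_signed_bump.
  apply calkin_eq_of_eq. do 2 f_equal. apply msum_ext. intros i _. unfold lift. bop_ring.
Qed.

Lemma sup_le_sampling_error (f : fn) (e : nat) : In f tests ->
  sup_le M (sampling_error f e) (mult * delta).
Proof.
  intros f_in y My.
  replace (sampling_error f e y) with
    (csum k (fun i => Cmul (RC (rad i e)) (Cmul (bump i y) (Csub (f y) (f (point i)))))).
  - eapply Rle_trans; [apply Cnorm_csum|].
    apply Rle_trans with (rsum k (fun i => delta * part_fun P i y)).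
    + apply rsum_le. intros i _. rewrite Cnorm_signed_term_le, Rmult_comm.
      destruct (Req_dec (part_fun P i y) 0) as [-> |nz]; [lra|].
      apply Rmult_le_compat_r; [apply (part_fun_nonneg P_part)|].
      apply tests_osc; auto; [apply (part_point_in P_part)|apply (part_near P_part); auto].
    + rewrite rsum_scal, Rmult_comm. apply Rmult_le_compat_r; [lra|].
      apply (part_sum_le P_part y My).
  - unfold sampling_error, fadd, fmul, signed_bump, fsum, fscale.
    rewrite <- !csum_scal, <- (msum_add (add := Cadd)). apply msum_ext. intros. ring.
Qed.

Lemma calkin_norm_left_error_le (f : fn) (e : nat) : In f tests ->
  calkin_norm_le (left_error f e) (C * (mult * delta)).
Proof.
  intros f_in.
  apply (calkin_norm_le_calkin_eq _ _ _ (left_error_calkin_eq f e (tests_cont f f_in))).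
  apply (hom_bounded T_hom); [|apply sup_le_sampling_error; auto].
  apply cont_add; [auto using cont_mul, cont_signed_bump|].
  apply cont_scale, cont_fsum. auto using cont_scale, cont_bump.
Qed.

Lemma calkin_norm_right_error_le (f : fn) (e : nat) : In f tests ->
  calkin_norm_le (right_error f e) (C * (mult * delta)).
Proof.
  intros f_in. apply calkin_norm_le_calkin_eq with (left_error f e);
    [|apply calkin_norm_left_error_le; auto].
  unfold left_error, right_error.
  rewrite <- sign_lift_calkin_eq, <- !(hom_mul T_hom) by auto using cont_signed_bump.
  rewrite (hom_ext T_hom (fmul f (signed_bump e)) (fmul (signed_bump e) f));
    [reflexivity|auto using cont_mul, cont_signed_bump..|].
  intros y _. unfold fmul. ring.
Qed.

Definition lift_bound : R := C * mult + 1.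

Record tail_controlled (m : nat) : Prop := {
  sign_lift_tail_le : forall e, (e < 2 ^ k)%nat -> opnorm_le (sign_lift e [*] tail m) lift_bound;
  tail_sign_lift_le : forall e, (e < 2 ^ k)%nat -> opnorm_le (tail m [*] sign_lift e) lift_bound;
  defect_tail_le : opnorm_le (defect [*] tail m) (delta * delta);
  right_error_tail_le : forall f, In f tests -> forall e, (e < 2 ^ k)%nat ->
    opnorm_le (right_error f e [*] tail m) (lift_bound * delta);
  tail_left_error_le : forall f, In f tests -> forall e, (e < 2 ^ k)%nat ->
    opnorm_le (tail m [*] left_error f e) (lift_bound * delta) }.

Lemma eventually_tail_controlled : eventually tail_controlled.
Proof.
  assert (error_bound : lift_bound * delta = C * (mult * delta) + delta)
    by (unfold lift_bound; ring).
  assert (controlled : eventually (fun m =>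
    (forall e, (e < 2 ^ k)%nat -> opnorm_le (sign_lift e [*] tail m) lift_bound) /\
    (forall e, (e < 2 ^ k)%nat -> opnorm_le (tail m [*] sign_lift e) lift_bound) /\
    opnorm_le (defect [*] tail m) (delta * delta) /\
    (forall f, In f tests -> forall e, (e < 2 ^ k)%nat ->
      opnorm_le (right_error f e [*] tail m) (lift_bound * delta)) /\
    (forall f, In f tests -> forall e, (e < 2 ^ k)%nat ->
      opnorm_le (tail m [*] left_error f e) (lift_bound * delta)))).
  { apply filter_and; [|apply filter_and; [|apply filter_and; [|apply filter_and]]].
    - apply eventually_below. intros e _.
      apply calkin_norm_le_comp_tail; [apply calkin_norm_sign_lift_le|lra].
    - apply eventually_below. intros e _.
      apply calkin_norm_le_tail_comp; [apply calkin_norm_sign_lift_le|lra].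
    - apply compact_comp_tail; [apply compact_defect|apply Rmult_lt_0_compat; lra].
    - apply eventually_list. intros f f_in. apply eventually_below. intros e _. rewrite error_bound.
      apply calkin_norm_le_comp_tail; [apply calkin_norm_right_error_le; auto|lra].
    - apply eventually_list. intros f f_in. apply eventually_below. intros e _. rewrite error_bound.
      apply calkin_norm_le_tail_comp; [apply calkin_norm_left_error_le; auto|lra]. }
  refine (filter_imp _ _ _ controlled). intros m (? & ? & ? & ? & ?). split; auto.
Qed.

(* The summands on the slice [2 ^ k], where the model acts by scalars, correct
   [compress [*] dilate] from the sum of the squares of the lifts to the identity exactly. *)
Definition dilate : Bop := rad_encode k lift [+] RC (/ delta) [.] (embed (2 ^ k) [*] defect).
Definition compress : Bop := rad_decode k lift [-] RC delta [.] slice (2 ^ k).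

Lemma compress_dilate : compress [*] dilate = bid.
Proof.
  transitivity (rad_decode k lift [*] rad_encode k lift
    [+] RC (/ delta) [.] (rad_decode k lift [*] embed (2 ^ k) [*] defect)
    [-] RC delta [.] (slice (2 ^ k) [*] rad_encode k lift)
    [-] Cmul (RC delta) (RC (/ delta)) [.] (slice (2 ^ k) [*] embed (2 ^ k) [*] defect));
    [unfold compress, dilate; bop_ring|].
  rewrite rad_decode_rad_encode, rad_decode_embed_outside, slice_rad_encode_outside,
    slice_embed_same, <- RC_mul, Rinv_r, RC_1 by lra.
  unfold defect. bop_ring.
Qed.

Lemma lift_bound_ge1 : 0 <= mult -> 1 <= lift_bound.
Proof.
  intros. pose proof (hom_bound_nonneg T_hom). unfold lift_bound.
  assert (0 <= C * mult) by positivity. lra.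
Qed.

Lemma opnorm_le_dilate_tail (m : nat) : tail_controlled m ->
  opnorm_le (dilate [*] tail m) (lift_bound + 1).
Proof.
  intros m_tail. unfold dilate. rewrite bcomp_add_l, rad_encode_comp, bcomp_scale_l, bcomp_assoc.
  apply opnorm_le_add.
  - apply opnorm_le_rad_encode. intros e e_lt. rewrite sign_sum_comp_r.
    apply (sign_lift_tail_le m m_tail); auto.
  - apply opnorm_le_mono with (/ delta * (delta * delta)).
    + replace (/ delta * (delta * delta)) with delta by (field; lra). lra.
    + apply opnorm_le_scale_RC; [positivity|].
      apply opnorm_le_contraction_l; [apply opnorm_le_embed|apply m_tail].
Qed.

Lemma opnorm_le_tail_compress (m : nat) : tail_controlled m ->
  opnorm_le (tail m [*] compress) (lift_bound + 1).
Proof.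
  intros m_tail. unfold compress.
  replace (tail m [*] (rad_decode k lift [-] RC delta [.] slice (2 ^ k)))
    with (tail m [*] rad_decode k lift [-] RC delta [.] (tail m [*] slice (2 ^ k))) by bop_ring.
  rewrite comp_rad_decode. apply opnorm_le_sub.
  - apply opnorm_le_rad_decode. intros e e_lt. rewrite sign_sum_comp_l.
    apply (tail_sign_lift_le m m_tail); auto.
  - apply opnorm_le_mono with (delta * 1); [lra|]. apply opnorm_le_scale_RC; [lra|].
    apply opnorm_le_contraction_l; [apply opnorm_le_diag|apply opnorm_le_slice].
Qed.

Section Intertwining.
Variables (f : fn) (m : nat) (G : Bop) (b eta t : R).
Hypothesis m_tail : tail_controlled m.
Hypothesis f_in : In f tests.
Hypothesis G_le : opnorm_le G 1.
Hypothesis Tf_le : opnorm_le (T f) t.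
Hypothesis sign_lift_le : forall e, (e < 2 ^ k)%nat -> opnorm_le (sign_lift e) b.
Hypothesis commutator_le : opnorm_le (commutator G (T f)) eta.

Lemma opnorm_le_encode_intertwining : tail m [*] G = G ->
  opnorm_le
    (rad_encode k lift [*] G [*] T f [-] rad_encode k (fun i => f (point i) [.] lift i) [*] G)
    (b * eta + lift_bound * delta).
Proof.
  intros tail_G. rewrite bcomp_assoc, !rad_encode_comp, <- rad_encode_sub.
  apply opnorm_le_rad_encode. intros e e_lt.
  rewrite (sign_sum_sub k (fun i => lift i [*] (G [*] T f))
    (fun i => (f (point i) [.] lift i) [*] G)), !sign_sum_comp_r.
  fold (sign_lift e) (sampled f e).
  replace (sign_lift e [*] (G [*] T f) [-] sampled f e [*] G)
    with (sign_lift e [*] commutator G (T f) [+] right_error f e [*] G)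
    by (unfold right_error, commutator; bop_ring).
  apply opnorm_le_add; [apply opnorm_le_comp; auto|].
  rewrite <- tail_G, <- bcomp_assoc. apply opnorm_le_contraction_r; auto.
  apply (right_error_tail_le m m_tail); auto.
Qed.

Lemma opnorm_le_dilate_intertwining : tail m [*] G = G ->
  opnorm_le (dilate [*] G [*] T f [-] rad_values x0 k point f [*] (dilate [*] G))
    (b * eta + lift_bound * delta + delta * (t + Cnorm (f x0))).
Proof.
  intros tail_G. pose proof (opnorm_le_nonneg _ _ Tf_le) as t_nonneg.
  set (J := embed (2 ^ k)).
  replace (dilate [*] G [*] T f [-] rad_values x0 k point f [*] (dilate [*] G)) with
    (rad_encode k lift [*] G [*] T f [-] rad_values x0 k point f [*] rad_encode k lift [*] G
     [+] RC (/ delta) [.] (J [*] (defect [*] G) [*] T f [-]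
       rad_values x0 k point f [*] J [*] (defect [*] G))) by (unfold dilate, J; bop_ring).
  unfold J. rewrite rad_values_rad_encode, rad_values_embed_outside. fold J.
  replace (J [*] (defect [*] G) [*] T f [-] (f x0 [.] J) [*] (defect [*] G))
    with (J [*] (defect [*] G [*] T f [-] f x0 [.] (defect [*] G))) by bop_ring.
  apply opnorm_le_add; [apply opnorm_le_encode_intertwining; auto|].
  assert (defect_le : opnorm_le (defect [*] G) (delta * delta)).
  { rewrite <- tail_G, <- bcomp_assoc. apply opnorm_le_contraction_r; [apply m_tail|auto]. }
  replace (delta * (t + Cnorm (f x0)))
    with (/ delta * (delta * delta * t + Cnorm (f x0) * (delta * delta))) by (field; lra).
  apply opnorm_le_scale_RC; [positivity|].
  apply opnorm_le_contraction_l; [apply opnorm_le_embed|].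
  apply opnorm_le_sub; [apply opnorm_le_comp|apply opnorm_le_scale]; auto.
Qed.

Lemma opnorm_le_decode_intertwining : G [*] tail m = G ->
  opnorm_le
    (T f [*] (G [*] rad_decode k lift) [-] G [*] rad_decode k (fun i => f (point i) [.] lift i))
    (eta * b + lift_bound * delta).
Proof.
  intros G_tail. rewrite <- bcomp_assoc, !comp_rad_decode, <- rad_decode_sub.
  apply opnorm_le_rad_decode. intros e e_lt.
  rewrite (sign_sum_sub k (fun i => T f [*] G [*] lift i)
    (fun i => G [*] (f (point i) [.] lift i))), !sign_sum_comp_l.
  fold (sign_lift e) (sampled f e).
  replace (T f [*] G [*] sign_lift e [-] G [*] sampled f e)
    with ((Copp C1 [.] commutator G (T f)) [*] sign_lift e [+] G [*] left_error f e)
    by (unfold left_error, commutator; bop_ring).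
  apply opnorm_le_add; [apply opnorm_le_comp; auto; apply opnorm_le_opp; auto|].
  rewrite <- G_tail, bcomp_assoc. apply opnorm_le_contraction_l; auto.
  apply (tail_left_error_le m m_tail); auto.
Qed.

Lemma opnorm_le_compress_intertwining : G [*] tail m = G ->
  opnorm_le (T f [*] (G [*] compress) [-] G [*] compress [*] rad_values x0 k point f)
    (eta * b + lift_bound * delta + delta * (t + Cnorm (f x0))).
Proof.
  intros G_tail. set (S := slice (2 ^ k)).
  replace (T f [*] (G [*] compress) [-] G [*] compress [*] rad_values x0 k point f) with
    (T f [*] (G [*] rad_decode k lift) [-] G [*] (rad_decode k lift [*] rad_values x0 k point f)
     [-] RC delta [.] (T f [*] G [*] S [-] G [*] (S [*] rad_values x0 k point f)))
    by (unfold compress, S; bop_ring).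
  unfold S. rewrite rad_decode_rad_values, slice_rad_values_outside. fold S.
  replace (T f [*] G [*] S [-] G [*] (f x0 [.] S)) with ((T f [*] G [-] f x0 [.] G) [*] S)
    by bop_ring.
  apply opnorm_le_sub; [apply opnorm_le_decode_intertwining; auto|].
  apply opnorm_le_scale_RC; [lra|]. apply opnorm_le_contraction_r; [|apply opnorm_le_slice].
  apply opnorm_le_sub; [apply opnorm_le_contraction_r; auto|].
  rewrite <- (Rmult_1_r (Cnorm (f x0))). apply opnorm_le_scale. auto.
Qed.

End Intertwining.
End DilationStage.

(** * Dilation of an extension to the model representation *)

Lemma geometric_tolerances (b : nat -> R) : (forall n, 0 <= b n) ->
  exists tol : nat -> R, (forall m, 0 < tol m) /\
    forall n m, (n <= m + 1)%nat -> b n * tol m <= (/ 2) ^ n.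
Proof.
  intros b_nonneg. set (S m := 1 + rsum (m + 2) b).
  assert (S_pos : forall m, 0 < S m)
    by (intros m; pose proof (rsum_nonneg (m + 2) b (fun i _ => b_nonneg i)); unfold S; lra).
  exists (fun m => (/ 2) ^ (m + 1) / S m). split.
  - intros m. specialize (S_pos m). positivity.
  - intros n m n_le. specialize (S_pos m).
    assert (b_le : b n <= S m)
      by (pose proof (rsum_ge_term (m + 2) n b ltac:(lia) b_nonneg); unfold S; lra).
    apply Rle_trans with ((/ 2) ^ (m + 1)).
    + apply Rmult_le_reg_r with (S m); auto.
      replace (b n * ((/ 2) ^ (m + 1) / S m) * S m) with ((/ 2) ^ (m + 1) * b n) by (field; lra).
      apply Rmult_le_compat_l; [apply pow_le; lra|auto].
    + replace (m + 1)%nat with (n + (m + 1 - n))%nat by lia. rewrite pow_add.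
      rewrite <- (Rmult_1_r ((/ 2) ^ n)) at 2. apply Rmult_le_compat_l; [apply pow_le; lra|].
      rewrite <- (pow1 (m + 1 - n)). apply pow_incr. lra.
Qed.

Section Dilation.
Context {E : exponent}.
Variables (d : nat) (M : pt -> Prop) (x0 : pt) (P : nat -> partition) (mesh : nat -> R)
  (tests : nat -> list fn).
Hypothesis d_pos : (1 <= d)%nat.
Hypothesis M_compact : compact_set d M.
Hypothesis Mx0 : M x0.
Hypothesis scheme : approximation_scheme d M P mesh tests.
Variables (T : fn -> Bop) (C : R).
Hypothesis T_hom : hom_mod d M C T.

Local Notation rho := (model x0 P).
Local Notation B0 := (lift_bound (2 ^ d) C).

Lemma pow_half_range (n : nat) : 0 < (/ 2) ^ n <= 1.
Proof. split; [apply pow_lt; lra|]. rewrite <- (pow1 n). apply pow_incr. lra. Qed.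

Lemma points_in (n i : nat) : M (part_point (P n) i).
Proof. apply (part_point_in (scheme_partition scheme n)). Qed.

Section Gluing.
Variables (ms : nat -> nat) (b tol : nat -> R) (w : nat -> nat -> R).
Hypothesis ms_controlled :
  forall n, tail_controlled (P n) (2 ^ d) ((/ 2) ^ n) (tests n) T C (ms n).
Hypothesis sign_lift_le :
  forall n e, (e < 2 ^ part_size (P n))%nat -> opnorm_le (sign_lift (P n) T e) (b n).
Hypothesis tol_small : forall n m, (n <= m + 1)%nat -> b n * tol m <= (/ 2) ^ n.
Hypothesis w_cutoffs : cutoffs (fun m => map T (tests m)) tol ms w.

Definition dilation_row (n : nat) : Bop := dilate (P n) ((/ 2) ^ n) T [*] cut w n.
Definition compression_column (n : nat) : Bop := wide_cut w n [*] compress (P n) ((/ 2) ^ n) T.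
Definition dilation : Bop := column dilation_row.
Definition compression : Bop := row 2 compression_column.

Lemma B0_ge1 : 1 <= B0.
Proof. apply (lift_bound_ge1 d M _ T C T_hom), Rlt_le, pow2_pos. Qed.

Lemma dilation_row_bounded : exists B, column_bound dilation_row B.
Proof.
  pose proof B0_ge1.
  destruct (uniform_bound_of_tail (fun n r => forall x,
    norm (dilate (P n) ((/ 2) ^ n) T (cut w n x)) <= r * norm (cut w n x)) 2 (B0 + 1))
    as (B & B_nonneg & dilate_le).
  - lra.
  - intros n s t s_le dilate_le x. eapply Rle_trans; [apply dilate_le|].
    apply Rmult_le_compat_r; positivity.
  - intros n n_ge x. rewrite <- (tail_cut _ _ _ _ w_cutoffs n n_ge) at 1.
    apply (opnorm_le_dilate_tail _ _ _ _ (pow_half_range n) _ _ _ (ms_controlled n)).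
  - intros n. destruct (opnorm_le_exists (dilate (P n) ((/ 2) ^ n) T))
      as (r & r_nonneg & dilate_le).
    eauto.
  - exists B. apply column_bound_comp; auto. apply (column_bound_cut _ _ _ _ w_cutoffs).
Qed.

Lemma compression_column_bounded : exists B, forall n, opnorm_le (compression_column n) B.
Proof.
  pose proof B0_ge1.
  destruct (uniform_bound_of_tail (fun n r => opnorm_le (compression_column n) r) 2 (B0 + 1))
    as (B & B_nonneg & column_le).
  - lra.
  - intros n s t s_le. apply opnorm_le_mono. auto.
  - intros n n_ge. unfold compression_column.
    rewrite <- (wide_cut_tail _ _ _ _ w_cutoffs n n_ge), bcomp_assoc.
    apply opnorm_le_contraction_l; [apply opnorm_le_gap|].
    apply (opnorm_le_tail_compress _ _ _ _ (pow_half_range n) _ _ _ (ms_controlled n)).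
  - intros n. destruct (opnorm_le_exists (compression_column n)) as [r column_le].
    exists r. split; [apply column_le|auto].
  - eauto.
Qed.

Lemma slice_dilation (n : nat) : slice n [*] dilation = dilation_row n.
Proof. destruct dilation_row_bounded as [B rows_le]. apply (slice_column _ B). auto. Qed.

Lemma compression_embed (n : nat) : compression [*] embed n = compression_column n.
Proof.
  destruct compression_column_bounded as [B columns_le].
  apply (row_embed 2 4 _ B); [lia|apply (row_local_wide_cut _ _ _ _ w_cutoffs)|auto].
Qed.

Lemma compression_column_dilation_row (n : nat) : compression_column n [*] dilation_row n = cut w n.
Proof.
  unfold compression_column, dilation_row.
  rewrite bcomp_assoc, <- (bcomp_assoc (compress _ _ _)), (compress_dilate _ _ (pow_half_range n)),
    bcomp_id_l.
  apply (wide_cut_cut _ _ _ _ w_cutoffs).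
Qed.

Lemma compression_dilation : compression [*] dilation = bid.
Proof.
  destruct compression_column_bounded as [B columns_le]. bop_coords.
  unfold compression. rewrite (row_app 2 4 _ B);
    [|lia|apply (row_local_wide_cut _ _ _ _ w_cutoffs)|auto].
  rewrite <- (sum_cut_app _ _ _ _ w_cutoffs x t). apply msum_ext. intros n _.
  rewrite <- compression_column_dilation_row, <- (slice_dilation n). reflexivity.
Qed.

Section Intertwining.
Variables (j : nat) (f : fn) (t : R).
Hypothesis f_in : In f (tests j).
Hypothesis Tf_le : opnorm_le (T f) t.

Let f_cont : cont_on d M f := scheme_cont scheme j f f_in.

Definition intertwining_const : R := 2 + B0 + (t + Cnorm (f x0)).

Lemma intertwining_const_nonneg : 0 <= intertwining_const.
Proof.
  pose proof B0_ge1. pose proof (opnorm_le_nonneg _ _ Tf_le). pose proof (Cnorm_nonneg (f x0)).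
  unfold intertwining_const. lra.
Qed.

Lemma in_map_tests (n : nat) : (j <= n)%nat -> In (T f) (map T (tests n)).
Proof. intros j_le. apply in_map, (scheme_mono scheme j n f j_le f_in). Qed.

Lemma slice_dilation_defect (n : nat) : slice n [*] (dilation [*] T f [-] rho f [*] dilation)
  = dilation_row n [*] T f [-] model_stage x0 P n f [*] dilation_row n.
Proof.
  transitivity ((slice n [*] dilation) [*] T f [-] (slice n [*] rho f) [*] dilation); [bop_ring|].
  rewrite (slice_model d M x0 P d_pos M_compact Mx0 points_in f n f_cont).
  rewrite (bcomp_assoc (model_stage _ _ _ _)), !slice_dilation. reflexivity.
Qed.

Lemma dilation_intertwines : dilation [*] T f =K rho f [*] dilation.
Proof.
  apply (compact_of_rows _ intertwining_const intertwining_const_nonneg).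
  - intros n. rewrite slice_dilation_defect.
    apply compact_sub; [apply compact_comp_r|apply compact_comp_l]; apply compact_comp_l;
      apply (compact_gap _ _ _ _ w_cutoffs); lia.
  - exists (j + 2)%nat. intros n n_ge. rewrite slice_dilation_defect.
    eapply opnorm_le_mono; [|apply (opnorm_le_dilate_intertwining x0 (P n) (2 ^ d) ((/ 2) ^ n)
      (tests n) (pow_half_range n) T C f (ms n) (cut w n) (b n) (tol (n + 1)%nat + tol n) t); auto].
    + pose proof (tol_small n (n + 1) ltac:(lia)). pose proof (tol_small n n ltac:(lia)).
      unfold intertwining_const. lra.
    + apply (scheme_mono scheme j); auto. lia.
    + apply opnorm_le_gap.
    + apply (opnorm_le_commutator_gap _ _ _ _ w_cutoffs); [|apply in_map_tests..]; lia.
    + apply (tail_cut _ _ _ _ w_cutoffs). lia.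
Qed.

Lemma compression_defect_embed (n : nat) :
  (T f [*] compression [-] compression [*] rho f) [*] embed n
  = T f [*] compression_column n [-] compression_column n [*] model_stage x0 P n f.
Proof.
  transitivity (T f [*] (compression [*] embed n) [-] compression [*] (rho f [*] embed n));
    [bop_ring|].
  rewrite (model_embed d M x0 P d_pos M_compact Mx0 points_in f n f_cont).
  rewrite <- (bcomp_assoc compression), !compression_embed. reflexivity.
Qed.

Lemma compression_intertwines : T f [*] compression =K compression [*] rho f.
Proof.
  apply (compact_of_columns _ intertwining_const intertwining_const_nonneg).
  - intros n. rewrite compression_defect_embed.
    apply compact_sub; [apply compact_comp_l, compact_comp_r|apply compact_comp_r, compact_comp_r];
      apply (compact_gap _ _ _ _ w_cutoffs); lia.
  - exists (j + 2)%nat. intros n n_ge. rewrite compression_defect_embed.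
    eapply opnorm_le_mono; [|apply (opnorm_le_compress_intertwining x0 (P n) (2 ^ d) ((/ 2) ^ n)
      (tests n) (pow_half_range n) T C f (ms n) (wide_cut w n) (b n)
      (tol (n + 2)%nat + tol (n - 1)%nat) t); auto].
    + pose proof (tol_small n (n + 2) ltac:(lia)). pose proof (tol_small n (n - 1) ltac:(lia)).
      unfold intertwining_const. lra.
    + apply (scheme_mono scheme j); auto. lia.
    + apply opnorm_le_gap.
    + apply (opnorm_le_commutator_gap _ _ _ _ w_cutoffs); [|apply in_map_tests..]; lia.
    + apply (wide_cut_tail _ _ _ _ w_cutoffs). lia.
Qed.

End Intertwining.
End Gluing.

Lemma dilation_exists_on_tests : exists V W : Bop, W [*] V = bid /\ forall n f, In f (tests n) ->
  V [*] T f =K rho f [*] V /\ T f [*] W =K W [*] rho f.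
Proof.
  assert (controlled : forall n, exists m,
    tail_controlled (P n) (2 ^ d) ((/ 2) ^ n) (tests n) T C m).
  { intros n. destruct (eventually_tail_controlled d M (P n) (mesh n) (2 ^ d) ((/ 2) ^ n) (tests n)
      (scheme_partition scheme n) (pow_half_range n) (scheme_cont scheme n) (scheme_osc scheme n)
      T C T_hom) as [m from_m]. exists m. apply from_m. auto. }
  destruct (choice _ controlled) as [ms ms_controlled].
  assert (sign_lifts_bounded : forall n, exists b, 0 <= b /\
    forall e, In e (seq 0 (2 ^ part_size (P n))) -> opnorm_le (sign_lift (P n) T e) b).
  { intros n. apply list_common_bound.
    - intros e r s r_le. apply opnorm_le_mono. auto.
    - intros e _. destruct (opnorm_le_exists (sign_lift (P n) T e)) as [r lift_le].
      exists r. split; [apply lift_le|auto]. }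
  destruct (choice _ sign_lifts_bounded) as [b b_spec].
  destruct (geometric_tolerances b) as (tol & tol_pos & tol_small); [apply b_spec|].
  destruct (cutoffs_exist (fun m => map T (tests m)) tol ms tol_pos) as [w w_cutoffs].
  assert (sign_lift_le : forall n e, (e < 2 ^ part_size (P n))%nat ->
    opnorm_le (sign_lift (P n) T e) (b n)) by (intros n e e_lt; apply b_spec, in_seq; lia).
  exists (dilation w), (compression w). split.
  - eapply compression_dilation; eauto.
  - intros n f f_in. destruct (opnorm_le_exists (T f)) as [t Tf_le].
    split; [eapply dilation_intertwines|eapply compression_intertwines]; eauto.
Qed.

Lemma intertwines_of_tests (T1 T2 : fn -> Bop) (B1 B2 : R) (X : Bop) :
  hom_mod d M B1 T1 -> hom_mod d M B2 T2 ->
  (forall n f, In f (tests n) -> X [*] T1 f =K T2 f [*] X) ->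
  forall f, cont_on d M f -> X [*] T1 f =K T2 f [*] X.
Proof.
  intros T1_hom T2_hom tests_int f f_cont. apply compact_of_calkin_norm_le. intros eps eps_pos.
  destruct (opnorm_le_exists X) as [r X_le]. pose proof (opnorm_le_nonneg X r X_le).
  pose proof (hom_bound_nonneg T1_hom). pose proof (hom_bound_nonneg T2_hom).
  set (K := r * B1 + B2 * r + 1). assert (K_pos : 0 < K).
  { assert (0 <= r * B1) by positivity. assert (0 <= B2 * r) by positivity. unfold K. lra. }
  assert (0 < eps / K) by positivity.
  destruct (scheme_dense scheme f (eps / K) f_cont) as (n & k & u & c & u_in & g_le); [auto|].
  set (f1 := fsum k (fun i => fscale (c i) (u i))) in *.
  set (g := fadd f (fscale (Copp C1) f1)) in *.
  assert (u_cont : forall i, (i < k)%nat -> cont_on d M (u i))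
    by (intros; apply (scheme_cont scheme n); auto).
  assert (f1_cont : cont_on d M f1) by (apply cont_fsum; auto using cont_scale).
  assert (g_cont : cont_on d M g) by (apply cont_add; auto using cont_scale).
  assert (split_f : feq M f (fadd f1 g)) by (intros y _; unfold g, fadd, fscale; ring).
  assert (f1_int : X [*] T1 f1 =K T2 f1 [*] X).
  { unfold f1. rewrite (hom_lincomb d M B1 T1 T1_hom), (hom_lincomb d M B2 T2 T2_hom) by auto.
    rewrite bcomp_bsum_l, bcomp_bsum_r. apply calkin_eq_bsum. intros i i_lt.
    rewrite bcomp_scale_r, bcomp_scale_l, (tests_int n (u i)) by auto. reflexivity. }
  apply calkin_norm_le_calkin_eq with (X [*] T1 g [*] bid [+] (Copp C1 [.] bid) [*] T2 g [*] X).
  - rewrite (hom_ext T1_hom f (fadd f1 g)), (hom_ext T2_hom f (fadd f1 g)) by auto using cont_add.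
    rewrite (hom_add T1_hom), (hom_add T2_hom), bcomp_add_r, bcomp_add_l, f1_int by auto.
    apply calkin_eq_of_eq. bop_ring.
  - apply calkin_norm_le_weaken with (r * (B1 * (eps / K)) * 1 + 1 * (B2 * (eps / K)) * r).
    + apply Rle_trans with (K * (eps / K)); [unfold K at 3|right; field]; nra.
    + apply calkin_norm_le_add; apply calkin_norm_le_comp; auto using opnorm_le_id, opnorm_le_opp;
        [apply (hom_bounded T1_hom)|apply (hom_bounded T2_hom)]; auto.
Qed.

Lemma dilation_exists : exists V W : Bop, W [*] V = bid /\
  (forall f, cont_on d M f -> V [*] T f =K rho f [*] V) /\
  (forall f, cont_on d M f -> W [*] rho f =K T f [*] W).
Proof.
  destruct dilation_exists_on_tests as (V & W & WV & tests_int).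
  destruct (representation_model d M x0 P d_pos M_compact Mx0 points_in) as [K rho_rep].
  apply hom_mod_of_representation in rho_rep. exists V, W. split; [auto|split].
  - apply (intertwines_of_tests T rho C K V); auto. intros n f f_in. apply (tests_int n f f_in).
  - apply (intertwines_of_tests rho T K C W); auto. intros n f f_in. symmetry.
    apply (tests_int n f f_in).
Qed.

End Dilation.

(** * Equivalence of homomorphisms modulo the compacts *)

Section Similarity.
Context {E : exponent}.
Variables (d : nat) (M : pt -> Prop).
Local Notation cont := (cont_on d M).

Definition similar_mod (T1 T2 : fn -> Bop) : Prop := exists S S' : Bop,
  S [*] S' = bid /\ S' [*] S = bid /\ forall f, cont f -> T2 f =K S [*] (T1 f [*] S').

Lemma similar_mod_of_calkin_eq (T1 T2 : fn -> Bop) :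
  (forall f, cont f -> T1 f =K T2 f) -> similar_mod T1 T2.
Proof.
  intros T12. exists bid, bid. split; [bop_ring|split; [bop_ring|]]. intros f f_cont.
  rewrite (T12 f f_cont). apply calkin_eq_of_eq. bop_ring.
Qed.

#[export] Instance similar_mod_equiv : Equivalence similar_mod.
Proof.
  split.
  - intros T. apply similar_mod_of_calkin_eq. reflexivity.
  - intros T1 T2 (S & S' & SS' & S'S & T12). exists S', S. split; [auto|split; [auto|]].
    intros f f_cont. rewrite (T12 f f_cont). apply calkin_eq_of_eq.
    transitivity ((S' [*] S) [*] (T1 f [*] (S' [*] S))); [rewrite S'S|]; bop_ring.
  - intros T1 T2 T3 (S & S' & SS' & S'S & T12) (R & R' & RR' & R'R & T23).
    exists (R [*] S), (S' [*] R'). split; [|split].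
    + transitivity (R [*] (S [*] S') [*] R'); [bop_ring|]. rewrite SS', bcomp_id_r. auto.
    + transitivity (S' [*] (R' [*] R) [*] S); [bop_ring|]. rewrite R'R, bcomp_id_r. auto.
    + intros f f_cont. rewrite (T23 f f_cont), (T12 f f_cont). apply calkin_eq_of_eq. bop_ring.
Qed.

#[export] Instance hom_dsum_similar_mod :
  Proper (similar_mod ==> similar_mod ==> similar_mod) hom_dsum.
Proof.
  intros T1 T1' (S & S' & SS' & S'S & T11') T2 T2' (R & R' & RR' & R'R & T22').
  exists (dsum S R), (dsum S' R'). split; [|split].
  - rewrite dsum_mul, SS', RR'. apply dsum_id.
  - rewrite dsum_mul, S'S, R'R. apply dsum_id.
  - intros f f_cont. unfold hom_dsum.
    rewrite !dsum_mul, (T11' f f_cont), (T22' f f_cont). reflexivity.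
Qed.

Lemma hom_dsum_comm (T1 T2 : fn -> Bop) : similar_mod (hom_dsum T1 T2) (hom_dsum T2 T1).
Proof.
  set (flip := mat bzero bid bid bzero).
  assert (flip_flip : flip [*] flip = bid).
  { transitivity (mat bid bzero bzero bid); [unfold flip; mat_ring|apply mat_id]. }
  exists flip, flip. split; [auto|split; [auto|]].
  intros f _. apply calkin_eq_of_eq. unfold hom_dsum, flip. mat_ring.
Qed.

Lemma hom_dsum_assoc (T1 T2 T3 : fn -> Bop) :
  similar_mod (hom_dsum (hom_dsum T1 T2) T3) (hom_dsum T1 (hom_dsum T2 T3)).
Proof.
  exists (even_incl [*] (even_part [*] even_part)
    [+] odd_incl [*] (even_incl [*] (odd_part [*] even_part))
    [+] odd_incl [*] (odd_incl [*] odd_part)).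
  exists (even_incl [*] (even_incl [*] even_part)
    [+] even_incl [*] (odd_incl [*] (even_part [*] odd_part))
    [+] odd_incl [*] (odd_part [*] odd_part)).
  split; [|split].
  - apply Bop_even_odd_ext; [mat_ring|]. apply Bop_even_odd_ext; mat_ring.
  - apply Bop_even_odd_ext; [|mat_ring]. apply Bop_even_odd_ext; mat_ring.
  - intros f _. apply calkin_eq_of_eq. unfold hom_dsum. mat_ring.
Qed.

Lemma hom_dsum_interchange (T1 T2 T3 T4 : fn -> Bop) :
  similar_mod (hom_dsum (hom_dsum T1 T2) (hom_dsum T3 T4))
    (hom_dsum (hom_dsum T1 T3) (hom_dsum T2 T4)).
Proof.
  rewrite (hom_dsum_assoc T1 T2), <- (hom_dsum_assoc T2 T3), (hom_dsum_comm T2 T3).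
  rewrite (hom_dsum_assoc T3 T2), <- (hom_dsum_assoc T1 T3). reflexivity.
Qed.

Lemma absorbs_of_idempotent (T A B : fn -> Bop) :
  similar_mod A (hom_dsum A A) -> similar_mod T (hom_dsum A B) -> similar_mod T (hom_dsum A T).
Proof.
  intros A_idem T_split. transitivity (hom_dsum (hom_dsum A A) B); [rewrite <- A_idem; auto|].
  rewrite hom_dsum_assoc, <- T_split. reflexivity.
Qed.

(* Both are equivalent to the sum of the two. *)
Lemma idempotent_absorbing_unique (A B : fn -> Bop) :
  similar_mod A (hom_dsum A A) -> similar_mod B (hom_dsum B B) ->
  (exists T, similar_mod A (hom_dsum B T)) -> (exists T, similar_mod B (hom_dsum A T)) ->
  similar_mod A B.
Proof.
  intros A_idem B_idem [T A_split] [T' B_split].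
  rewrite (absorbs_of_idempotent A B T B_idem A_split), hom_dsum_comm.
  symmetry. exact (absorbs_of_idempotent B A T' A_idem B_split).
Qed.

End Similarity.

(** * The universal extension *)

Section CommutantDouble.
Context {E : exponent}.
Variables (d : nat) (M : pt -> Prop) (T : fn -> Bop) (D : Bop -> Bop).
Hypothesis D_add : forall A B, D (A [+] B) = D A [+] D B.
Hypothesis D_mul : forall A B, D (A [*] B) = D A [*] D B.
Hypothesis D_id : D bid = bid.
Hypothesis D_comm : forall f A, cont_on d M f -> T f [*] D A = D A [*] T f.

Let D_zero : D bzero = bzero.
Proof.
  transitivity (D bzero [+] D bzero [-] D bzero); [bop_ring|].
  rewrite <- D_add, badd_zero_r. bop_ring.
Qed.

(* The image of [D] contains two isometries with complementary ranges, and they commute with [T]. *)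
Lemma similar_mod_double_of_commutant : similar_mod d M T (hom_dsum T T).
Proof.
  assert (ee : even_part [*] even_incl = bid) by mat_ring.
  assert (eo : even_part [*] odd_incl = bzero) by mat_ring.
  assert (oe : odd_part [*] even_incl = bzero) by mat_ring.
  assert (oo : odd_part [*] odd_incl = bid) by mat_ring.
  set (S := even_incl [*] D even_part [+] odd_incl [*] D odd_part).
  set (S' := D even_incl [*] even_part [+] D odd_incl [*] odd_part).
  assert (conj : forall X, (forall A B, D A [*] X [*] D B = X [*] D (A [*] B)) ->
    S [*] X [*] S' = dsum X X).
  { intros X X_comm.
    transitivity (even_incl [*] (D even_part [*] X [*] D even_incl) [*] even_part
      [+] even_incl [*] (D even_part [*] X [*] D odd_incl) [*] odd_part
      [+] (odd_incl [*] (D odd_part [*] X [*] D even_incl) [*] even_part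
      [+] odd_incl [*] (D odd_part [*] X [*] D odd_incl) [*] odd_part)); [unfold S, S'; bop_ring|].
    rewrite !X_comm, ee, eo, oe, oo, D_id, D_zero. mat_ring. }
  exists S, S'. split; [|split].
  - rewrite <- (bcomp_id_r S), conj; [apply dsum_id|].
    intros A B. rewrite bcomp_id_r, bcomp_id_l, D_mul. reflexivity.
  - transitivity (D even_incl [*] (even_part [*] even_incl) [*] D even_part
      [+] D even_incl [*] (even_part [*] odd_incl) [*] D odd_part
      [+] (D odd_incl [*] (odd_part [*] even_incl) [*] D even_part
      [+] D odd_incl [*] (odd_part [*] odd_incl) [*] D odd_part)); [unfold S, S'; bop_ring|].
    rewrite ee, eo, oe, oo.
    transitivity (D even_incl [*] D even_part [+] D odd_incl [*] D odd_part); [bop_ring|].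
    rewrite <- !D_mul, <- D_add, even_incl_add_odd_incl. apply D_id.
  - intros f f_cont. apply calkin_eq_of_eq. unfold hom_dsum. rewrite <- bcomp_assoc, conj; auto.
    intros A B. rewrite <- D_comm, bcomp_assoc, D_mul by auto. reflexivity.
Qed.

End CommutantDouble.

Section Amplification.
Context {E : exponent}.

Definition ampl (A : Bop) : Bop := block_diag (fun _ => A).

Lemma slice_ampl (n : nat) (A : Bop) : slice n [*] ampl A = A [*] slice n.
Proof.
  destruct (opnorm_le_exists A) as [r A_le].
  exact (slice_block_diag (fun _ => A) r (fun _ => A_le) n).
Qed.

Lemma ampl_embed (n : nat) (A : Bop) : ampl A [*] embed n = embed n [*] A.
Proof.
  destruct (opnorm_le_exists A) as [r A_le].
  exact (block_diag_embed (fun _ => A) r (fun _ => A_le) n).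
Qed.

Lemma ampl_mul (A B : Bop) : ampl (A [*] B) = ampl A [*] ampl B.
Proof.
  apply Bop_slice_ext. intros n.
  rewrite <- bcomp_assoc, !slice_ampl, !bcomp_assoc, slice_ampl. reflexivity.
Qed.

Lemma ampl_add (A B : Bop) : ampl (A [+] B) = ampl A [+] ampl B.
Proof.
  apply Bop_slice_ext. intros n. rewrite bcomp_add_r, !slice_ampl, bcomp_add_l. reflexivity.
Qed.

Lemma ampl_id : ampl bid = bid.
Proof. apply Bop_slice_ext. intros n. rewrite slice_ampl, bcomp_id_l, bcomp_id_r. reflexivity. Qed.

Lemma rad_pair_ampl (k i : nat) (A : Bop) : rad_pair k i [*] ampl A = A [*] rad_pair k i.
Proof.
  unfold rad_pair. rewrite bcomp_bsum_l, bcomp_bsum_r. apply msum_ext. intros e _.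
  rewrite bcomp_scale_l, bcomp_scale_r, slice_ampl. reflexivity.
Qed.

Lemma ampl_rad_tensor (k i : nat) (A : Bop) : ampl A [*] rad_tensor k i = rad_tensor k i [*] A.
Proof.
  unfold rad_tensor. rewrite bcomp_bsum_l, bcomp_bsum_r. apply msum_ext. intros e _.
  rewrite bcomp_scale_l, bcomp_scale_r, ampl_embed. reflexivity.
Qed.

Lemma rad_values_ampl (x0 : pt) (k : nat) (x : nat -> pt) (f : fn) (A : Bop) :
  rad_values x0 k x f [*] ampl A = ampl A [*] rad_values x0 k x f.
Proof.
  unfold rad_values, rad_mult, rad_encode.
  rewrite bcomp_add_l, bcomp_add_r, bcomp_bsum_l, bcomp_bsum_r. f_equal; [bop_ring|].
  apply msum_ext. intros i _.
  rewrite bcomp_assoc, bcomp_scale_l, rad_pair_ampl, <- bcomp_assoc, ampl_rad_tensor. bop_ring.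
Qed.

End Amplification.

Section Complement.
Context {E : exponent}.
Variables (d : nat) (M : pt -> Prop) (x0 : pt) (K : R) (rho T : fn -> Bop) (V W : Bop).
Hypothesis Mx0 : M x0.
Hypothesis rho_hom : hom_mod d M K rho.
Hypothesis WV : W [*] V = bid.
Hypothesis V_int : forall f, cont_on d M f -> V [*] T f =K rho f [*] V.
Hypothesis W_int : forall f, cont_on d M f -> W [*] rho f =K T f [*] W.

Definition coproj : Bop := bid [-] V [*] W.
Definition complement (f : fn) : Bop := f x0 [.] (V [*] W) [+] coproj [*] rho f [*] coproj.

Lemma W_coproj : W [*] coproj = bzero.
Proof. transitivity (W [-] (W [*] V) [*] W); [unfold coproj|rewrite WV]; bop_ring. Qed.

Lemma coproj_V : coproj [*] V = bzero.
Proof. transitivity (V [-] V [*] (W [*] V)); [unfold coproj|rewrite WV]; bop_ring. Qed.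

Lemma coproj_coproj : coproj [*] coproj = coproj.
Proof.
  transitivity (coproj [-] V [*] (W [*] coproj)); [unfold coproj at 1|rewrite W_coproj]; bop_ring.
Qed.

Lemma coproj_comm (f : fn) : cont_on d M f -> coproj [*] rho f =K rho f [*] coproj.
Proof.
  intros f_cont.
  transitivity (rho f [-] V [*] (W [*] rho f)); [apply calkin_eq_of_eq; unfold coproj; bop_ring|].
  rewrite (W_int f f_cont), <- bcomp_assoc, (V_int f f_cont). apply calkin_eq_of_eq.
  unfold coproj. bop_ring.
Qed.

Definition exchange : Bop := mat bzero W V coproj.

Lemma exchange_exchange : exchange [*] exchange = bid.
Proof.
  assert (sum : V [*] W [+] coproj = bid) by (unfold coproj; bop_ring).
  unfold exchange. rewrite mat_mul, W_coproj, coproj_V, coproj_coproj, WV, sum.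
  transitivity (mat bid bzero bzero bid); [f_equal; bop_ring|apply mat_id].
Qed.

Lemma point_dsum_split :
  similar_mod d M (hom_dsum (fun f => f x0 [.] bid) rho) (hom_dsum T complement).
Proof.
  exists exchange, exchange. split; [|split]; [apply exchange_exchange..|]. intros f f_cont.
  unfold hom_dsum, exchange, dsum. rewrite !mat_mul. apply mat_calkin_eq.
  - transitivity (W [*] (rho f [*] V)); [|apply calkin_eq_of_eq; bop_ring].
    rewrite <- (V_int f f_cont), <- bcomp_assoc, WV, bcomp_id_l. reflexivity.
  - transitivity (W [*] (rho f [*] coproj)); [|apply calkin_eq_of_eq; bop_ring].
    rewrite <- (coproj_comm f f_cont), <- bcomp_assoc, W_coproj. apply calkin_eq_of_eq. bop_ring.
  - transitivity (coproj [*] rho f [*] V); [|apply calkin_eq_of_eq; bop_ring].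
    rewrite (coproj_comm f f_cont), bcomp_assoc, coproj_V. apply calkin_eq_of_eq. bop_ring.
  - apply calkin_eq_of_eq. unfold complement. bop_ring.
Qed.

Lemma complement_mul (f g : fn) : cont_on d M f -> cont_on d M g ->
  complement (fmul f g) =K complement f [*] complement g.
Proof.
  intros f_cont g_cont. unfold complement. rewrite (hom_mul rho_hom) by auto.
  transitivity (Cmul (f x0) (g x0) [.] (V [*] (W [*] V) [*] W)
    [+] f x0 [.] (V [*] (W [*] coproj) [*] rho g [*] coproj)
    [+] g x0 [.] (coproj [*] rho f [*] (coproj [*] V) [*] W)
    [+] coproj [*] rho f [*] (coproj [*] coproj) [*] rho g [*] coproj);
    [|apply calkin_eq_of_eq; bop_ring].
  rewrite WV, W_coproj, coproj_V, coproj_coproj.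
  rewrite (bcomp_assoc (coproj [*] rho f) coproj (rho g)), (coproj_comm g g_cont).
  transitivity (Cmul (f x0) (g x0) [.] (V [*] W)
    [+] coproj [*] rho f [*] rho g [*] (coproj [*] coproj)); [|apply calkin_eq_of_eq; bop_ring].
  rewrite coproj_coproj. apply calkin_eq_of_eq. unfold fmul. bop_ring.
Qed.

Lemma complement_hom_mod : exists C, hom_mod d M C complement.
Proof.
  destruct (opnorm_le_exists (V [*] W)) as [q VW_le].
  destruct (opnorm_le_exists coproj) as [r coproj_le].
  pose proof (opnorm_le_nonneg _ q VW_le). pose proof (opnorm_le_nonneg _ r coproj_le).
  pose proof (hom_bound_nonneg rho_hom).
  exists (q + r * K * r). unfold complement. split.
  - positivity.
  - intros f g f_cont g_cont fg. rewrite (fg x0 Mx0), (hom_ext rho_hom f g) by auto. reflexivity.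
  - intros f g f_cont g_cont. rewrite (hom_add rho_hom) by auto. apply calkin_eq_of_eq.
    unfold fadd. bop_ring.
  - intros c f f_cont. rewrite (hom_scale rho_hom) by auto. apply calkin_eq_of_eq.
    unfold fscale. bop_ring.
  - exact complement_mul.
  - rewrite (hom_one rho_hom), bcomp_id_r, coproj_coproj. apply calkin_eq_of_eq.
    unfold fone, coproj. bop_ring.
  - intros f s f_cont f_le.
    replace ((q + r * K * r) * s) with (s * q + r * (K * s) * r) by ring. apply calkin_norm_le_add.
    + apply calkin_norm_le_of_opnorm_le, opnorm_le_mono with (Cnorm (f x0) * q).
      * apply Rmult_le_compat_r; auto.
      * apply opnorm_le_scale. auto.
    + apply calkin_norm_le_comp; auto. apply (hom_bounded rho_hom); auto.
Qed.

End Complement.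

Definition calkin_bounded_below {E : exponent} (d : nat) (M : pt -> Prop) (T : fn -> Bop) : Prop :=
  forall f s, cont_on d M f -> calkin_norm_le (T f) s -> sup_le M f s.

Lemma calkin_bounded_below_dsum {E : exponent} (d : nat) (M : pt -> Prop) (T1 T2 : fn -> Bop) :
  calkin_bounded_below d M T2 -> calkin_bounded_below d M (hom_dsum T1 T2).
Proof.
  intros T2_below f s f_cont dsum_le. apply T2_below; auto.
  rewrite <- (dsum_corner (T1 f) (T2 f)). replace s with (1 * s * 1) by ring.
  apply calkin_norm_le_comp; auto using opnorm_le_odd_part, opnorm_le_odd_incl.
Qed.

Section Universal.
Context {E : exponent}.
Variables (d : nat) (M : pt -> Prop) (x0 : pt) (P : nat -> partition) (mesh : nat -> R)
  (tests : nat -> list fn).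
Hypothesis d_pos : (1 <= d)%nat.
Hypothesis M_compact : compact_set d M.
Hypothesis Mx0 : M x0.
Hypothesis scheme : approximation_scheme d M P mesh tests.

Local Notation rho := (model x0 P).

Definition universal : fn -> Bop := hom_dsum (fun f => f x0 [.] bid) rho.

Lemma representation_universal : exists C, representation d M C universal.
Proof.
  destruct (representation_model d M x0 P d_pos M_compact Mx0 (points_in d M P mesh tests scheme))
    as [K rho_rep].
  exists (1 + K). apply (homomorphism_dsum d M (eqv := eq));
    auto using opnorm_le_dsum, representation_point.
Qed.

Lemma model_bounded_below : calkin_bounded_below d M rho.
Proof.
  intros f s f_cont rho_le y My. apply le_epsilon. intros eps eps_pos.
  destruct (cont_uniform d d_pos M M_compact f eps f_cont eps_pos) as (r & r_pos & f_osc).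
  destruct (pow_half_small 1 r r_pos) as [n half_small].
  specialize (half_small n (le_n n)). rewrite Rmult_1_l in half_small.
  pose proof (scheme_partition scheme n) as P_part.
  destruct (part_fun_nonzero d M _ _ (P n) y P_part My) as (i & i_lt & nz).
  pose proof (Cnorm_point_le_calkin_norm_model d M x0 P d_pos M_compact Mx0
    (points_in d M P mesh tests scheme) f s n i f_cont i_lt rho_le).
  assert (Cnorm (Csub (f y) (f (part_point (P n) i))) <= eps).
  { apply f_osc; auto; [apply (part_point_in P_part)|].
    apply near_weaken with (mesh n); [|apply (part_near P_part); auto].
    pose proof (scheme_mesh scheme n). lra. }
  replace (f y) with (Cadd (f (part_point (P n) i)) (Csub (f y) (f (part_point (P n) i)))) by ring.
  eapply Rle_trans; [apply Cnorm_add|]. lra.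
Qed.

Lemma universal_bounded_below : calkin_bounded_below d M universal.
Proof. apply calkin_bounded_below_dsum, model_bounded_below. Qed.

Lemma model_ampl (f : fn) (A : Bop) : cont_on d M f ->
  rho f [*] ampl (ampl A) = ampl (ampl A) [*] rho f.
Proof.
  intros f_cont. apply Bop_slice_ext. intros n.
  pose proof (slice_model d M x0 P d_pos M_compact Mx0 (points_in d M P mesh tests scheme)
    f n f_cont) as slice_rho.
  rewrite <- !bcomp_assoc, slice_rho, slice_ampl, !bcomp_assoc, slice_ampl, slice_rho,
    <- !bcomp_assoc.
  unfold model_stage. rewrite rad_values_ampl. reflexivity.
Qed.

Lemma universal_double : similar_mod d M universal (hom_dsum universal universal).
Proof.
  unfold universal. rewrite <- hom_dsum_interchange. apply hom_dsum_similar_mod.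
  - apply similar_mod_of_calkin_eq. intros f _. unfold hom_dsum. rewrite dsum_scale, dsum_id.
    reflexivity.
  - apply (similar_mod_double_of_commutant d M rho (fun A => ampl (ampl A))).
    + intros. rewrite !ampl_add. reflexivity.
    + intros. rewrite !ampl_mul. reflexivity.
    + rewrite !ampl_id. reflexivity.
    + intros. apply model_ampl. auto.
Qed.

Lemma universal_absorbs (C : R) (T : fn -> Bop) : hom_mod d M C T ->
  exists (C' : R) (T' : fn -> Bop), hom_mod d M C' T' /\ calkin_bounded_below d M T' /\
    similar_mod d M universal (hom_dsum T T').
Proof.
  intros T_hom.
  destruct (dilation_exists d M x0 P mesh tests d_pos M_compact Mx0 scheme T C T_hom)
    as (V & W & WV & V_int & W_int).
  destruct (representation_model d M x0 P d_pos M_compact Mx0 (points_in d M P mesh tests scheme))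
    as [K rho_hom]. apply hom_mod_of_representation in rho_hom.
  destruct (complement_hom_mod d M x0 K rho T V W Mx0 rho_hom WV V_int W_int) as [B complement_hom].
  destruct representation_universal as [B' universal_hom].
  apply hom_mod_of_representation in universal_hom.
  exists (B + B'), (hom_dsum (complement x0 rho V W) universal). split; [|split].
  - apply (homomorphism_dsum d M (eqv := calkin_eq)); auto using calkin_norm_le_dsum.
  - apply calkin_bounded_below_dsum, universal_bounded_below.
  - rewrite universal_double at 1. rewrite <- hom_dsum_assoc.
    apply hom_dsum_similar_mod; [|reflexivity].
    apply (point_dsum_split d M x0 rho T V W WV V_int W_int).
Qed.

End Universal.

Lemma absorbing_homomorphism_exists {E : exponent} (d : nat) (M : pt -> Prop) :
  (1 <= d)%nat -> compact_set d M -> (exists x, M x) ->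
  exists U : fn -> Bop, (exists C, representation d M C U) /\ calkin_bounded_below d M U /\
    similar_mod d M U (hom_dsum U U) /\
    forall C T, hom_mod d M C T -> exists C' T', hom_mod d M C' T' /\
      calkin_bounded_below d M T' /\ similar_mod d M U (hom_dsum T T').
Proof.
  intros d_pos M_compact [x0 Mx0].
  destruct (approximation_scheme_exists d M d_pos M_compact (ex_intro _ x0 Mx0))
    as (P & mesh & tests & scheme).
  exists (universal x0 P). split; [|split; [|split]].
  - eapply representation_universal; eauto.
  - eapply universal_bounded_below; eauto.
  - eapply universal_double; eauto.
  - intros C T. eapply universal_absorbs; eauto.
Qed.

(** * Operators on sequences and bounded operators on l^p *)

Section Transfer.
Context {E : exponent}.
Notation p := pexp.

(* Zero, when [x] is not in l^p. *)
Definition ellp_of (x : vec) : ellp :=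
  match excluded_middle_informative (lp p x) with
  | left x_lp => exist _ x x_lp
  | right _ => lzero
  end.

Lemma coord_ellp_of (x : vec) : lp p x -> coord (ellp_of x) = x.
Proof.
  intros x_lp. unfold ellp_of. destruct excluded_middle_informative; [reflexivity|contradiction].
Qed.

Lemma ellp_of_coord (x : ellp) : ellp_of x = x.
Proof. apply ellp_ext. intros n. rewrite coord_ellp_of by exact (proj2_sig x). reflexivity. Qed.

Lemma lp_of_vsub (x : ellp) (y : vec) : lp p (vsub x y) -> lp p y.
Proof.
  intros diff_lp. replace y with (coord (lsub x (ellp_of (vsub x y)))); [exact (proj2_sig _)|].
  apply functional_extensionality. intros n. push_coord. rewrite coord_ellp_of by auto.
  unfold vsub. ring.
Qed.

Lemma coord_sub (x y : ellp) : coord (lsub x y) = vsub x y.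
Proof. apply functional_extensionality. intros n. unfold vsub. push_coord. ring. Qed.

Definition represents (T : op) (A : Bop) : Prop := forall x : ellp, T x = coord (A x).

Definition op_of_Bop (A : Bop) : op := fun x => A (ellp_of x).

Definition Bop_of_op (T : op) : Bop := Bop_of (fun x => T x).

Lemma represents_op_of_Bop (A : Bop) : represents (op_of_Bop A) A.
Proof. intros x. unfold op_of_Bop. rewrite ellp_of_coord. reflexivity. Qed.

Lemma represents_add (T S : op) (A B : Bop) :
  represents T A -> represents S B -> represents (op_add T S) (A [+] B).
Proof. intros TA SB x. unfold op_add. rewrite TA, SB. reflexivity. Qed.

Lemma represents_sub (T S : op) (A B : Bop) :
  represents T A -> represents S B -> represents (op_sub T S) (A [-] B).
Proof. intros TA SB x. unfold op_sub. rewrite TA, SB. symmetry. apply coord_sub. Qed.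

Lemma represents_scale (c : CC) (T : op) (A : Bop) :
  represents T A -> represents (op_scale c T) (c [.] A).
Proof. intros TA x. unfold op_scale. rewrite TA. reflexivity. Qed.

Lemma represents_comp (T S : op) (A B : Bop) :
  represents T A -> represents S B -> represents (op_comp T S) (A [*] B).
Proof. intros TA SB x. unfold op_comp. rewrite SB, TA. reflexivity. Qed.

Lemma represents_id : represents op_id bid.
Proof. intros x. reflexivity. Qed.

Lemma represents_interleave (T S : op) (A B : Bop) : represents T A -> represents S B ->
  represents (fun x => interleave (T (evens x)) (S (odds x))) (dsum A B).
Proof.
  intros TA SB x. apply functional_extensionality. intros n.
  assert (evens_x : evens x = coord (even_part x))
    by (apply functional_extensionality; intros m; symmetry; apply even_part_app).
  assert (odds_x : odds x = coord (odd_part x))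
    by (apply functional_extensionality; intros m; symmetry; apply odd_part_app).
  rewrite evens_x, odds_x, TA, SB. unfold dsum, mat, interleave. unfold_bop. push_coord.
  rewrite even_incl_app, odd_incl_app. destruct (Nat.even n); push_coord; ring.
Qed.

Lemma op_bound_nonneg (T : op) (r : R) : op_bound p T r -> 0 <= r.
Proof.
  intros T_bound. destruct (T_bound (coord lzero) 1) as [r_nonneg _]; [|lra].
  apply norm_le_iff. rewrite norm_zero. lra.
Qed.

Lemma op_bound_iff (T : op) (A : Bop) (r : R) : represents T A ->
  (op_bound p T r <-> opnorm_le A r).
Proof.
  intros TA. split.
  - intros T_bound. split; [apply (op_bound_nonneg T); auto|]. intros x. apply norm_le_iff.
    rewrite <- TA. apply T_bound, lp_norm_le_norm.
  - intros [r_nonneg A_le] x s x_le.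
    rewrite <- (coord_ellp_of x) in x_le |- * by (exists s; auto).
    apply norm_le_iff in x_le. rewrite TA. apply norm_le_iff. eapply Rle_trans; [apply A_le|].
    apply Rmult_le_compat_l; auto.
Qed.

Lemma bdd_of_represents (T : op) (A : Bop) : represents T A -> bdd p T.
Proof.
  intros TA. split; [|split].
  - intros x y x_lp y_lp n. rewrite <- (coord_ellp_of x), <- (coord_ellp_of y) by auto.
    change (vadd (ellp_of x) (ellp_of y)) with (coord (ladd (ellp_of x) (ellp_of y))).
    rewrite !TA, bapp_add. reflexivity.
  - intros c x x_lp n. rewrite <- (coord_ellp_of x) by auto.
    change (vscale c (ellp_of x)) with (coord (lscale c (ellp_of x))).
    rewrite !TA, bapp_scale. reflexivity.
  - destruct (opnorm_le_exists A) as [r A_le]. exists r. apply (op_bound_iff T A); auto.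
Qed.

Lemma represents_Bop_of_op (T : op) : bdd p T -> represents T (Bop_of_op T).
Proof.
  intros (T_add & T_scale & r & T_bound) x. apply functional_extensionality. intros n.
  unfold Bop_of_op. rewrite (Bop_of_app _ r); [reflexivity|]. split; [|split; [|split]].
  - intros u v m. exact (T_add u v (proj2_sig u) (proj2_sig v) m).
  - intros c u m. exact (T_scale c u (proj2_sig u) m).
  - apply (op_bound_nonneg T). auto.
  - intros u. apply T_bound, lp_norm_le_norm.
Qed.

Lemma op_eq_iff (T S : op) (A B : Bop) :
  represents T A -> represents S B -> (op_eq p T S <-> A = B).
Proof.
  intros TA SB. split.
  - intros TS. apply Bop_ext. intros x. apply ellp_ext. intros n. rewrite <- TA, <- SB.
    exact (TS x (proj2_sig x) n).
  - intros -> x x_lp n. rewrite <- (coord_ellp_of x), TA, SB by auto. reflexivity.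
Qed.

Lemma compact_op_iff (T : op) (A : Bop) : represents T A -> (compact_op p T <-> is_compact A).
Proof.
  intros TA. split.
  - intros [_ T_cpt] eps eps_pos. destruct (T_cpt eps eps_pos) as [ys net].
    exists (map ellp_of ys). intros x x_le.
    destruct (net x) as (y & y_in & y_near); [apply norm_le_iff; auto|].
    exists (ellp_of y). split; [apply in_map; auto|].
    apply norm_le_iff. rewrite TA in y_near. rewrite coord_sub, coord_ellp_of; auto.
    apply (lp_of_vsub (A x)). exists eps. auto.
  - intros A_cpt. split; [eapply bdd_of_represents; eauto|]. intros eps eps_pos.
    destruct (A_cpt eps eps_pos) as [ys net]. exists (map coord ys). intros x x_le.
    rewrite <- (coord_ellp_of x) in x_le |- * by (exists 1; auto).
    destruct (net (ellp_of x)) as (y & y_in & y_near); [apply norm_le_iff; auto|].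
    exists (coord y). split; [apply in_map; auto|].
    rewrite TA, <- coord_sub. apply norm_le_iff. auto.
Qed.

Lemma calk_eq_iff (T S : op) (A B : Bop) :
  represents T A -> represents S B -> (calk_eq p T S <-> A =K B).
Proof. intros. apply compact_op_iff, represents_sub; auto. Qed.

Lemma calk_norm_le_iff (T : op) (A : Bop) (r : R) :
  represents T A -> (calk_norm_le p T r <-> calkin_norm_le A r).
Proof.
  intros TA. split; intros norm_le eps eps_pos;
    destruct (norm_le eps eps_pos) as (K & K_cpt & TK_le).
  - assert (KK : represents K (Bop_of_op K)) by (apply represents_Bop_of_op, K_cpt).
    exists (Bop_of_op K). split; [apply (compact_op_iff K); auto|].
    apply (op_bound_iff (op_add T K)); auto using represents_add.
  - pose proof (represents_op_of_Bop K) as KK.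
    exists (op_of_Bop K). split; [apply (compact_op_iff _ K); auto|].
    apply (op_bound_iff _ (A [+] K)); auto using represents_add.
Qed.

Variables (d : nat) (M : pt -> Prop).

(* Both [is_ext] and [is_iso_into_B] are instances. *)
Definition isomorphic_hom (eqv : op -> op -> Prop) (bound : op -> R -> Prop)
  (Phi : fn -> op) : Prop :=
  (forall f, cont_on d M f -> bdd p (Phi f)) /\
  (forall f g, cont_on d M f -> cont_on d M g -> feq M f g -> eqv (Phi f) (Phi g)) /\
  (forall f g, cont_on d M f -> cont_on d M g -> eqv (Phi (fadd f g)) (op_add (Phi f) (Phi g))) /\
  (forall c f, cont_on d M f -> eqv (Phi (fscale c f)) (op_scale c (Phi f))) /\
  (forall f g, cont_on d M f -> cont_on d M g -> eqv (Phi (fmul f g)) (op_comp (Phi f) (Phi g))) /\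
  eqv (Phi fone) op_id /\
  exists C, 1 <= C /\ forall f, cont_on d M f ->
    (forall s, bound (Phi f) s -> sup_le M f (C * s)) /\
    (forall s, sup_le M f s -> bound (Phi f) (C * s)).

Definition lifts (Phi : fn -> op) (T : fn -> Bop) : Prop :=
  forall f, cont_on d M f -> represents (Phi f) (T f).

Definition ext_of (T : fn -> Bop) : fn -> op := fun f => op_of_Bop (T f).

Lemma lifts_ext_of (T : fn -> Bop) : lifts (ext_of T) T.
Proof. intros f _. apply represents_op_of_Bop. Qed.

Lemma lifts_sum_ext (Phi Psi : fn -> op) (T S : fn -> Bop) :
  lifts Phi T -> lifts Psi S -> lifts (sum_ext Phi Psi) (hom_dsum T S).
Proof. intros PhiT PsiS f f_cont. apply represents_interleave; auto. Qed.

Lemma isomorphic_hom_ext_of (eqv : Bop -> Bop -> Prop) (bound : Bop -> R -> Prop)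
  (raw_eqv : op -> op -> Prop) (raw_bound : op -> R -> Prop) (C : R) (T : fn -> Bop) :
  (forall U V A B, represents U A -> represents V B -> (raw_eqv U V <-> eqv A B)) ->
  (forall U A r, represents U A -> (raw_bound U r <-> bound A r)) ->
  (forall A r s, r <= s -> bound A r -> bound A s) ->
  (exists x, M x) -> homomorphism d M eqv bound C T ->
  (forall f s, cont_on d M f -> bound (T f) s -> sup_le M f s) ->
  isomorphic_hom raw_eqv raw_bound (ext_of T).
Proof.
  intros eqv_iff bound_iff bound_mono [x0 Mx0] T_hom T_below.
  assert (T_lift : forall f, represents (ext_of T f) (T f)) by (intros; apply represents_op_of_Bop).
  split; [|split; [|split; [|split; [|split; [|split]]]]].
  - intros f _. eapply bdd_of_represents, T_lift.
  - intros f g f_cont g_cont fg. eapply eqv_iff; eauto. apply (hom_ext T_hom); auto.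
  - intros f g f_cont g_cont. eapply eqv_iff; eauto using represents_add.
    apply (hom_add T_hom); auto.
  - intros c f f_cont. eapply eqv_iff; eauto using represents_scale. apply (hom_scale T_hom); auto.
  - intros f g f_cont g_cont. eapply eqv_iff; eauto using represents_comp.
    apply (hom_mul T_hom); auto.
  - eapply eqv_iff; eauto using represents_id. apply (hom_one T_hom).
  - pose proof (hom_bound_nonneg T_hom). exists (C + 1). split; [lra|]. intros f f_cont. split.
    + intros s Tf_le x Mx.
      pose proof (T_below f s f_cont (proj1 (bound_iff _ _ s (T_lift f)) Tf_le) x Mx).
      pose proof (Cnorm_nonneg (f x)). nra.
    + intros s f_le. apply (bound_iff _ _ _ (T_lift f)).
      apply bound_mono with (C * s); [|apply (hom_bounded T_hom); auto].
      pose proof (f_le x0 Mx0). pose proof (Cnorm_nonneg (f x0)). lra.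
Qed.

Lemma is_ext_ext_of (C : R) (T : fn -> Bop) : (exists x, M x) -> hom_mod d M C T ->
  calkin_bounded_below d M T -> is_ext p d M (ext_of T).
Proof.
  intros. apply (isomorphic_hom_ext_of calkin_eq calkin_norm_le (calk_eq p) (calk_norm_le p) C T);
    auto.
  - intros. apply calk_eq_iff; auto.
  - intros. apply calk_norm_le_iff; auto.
  - intros A r s. apply calkin_norm_le_weaken.
Qed.

Lemma trivial_ext_ext_of (C : R) (T : fn -> Bop) : (exists x, M x) -> representation d M C T ->
  calkin_bounded_below d M T -> trivial_ext p d M (ext_of T).
Proof.
  intros M_inhabited T_rep T_below. exists (ext_of T). split.
  - apply (isomorphic_hom_ext_of eq opnorm_le (op_eq p) (op_bound p) C T); auto.
    + intros. apply op_eq_iff; auto.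
    + intros. apply op_bound_iff; auto.
    + intros A r s. apply opnorm_le_mono.
    + intros f s f_cont Tf_le. apply T_below; auto. apply calkin_norm_le_of_opnorm_le. auto.
  - intros f _. apply (calk_eq_iff _ _ (T f) (T f)); [apply represents_op_of_Bop..|reflexivity].
Qed.

Lemma hom_mod_of_ext (Phi : fn -> op) : is_ext p d M Phi ->
  exists C T, hom_mod d M C T /\ lifts Phi T.
Proof.
  intros (Phi_bdd & Phi_ext & Phi_add & Phi_scale & Phi_mul & Phi_one & C & C_ge1 & Phi_norm).
  assert (Phi_lift : lifts Phi (fun f => Bop_of_op (Phi f))).
  { intros f f_cont. apply represents_Bop_of_op. auto. }
  exists C, (fun f => Bop_of_op (Phi f)). split; auto. split.
  - lra.
  - intros f g f_cont g_cont fg. apply (calk_eq_iff (Phi f) (Phi g)); auto.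
  - intros f g f_cont g_cont.
    apply (calk_eq_iff (Phi (fadd f g)) (op_add (Phi f) (Phi g))); auto using represents_add.
    apply Phi_lift, cont_add; auto.
  - intros c f f_cont.
    apply (calk_eq_iff (Phi (fscale c f)) (op_scale c (Phi f))); auto using represents_scale.
    apply Phi_lift, cont_scale; auto.
  - intros f g f_cont g_cont.
    apply (calk_eq_iff (Phi (fmul f g)) (op_comp (Phi f) (Phi g))); auto using represents_comp.
    apply Phi_lift, cont_mul; auto.
  - apply (calk_eq_iff (Phi fone) op_id); auto using represents_id. apply Phi_lift, cont_const.
  - intros f s f_cont f_le. apply (calk_norm_le_iff (Phi f)); auto. apply Phi_norm; auto.
Qed.

Lemma equiv_ext_iff (Phi1 Phi2 : fn -> op) (T1 T2 : fn -> Bop) :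
  lifts Phi1 T1 -> lifts Phi2 T2 -> (equiv_ext p d M Phi1 Phi2 <-> similar_mod d M T1 T2).
Proof.
  intros Phi1_lift Phi2_lift. split.
  - intros (S & S' & (S_bdd & S'_bdd & SS' & S'S) & Phi12).
    pose proof (represents_Bop_of_op S S_bdd). pose proof (represents_Bop_of_op S' S'_bdd).
    exists (Bop_of_op S), (Bop_of_op S'). split; [|split].
    + apply (op_eq_iff (op_comp S S') op_id); auto using represents_comp, represents_id.
    + apply (op_eq_iff (op_comp S' S) op_id); auto using represents_comp, represents_id.
    + intros f f_cont. apply (calk_eq_iff (Phi2 f) (op_comp S (op_comp (Phi1 f) S')));
        auto using represents_comp.
  - intros (S & S' & SS' & S'S & T12).
    pose proof (represents_op_of_Bop S). pose proof (represents_op_of_Bop S').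
    exists (op_of_Bop S), (op_of_Bop S'). split; [split; [|split; [|split]]|].
    + eapply bdd_of_represents; eauto.
    + eapply bdd_of_represents; eauto.
    + apply (op_eq_iff _ _ (S [*] S') bid); auto using represents_comp, represents_id.
    + apply (op_eq_iff _ _ (S' [*] S) bid); auto using represents_comp, represents_id.
    + intros f f_cont. apply (calk_eq_iff _ _ (T2 f) (S [*] (T1 f [*] S')));
        auto using represents_comp.
Qed.

End Transfer.

Theorem theorem1p1 (p : R) (d : nat) (M : pt -> Prop) :
  1 < p -> (1 <= d)%nat ->
  (exists x, M x) -> in_Rd d M -> compact_set d M ->
  exists Theta : fn -> op,
    is_ext p d M Theta /\ trivial_ext p d M Theta /\
    equiv_ext p d M Theta (sum_ext Theta Theta) /\
    (forall Phi, is_ext p d M Phi ->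
       exists Psi, is_ext p d M Psi /\ equiv_ext p d M Theta (sum_ext Phi Psi)) /\
    (forall Theta', is_ext p d M Theta' -> trivial_ext p d M Theta' ->
       equiv_ext p d M Theta' (sum_ext Theta' Theta') ->
       (forall Phi, is_ext p d M Phi ->
          exists Psi, is_ext p d M Psi /\ equiv_ext p d M Theta' (sum_ext Phi Psi)) ->
       equiv_ext p d M Theta Theta').
Proof.
  intros p_gt1 d_pos M_inhabited _ M_compact. pose (E := Exponent p p_gt1). change p with (@pexp E).
  destruct (absorbing_homomorphism_exists d M d_pos M_compact M_inhabited)
    as (U & [C U_rep] & U_below & U_double & U_absorbs).
  pose proof (hom_mod_of_representation d M C U U_rep) as U_hom.
  pose proof (is_ext_ext_of d M C U M_inhabited U_hom U_below) as U_ext.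
  exists (ext_of U). split; [exact U_ext|split; [|split; [|split]]].
  - exact (trivial_ext_ext_of d M C U M_inhabited U_rep U_below).
  - apply (equiv_ext_iff d M _ _ U (hom_dsum U U)); auto using lifts_ext_of, lifts_sum_ext.
  - intros Phi Phi_ext. destruct (hom_mod_of_ext d M Phi Phi_ext) as (B & T & T_hom & Phi_lift).
    destruct (U_absorbs B T T_hom) as (B' & T' & T'_hom & T'_below & U_split).
    exists (ext_of T'). split; [exact (is_ext_ext_of d M B' T' M_inhabited T'_hom T'_below)|].
    apply (equiv_ext_iff d M _ _ U (hom_dsum T T')); auto using lifts_ext_of, lifts_sum_ext.
  - intros Theta Theta_ext _ Theta_double Theta_absorbs.
    destruct (hom_mod_of_ext d M Theta Theta_ext) as (B & T & T_hom & Theta_lift).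
    apply (equiv_ext_iff d M _ _ U T); [apply lifts_ext_of|auto|].
    apply idempotent_absorbing_unique; auto.
    + apply (equiv_ext_iff d M Theta (sum_ext Theta Theta)); auto using lifts_sum_ext.
    + destruct (U_absorbs B T T_hom) as (B' & T' & _ & _ & U_split). eauto.
    + destruct (Theta_absorbs _ U_ext) as (Psi & Psi_ext & Theta_split).
      destruct (hom_mod_of_ext d M Psi Psi_ext) as (B' & T' & _ & Psi_lift). exists T'.
      apply (equiv_ext_iff d M Theta (sum_ext (ext_of U) Psi));
        auto using lifts_ext_of, lifts_sum_ext.
Qed.
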